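(* Let $\alpha>0$, $n\in\mathbb N$ and $k\in\{1,\ldots,n\}$ with $\alpha n>1$. Then $$ \tilde{\mathbf J}_{n,k}\Big(\frac{\alpha+n-1}{2}\Big)=\binom nk\int_{-\pi/2}^{\pi/2}\tilde c_{\frac{\alpha n}{2}}(\cos x)^{\alpha n-2}\Big(\frac12+i\int_0^x\tilde c_{\frac{\alpha+1}{2}}(\cos y)^{-\alpha}dy\Big)^{n-k}dx. $$
   Context: For $d\in\mathbb N$ and $\beta>d/2$ the $d$-dimensional beta' distribution has density $\tilde f_{d,\beta}(x)=\tilde c_{d,\beta}(1+\|x\|^2)^{-\beta}$, $x\in\mathbb R^d$, with $\tilde c_{d,\beta}=\Gamma(\beta)/(\pi^{d/2}\Gamma(\beta-\frac d2))$. Write $\tilde c_\beta:=\tilde c_{1,\beta}=\Gamma(\beta)/(\sqrt\pi\,\Gamma(\beta-\frac12))$. The internal angle $\beta(F,T)$ of a simplex $T\subset\mathbb R^d$ at a face $F$ is $\lim_{r\downarrow0}\mathrm{Vol}_d(B_r(z)\cap T)/\mathrm{Vol}_d(B_r(z))$, $z$ in the relative interior of $F$. For $n\ge2$, $\beta>\frac{n-1}{2}$ and $\tilde X_1,\ldots,\tilde X_n$ i.i.d. in $\mathbb R^{n-1}$ with density $\tilde f_{n-1,\beta}$, $\tilde{\mathbf J}_{n,k}(\beta)=\binom nk\,\mathbb E\,\beta([\tilde X_1,\ldots,\tilde X_k],[\tilde X_1,\ldots,\tilde X_n])$, $k\in\{1,\ldots,n\}$; by convention $\tilde{\mathbf J}_{n,n}(\beta)=1$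 for all $n\in\mathbb N$. Here $i=\sqrt{-1}$. *)

(* Defs.v *)
From HB Require Import structures.
From mathcomp Require Import all_boot all_order all_algebra.
From mathcomp Require Import all_classical all_reals all_analysis.
From mathcomp.real_closed Require Import complex.

Set Implicit Arguments.
Unset Strict Implicit.
Unset Printing Implicit Defensive.

Import Order.TTheory GRing.Theory Num.Theory.
Import numFieldNormedType.Exports.

Local Open Scope classical_set_scope.
Local Open Scope ring_scope.

Section Defs.
Variable R : realType.

Definition Gamma (s : R) : R :=
  Rintegral lebesgue_measure `]0, +oo[%classic (fun t => t `^ (s - 1) * expR (- t)).

(* Euclidean norm on R^d = 'rV[R]_d (the library norm on matrices is the sup norm). *)
Definition enorm (d : nat) (x : 'rV[R]_d) : R :=
  Num.sqrt (\sum_(i < d) x ord0 i ^+ 2).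

Definition eball (d : nat) (z : 'rV[R]_d) (r : R) : set 'rV[R]_d :=
  [set x | enorm (x - z) < r].

(* Lebesgue integral over R^d of a non-negative extended-real function,
   computed as the iterated one-dimensional Lebesgue integral (Tonelli). *)
Fixpoint intRd (d : nat) : ('rV[R]_d -> \bar R) -> \bar R :=
  match d return ('rV[R]_d -> \bar R) -> \bar R with
  | 0 => fun f => f 0
  | d'.+1 => fun f =>
      (\int[lebesgue_measure]_(t in [set: R])
         intRd (fun y : 'rV[R]_d' => f (row_mx (t%:M : 'M[R]_1) y)))%E
  end.

Definition vol (d : nat) (A : set 'rV[R]_d) : \bar R :=
  intRd (fun x => (\1_A x)%:E).

Definition ctd (d : nat) (b : R) : R :=
  Gamma b / (pi `^ (d%:R / 2) * Gamma (b - d%:R / 2)).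

Definition ct (b : R) : R := ctd 1 b.

Definition betap_density (d : nat) (b : R) (x : 'rV[R]_d) : R :=
  ctd d b * (1 + enorm x ^+ 2) `^ (- b).

Definition conv_rows (n d : nat) (X : 'M[R]_(n, d)) (P : pred 'I_n) : set 'rV[R]_d :=
  [set x | exists l : 'I_n -> R,
     [/\ forall i, 0 <= l i, forall i, ~~ P i -> l i = 0,
         \sum_(i < n) l i = 1 & x = \sum_(i < n) l i *: row i X]].

(* Internal angle of the simplex T at a face F, evaluated at a point z of the
   relative interior of F:  lim_{r -> 0+} Vol(B_r(z) /\ T) / Vol(B_r(z)). *)
Definition internal_angle_at (d : nat) (T : set 'rV[R]_d) (z : 'rV[R]_d) : R :=
  lim ((fun r : R => fine (vol (eball z r `&` T)) / fine (vol (eball z r)))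
         @ 0^'+).

(* beta([X_1..X_k], [X_1..X_n]) : z is the barycentre of X_1..X_k, which lies
   in the relative interior of the face [X_1,...,X_k]. *)
Definition face_angle (n d : nat) (X : 'M[R]_(n, d)) (k : nat) : R :=
  internal_angle_at (conv_rows X predT)
    ((k%:R)^-1 *: \sum_(i < n | (i < k)%N) row i X).

(* E beta([X_1..X_k],[X_1..X_n]) for X_1..X_n iid with density tilde f_{n-1,b}
   in R^(n-1): integral over (R^(n-1))^n of the angle times the product density. *)
Definition expected_angle (n k : nat) (b : R) : \bar R :=
  intRd (fun v : 'rV[R]_(n * n.-1) =>
    let X : 'M[R]_(n, n.-1) := vec_mx v in
    (face_angle X k * \prod_(i < n) betap_density b (row i X))%:E).

(* tilde J_{n,k}(beta), with the convention tilde J_{n,n} = 1. *)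
Definition Jt (n k : nat) (b : R) : R :=
  if k == n then 1 else 'C(n, k)%:R * fine (expected_angle n k b).

Definition oint (a b : R) (f : R -> R) : R :=
  if a <= b then Rintegral lebesgue_measure `[a, b] f
  else - Rintegral lebesgue_measure `[b, a] f.

Local Open Scope complex_scope.

Definition cintegral (a b : R) (g : R -> R[i]) : R[i] :=
  (Rintegral lebesgue_measure `[a, b] (fun x => complex.Re (g x)))%:C
  + (@Complex R 0 1) * (Rintegral lebesgue_measure `[a, b] (fun x => complex.Im (g x)))%:C.

End Defs.

(* Main.v *)
Require Import Defs.
From HB Require Import structures.
From mathcomp Require Import all_boot all_order all_algebra.
From mathcomp Require Import all_classical all_reals all_analysis.
From mathcomp Require Import measurable_realfun.
From mathcomp.real_closed Require Import complex polyrcf.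
From mathcomp Require Import ring lra.

Set Implicit Arguments.
Unset Strict Implicit.
Unset Printing Implicit Defensive.

Import Order.TTheory GRing.Theory Num.Theory.
Import numFieldNormedType.Exports.

Local Open Scope classical_set_scope.
Local Open Scope ring_scope.

(* Write [n = d + 1].  The angle of the simplex with vertices [X_0, ..., X_d] at its
   first [k] vertices is a Gaussian integral of [exp (- |sum_i h_i X_i|^2)] over a cone [K] of
   vectors [h] with [sum_i h_i = 0], times the Jacobian [|det (X_i - X_0)|].  Each
   density [(1 + |x|^2)^(-b)] is a Gamma mixture of Gaussians [exp (- t |x|^2)], so the [X_i] can be
   integrated out exactly; by homogeneity what remains is, up to a factor that does not depend on
   [K], the integral over [K] of [prod_i q (h_i)], where
   [q x = int t^((alpha - 3) / 2) exp (- t - x^2 / t) dt].  The factor is eliminated by comparison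
   with the case [k = n], where [K] is everything and the angle is 1.

   The constraint [sum_i h_i = 0] makes this a convolution at the origin, hence by Fourier inversion
   an integral of [A^k B^(n-k)], [A] and [B] being the Fourier transforms of [q] on the line and on
   the half-line.  Under [v = 2 tan x],
   [B v = sqrt pi * Gamma (alpha / 2) * cos^alpha x * (1/2 + i c int_0^x cos^(-alpha))]
   and [A = 2 Re B]; the imaginary part is a superposition of Dawson integrals. *)

Definition matrix_display : measure_display.
Proof. exact: default_measure_display. Qed.

Section measurable_matrix.
Variables (T : realType) (m n : nat).

Let coords : 'I_(m * n) -> 'M[T]_(m, n) -> T := fun i A => mxvec A ord0 i.

Let matrix_set0 : g_sigma_preimage coords set0.
Proof. exact: sigma_algebra0. Qed.

Let matrix_setC A : g_sigma_preimage coords A -> g_sigma_preimage coords (~` A).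
Proof. exact: sigma_algebraC. Qed.

Let matrix_bigcup (F : _^nat) : (forall i, g_sigma_preimage coords (F i)) ->
  g_sigma_preimage coords (\bigcup_i (F i)).
Proof. exact: sigma_algebra_bigcup. Qed.

HB.instance Definition _ := @isMeasurable.Build matrix_display
  'M[T]_(m, n) (g_sigma_preimage coords) matrix_set0 matrix_setC matrix_bigcup.

Lemma measurable_entry (i : 'I_m) (j : 'I_n) :
  measurable_fun [set: 'M[T]_(m, n)] (fun A : 'M[T]_(m, n) => A i j).
Proof.
move=> _ Y mY; rewrite setTI; apply: sub_sigma_algebra => /=.
rewrite -bigcup_seq/=; exists (mxvec_index i j) => /=.
  by rewrite mem_index_enum.
by exists Y => //; rewrite setTI; apply/seteqP; split=> A /=; rewrite /coords mxvecE.
Qed.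

Lemma measurable_fun_mxP (d : measure_display) (S : measurableType d)
    (f : S -> 'M[T]_(m, n)) :
  (forall i j, measurable_fun setT (fun x => f x i j)) -> measurable_fun setT f.
Proof.
move=> mf.
have mvec (k : 'I_(m * n)) : measurable_fun setT (fun x => mxvec (f x) ord0 k).
  case/mxvec_indexP: k => i j.
  by rewrite (_ : (fun x => _) = (fun x => f x i j)) //; apply/funext => x; rewrite mxvecE.
suff h : g_sigma_preimage (fun i => coords i \o f) `<=` measurable.
  move: h; rewrite g_sigma_preimage_comp => h.
  by move=> _ A mA; apply: h; exists A.
apply: smallest_sub; first exact: sigma_algebra_measurable.
by move=> A; rewrite -bigcup_seq /= => -[k _ [B mB <-]]; exact: mvec.
Qed.

End measurable_matrix.

Section measurable_functions.
Context (d : measure_display) (T : measurableType d) (R : realType).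
Implicit Types f : T -> R.

Lemma measurable_fun2_comp (d1 d2 d3 : measure_display) (T1 : measurableType d1)
    (T2 : measurableType d2) (T3 : measurableType d3)
    (h : T1 -> T2 -> T3) (a : T -> T1) (b : T -> T2) :
  measurable_fun setT (fun p : T1 * T2 => h p.1 p.2) ->
  measurable_fun setT a -> measurable_fun setT b ->
  measurable_fun setT (fun x => h (a x) (b x)).
Proof.
move=> mh ma mb; apply: (measurableT_comp mh (g := fun x => (a x, b x))).
exact: measurable_fun_pair.
Qed.

Lemma measurable_fun_invr f : measurable_fun setT f ->
  measurable_fun setT (fun x => (f x)^-1).
Proof.
move=> mf.
have -> : (fun x => (f x)^-1) = (fun x =>
    if f x < 0 then - (- f x) `^ (-1) else if f x == 0 then 0 else f x `^ (-1)).
  apply/funext => x; case: ltP => fx.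
    by rewrite powR_inv1 ?oppr_ge0 ?ltW // invrN opprK.
  by case: eqP => [->|_]; [rewrite invr0|rewrite powR_inv1].
have mV := measurable_powR (R := R) (-1).
apply: measurable_fun_ifT; first exact: measurable_fun_ltr.
  by apply: measurable_funN; apply: (measurableT_comp mV); exact: measurable_funN.
apply: measurable_fun_ifT => //; first exact: measurable_fun_eqr.
exact: (measurableT_comp mV).
Qed.

Lemma measurable_fun_indicator (b : T -> bool) : measurable_fun setT b ->
  measurable_fun setT (fun x => (b x)%:R : R).
Proof.
move=> mb; have -> : (fun x => (b x)%:R) = (fun x => if b x then 1 else 0 : R).
  by apply/funext => x; case: (b x).
exact: measurable_fun_ifT.
Qed.

Lemma measurable_fun_in_itv (i : interval R) f : measurable_fun setT f ->
  measurable_fun setT (fun x => f x \in i).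
Proof.
move=> mf; apply: (measurable_fun_bool true); rewrite setTI.
rewrite (_ : _ @^-1` _ = f @^-1` [set` i]); last by apply/seteqP; split.
by rewrite -[_ @^-1` _]setTI; apply: mf => //; exact: measurable_itv.
Qed.

Lemma measurable_fun_forall (I : finType) (h : I -> T -> bool) :
  (forall i, measurable_fun setT (h i)) ->
  measurable_fun setT (fun x => [forall i, h i x]).
Proof.
move=> mh; rewrite (_ : (fun x => _) = (fun x => \big[andb/true]_i h i x)); last first.
  by apply/funext => x; rewrite big_andE.
elim: (index_enum I) => [|i s IH].
  by under eq_fun do rewrite big_nil; exact: measurable_cst.
by under eq_fun do rewrite big_cons; exact: measurable_and.
Qed.

Lemma emeasurable_fun_prod (I : Type) (s : seq I) (h : I -> T -> \bar R) :
  (forall i, measurable_fun setT (h i)) ->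
  measurable_fun setT (fun x => \prod_(i <- s) h i x)%E.
Proof.
move=> mh; elim: s => [|i s IH].
  by under eq_fun do rewrite big_nil; exact: measurable_cst.
by under eq_fun do rewrite big_cons; exact: emeasurable_funM.
Qed.

Lemma measurable_fun_integral (h : T -> R -> \bar R) :
  measurable_fun setT (fun p : T * R => h p.1 p.2) -> (forall x y, 0 <= h x y)%E ->
  measurable_fun setT (fun x => \int[lebesgue_measure]_y h x y)%E.
Proof.
move=> mh h0; apply: (measurable_fun_fubini_tonelli_F (m2 := @lebesgue_measure R)
  (fun p : T * R => h p.1 p.2)) => //.
Qed.

Section matrices.
Variables m n p : nat.
Implicit Types (X : T -> 'M[R]_(m, n)) (Y : T -> 'M[R]_(n, p)).

Lemma measurable_fun_entry X i j :
  measurable_fun setT X -> measurable_fun setT (fun x => X x i j).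
Proof. exact: measurableT_comp (measurable_entry i j). Qed.

Lemma measurable_fun_matrix_of_fun (E : T -> 'I_m -> 'I_n -> R) :
  (forall i j, measurable_fun setT (fun x => E x i j)) ->
  measurable_fun setT (fun x => \matrix_(i, j) E x i j).
Proof.
by move=> mE; apply: measurable_fun_mxP => i j; under eq_fun do rewrite mxE; exact: mE.
Qed.

Lemma measurable_fun_addmx X (X' : T -> 'M[R]_(m, n)) : measurable_fun setT X ->
  measurable_fun setT X' -> measurable_fun setT (fun x => X x + X' x).
Proof.
move=> mX mX'; apply: measurable_fun_mxP => i j; under eq_fun do rewrite mxE.
by apply: measurable_funD; exact: measurable_fun_entry.
Qed.

Lemma measurable_fun_oppmx X :
  measurable_fun setT X -> measurable_fun setT (fun x => - X x).
Proof.
move=> mX; apply: measurable_fun_mxP => i j; under eq_fun do rewrite mxE.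
by apply: measurable_funN; exact: measurable_fun_entry.
Qed.

Lemma measurable_fun_scalemx f X : measurable_fun setT f ->
  measurable_fun setT X -> measurable_fun setT (fun x => f x *: X x).
Proof.
move=> mf mX; apply: measurable_fun_mxP => i j; under eq_fun do rewrite mxE.
by apply: measurable_funM => //; exact: measurable_fun_entry.
Qed.

Lemma measurable_fun_trmx X :
  measurable_fun setT X -> measurable_fun setT (fun x => (X x)^T).
Proof.
move=> mX; apply: measurable_fun_mxP => i j; under eq_fun do rewrite mxE.
exact: measurable_fun_entry.
Qed.

Lemma measurable_fun_row X i :
  measurable_fun setT X -> measurable_fun setT (fun x => row i (X x)).
Proof.
move=> mX; apply: measurable_fun_mxP => i' j; under eq_fun do rewrite mxE.
exact: measurable_fun_entry.
Qed.

Lemma measurable_fun_vec_mx (V : T -> 'rV[R]_(m * n)) :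
  measurable_fun setT V -> measurable_fun setT (fun x => vec_mx (V x)).
Proof.
move=> mV; apply: measurable_fun_mxP => i j; under eq_fun do rewrite mxE.
exact: (measurableT_comp (measurable_entry _ _) mV).
Qed.

End matrices.

Lemma measurable_fun_mulmx m n p (X : T -> 'M[R]_(m, n)) (Y : T -> 'M[R]_(n, p)) :
  measurable_fun setT X -> measurable_fun setT Y ->
  measurable_fun setT (fun x => X x *m Y x).
Proof.
move=> mX mY; apply: measurable_fun_mxP => i j; under eq_fun do rewrite mxE.
by apply: measurable_sum => k; apply: measurable_funM; exact: measurable_fun_entry.
Qed.

Lemma measurable_fun_scalar_mx n f : measurable_fun setT f ->
  measurable_fun setT (fun x => (f x)%:M : 'M[R]_n).
Proof.
move=> mf; apply: measurable_fun_mxP => i j; under eq_fun do rewrite mxE.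
by case: (i == j) => //; under eq_fun do rewrite mulr0n; exact: measurable_cst.
Qed.

Lemma measurable_fun_row_mx m n p (X : T -> 'M[R]_(m, n)) (Y : T -> 'M[R]_(m, p)) :
  measurable_fun setT X -> measurable_fun setT Y ->
  measurable_fun setT (fun x => row_mx (X x) (Y x)).
Proof.
move=> mX mY; apply: measurable_fun_mxP => i j; case: (split_ordP j) => k ->.
  by under eq_fun do rewrite row_mxEl; exact: measurable_fun_entry.
by under eq_fun do rewrite row_mxEr; exact: measurable_fun_entry.
Qed.

Lemma measurable_fun_col_mx m n p (X : T -> 'M[R]_(m, p)) (Y : T -> 'M[R]_(n, p)) :
  measurable_fun setT X -> measurable_fun setT Y ->
  measurable_fun setT (fun x => col_mx (X x) (Y x)).
Proof.
move=> mX mY; apply: measurable_fun_mxP => i j; case: (split_ordP i) => k ->.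
  by under eq_fun do rewrite col_mxEu; exact: measurable_fun_entry.
by under eq_fun do rewrite col_mxEd; exact: measurable_fun_entry.
Qed.

Lemma measurable_fun_dsubmx m n p (X : T -> 'M[R]_(m + n, p)) :
  measurable_fun setT X -> measurable_fun setT (fun x => dsubmx (X x)).
Proof.
move=> mX; apply: measurable_fun_mxP => i j; under eq_fun do rewrite mxE.
exact: measurable_fun_entry.
Qed.

Lemma measurable_fun_determinant n (X : T -> 'M[R]_n) :
  measurable_fun setT X -> measurable_fun setT (fun x => \det (X x)).
Proof.
move=> mX; rewrite /determinant; apply: measurable_sum => s.
apply: measurable_funM => //.
by apply: measurable_prod => i _; exact: measurable_fun_entry.
Qed.

Lemma measurable_fun_enorm n (X : T -> 'rV[R]_n) :
  measurable_fun setT X -> measurable_fun setT (fun x => enorm (X x)).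
Proof.
move=> mX; apply: (measurableT_comp (continuous_measurable_fun (@sqrt_continuous R))).
apply: measurable_sum => i; apply: measurable_funX.
exact: measurable_fun_entry.
Qed.

End measurable_functions.

Section iterated_integral.
Variable R : realType.
Local Open Scope ereal_scope.

Lemma eq_intRd d (f g : 'rV[R]_d -> \bar R) : f =1 g -> intRd f = intRd g.
Proof. by move=> /funext ->. Qed.

Lemma intRd_ge0 d (f : 'rV[R]_d -> \bar R) : (forall x, 0 <= f x) -> 0 <= intRd f.
Proof.
elim: d f => [|d IH] f f0 //=; apply: integral_ge0 => t _.
by apply: IH.
Qed.

Lemma measurable_fun_intRd d (e : measure_display) (T : measurableType e)
    (f : T -> 'rV[R]_d -> \bar R) :
  measurable_fun setT (fun p : T * 'rV[R]_d => f p.1 p.2) -> (forall x y, 0 <= f x y) ->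
  measurable_fun setT (fun x => intRd (f x)).
Proof.
elim: d e T f => [|d IH] e T f mf f0 /=; first exact: measurable_fun_pair1 mf.
apply: (measurable_fun_integral
  (h := fun x t => intRd (fun y => f x (row_mx (t%:M : 'M[R]_1) y)))); last first.
  by move=> x t; exact: intRd_ge0.
apply: (IH _ (T * R)%type (fun p y => f p.1 (row_mx (p.2%:M : 'M[R]_1) y))) => //.
apply: (measurable_fun2_comp mf).
  exact: measurableT_comp measurable_fst measurable_fst.
apply: (@measurable_fun_row_mx _ _ _ 1 1 d) => //; apply: measurable_fun_scalar_mx.
exact: measurableT_comp measurable_snd measurable_fst.
Qed.

Definition intM m n (f : 'M[R]_(m, n) -> \bar R) : \bar R :=
  intRd (fun v : 'rV[R]_(m * n) => f (vec_mx v)).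

Lemma eq_intM m n (f g : 'M[R]_(m, n) -> \bar R) : f =1 g -> intM f = intM g.
Proof. by move=> /funext ->. Qed.

Lemma intM_ge0 m n (f : 'M[R]_(m, n) -> \bar R) : (forall x, 0 <= f x) -> 0 <= intM f.
Proof. by move=> f0; apply: intRd_ge0. Qed.

Lemma measurable_fun_intM m n (e : measure_display) (T : measurableType e)
    (f : T -> 'M[R]_(m, n) -> \bar R) :
  measurable_fun setT (fun p : T * 'M[R]_(m, n) => f p.1 p.2) -> (forall x y, 0 <= f x y) ->
  measurable_fun setT (fun x => intM (f x)).
Proof.
move=> mf f0; apply: (measurable_fun_intRd (f := fun x v => f x (vec_mx v))) => //.
by apply: (measurable_fun2_comp mf) => //; exact: measurable_fun_vec_mx.
Qed.

End iterated_integral.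

Create HintDb measurable_fun.
Create HintDb nonneg.

Ltac nonneg_step :=
  lazymatch goal with
  | |- forall _, _ => intro
  | |- is_true (Order.le _ ?x) =>
    first [ assumption | by [] | lazymatch x with
    | EFin _ => rewrite lee_fin
    | GRing.mul _ _ => apply: mulr_ge0
    | GRing.add _ _ => first [apply: addr_ge0 | apply: adde_ge0]
    | GRing.exp _ _ => first [exact: sqr_ge0 | apply: exprn_ge0]
    | GRing.inv _ => rewrite invr_ge0
    | Num.sqrt _ => exact: sqrtr_ge0
    | powR _ _ => exact: powR_ge0
    | expR _ => exact: expR_ge0
    | enorm _ => exact: sqrtr_ge0
    | mule _ _ => apply: mule_ge0
    | integral _ _ _ => apply: integral_ge0
    | intRd _ => apply: intRd_ge0
    | intM _ => apply: intM_ge0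
    | bigop _ _ _ => first [apply: sumr_ge0 | apply: prodr_ge0 | apply: prode_ge0]
    | _ => first [solve [auto with nonneg nocore] | apply: ltW; first [by [] | solve [auto with nonneg nocore]]]
    end ]
  end; cbv beta.
Ltac nonneg := repeat nonneg_step.

Ltac measurable_atom :=
  first [ assumption | exact: measurable_cst | exact: measurable_id | exact: measurable_fst
        | exact: measurable_snd | exact: measurable_swap
        | exact: measurable_expR | exact: measurable_powR | exact: normr_measurable
        | exact: (continuous_measurable_fun (@sqrt_continuous _))
        | exact: (continuous_measurable_fun (@continuous_cos _))
        | exact: (continuous_measurable_fun (@continuous_sin _))
        | exact: EFin_measurable | exact: (@fine_measurable _ setT measurableT)
        | solve [auto with measurable_fun nocore] ].

(* Syntax-directed: one rule per head symbol, then composition with a function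
   known to be measurable (a hypothesis or an entry of the hint database). *)
Ltac measurable_step :=
  lazymatch goal with
  | |- measurable_fun _ ?F =>
    first [ assumption | lazymatch F with
    | fun x => x => exact: measurable_id
    | fun _ => ?c => exact: measurable_cst
    | fun x => fst (@?g x) => apply: (measurableT_comp measurable_fst (g := g))
    | fun x => snd (@?g x) => apply: (measurableT_comp measurable_snd (g := g))
    | fun x => pair _ _ => apply: measurable_fun_pair
    | fun x => GRing.add (@?f x) (@?g x) =>
      first [ apply: (measurable_funD (f := f) (g := g)) | apply: emeasurable_funD
            | apply: measurable_fun_addmx ]
    | fun x => GRing.opp (@?f x) =>
      first [apply: (measurable_funN (f := f)) | apply: measurable_fun_oppmx]
    | fun x => GRing.mul (@?f x) (@?g x) => apply: (measurable_funM (f := f) (g := g))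
    | fun x => GRing.exp (@?f x) _ => apply: (measurable_funX (f := f))
    | fun x => GRing.inv _ => apply: measurable_fun_invr
    | fun x => GRing.scale _ _ => apply: measurable_fun_scalemx
    | fun x => GRing.natmul _ (nat_of_bool _) => apply: measurable_fun_indicator
    | fun x => powR (@?f x) ?p => apply: (measurableT_comp (measurable_powR p) (g := f))
    | fun x => andb _ _ => apply: measurable_and
    | fun x => negb _ => apply: measurable_neg
    | fun x => Order.lt _ _ => apply: measurable_fun_ltr
    | fun x => Order.le _ _ => apply: measurable_fun_ler
    | fun x => eq_op _ _ => apply: measurable_fun_eqr
    | fun x => in_mem _ (@mem _ (itvPredType _) _) => apply: measurable_fun_in_itv
    | fun x => if _ then _ else _ => apply: measurable_fun_ifT
    | fun x => mule _ _ => apply: emeasurable_funM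
    | fun x => determinant _ => apply: measurable_fun_determinant
    | fun x => enorm _ => apply: measurable_fun_enorm
    | fun x => mulmx _ _ => apply: measurable_fun_mulmx
    | fun x => trmx _ => apply: measurable_fun_trmx
    | fun x => row _ _ => apply: measurable_fun_row
    | fun x => scalar_mx _ => apply: measurable_fun_scalar_mx
    | fun x => @row_mx _ ?m ?n ?p _ _ => apply: (@measurable_fun_row_mx _ _ _ m n p)
    | fun x => @col_mx _ ?m ?n ?p _ _ => apply: (@measurable_fun_col_mx _ _ _ m n p)
    | fun x => @dsubmx _ ?m ?n ?p _ => apply: (@measurable_fun_dsubmx _ _ _ m n p)
    | @vec_mx _ ?m ?n => apply: (@measurable_fun_vec_mx _ _ _ m n id)
    | fun x => @vec_mx _ ?m ?n _ => apply: (@measurable_fun_vec_mx _ _ _ m n)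
    | fun x => fun_of_matrix _ _ _ => apply: measurable_fun_entry
    | fun x => matrix_of_fun _ _ => apply: measurable_fun_matrix_of_fun
    | fun x => FiniteQuant.quant0b _ => apply: measurable_fun_forall
    | fun x => bigop _ _ _ =>
      first [apply: measurable_sum | apply: measurable_prod | apply: emeasurable_fun_prod]
    | fun x => @intRd _ ?d (@?f x) =>
      apply: (measurable_fun_intRd (d := d) (f := f)); [|solve [nonneg]]
    | fun x => @intM _ ?m ?n (@?f x) =>
      apply: (measurable_fun_intM (m := m) (n := n) (f := f)); [|solve [nonneg]]
    | fun x => @integral _ _ _ _ setT (@?f x) =>
      apply: (measurable_fun_integral (h := f)); [|solve [nonneg]]
    | fun x => ?f (@?g x) => first
      [ apply: (measurableT_comp (f := f) _ (g := g)); [measurable_atom|]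
      | lazymatch F with fun x => ?h (@?u x) (@?v x) =>
          apply: (measurable_fun2_comp (h := h) _ (a := u) (b := v)); [measurable_atom| |]
        end ]
    | fun x => _ => fail
    | _ => first [measurable_atom | lazymatch goal with
           | |- @measurable_fun ?d1 ?d2 ?T ?U ?D ?F =>
             progress change (@measurable_fun d1 d2 T U D (fun x => F x))
           end]
    end ]
  | |- forall _, _ => intro
  end; cbv beta.
Ltac measurability := repeat measurable_step.

Ltac integral_side := first [exact: measurableT | by measurability | by nonneg].

Section iterated_integral_theory.
Variable R : realType.
Local Notation mu := (@lebesgue_measure R).
Local Open Scope ereal_scope.

Lemma intRd0 d : intRd (fun _ : 'rV[R]_d => 0) = 0.
Proof. by elim: d => //= d IH; rewrite integral0_eq. Qed.

Lemma intRd_integral d (f : R -> 'rV[R]_d -> \bar R) :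
  measurable_fun setT (fun p : R * 'rV[R]_d => f p.1 p.2) -> (forall x y, 0 <= f x y) ->
  intRd (fun y => \int[mu]_x f x y) = \int[mu]_x intRd (f x).
Proof.
elim: d f => [|d IH] f mf f0 //=.
transitivity (\int[mu]_t \int[mu]_x intRd (fun y => f x (row_mx (t%:M : 'M[R]_1) y))).
  by apply: eq_integral => t _; apply: IH => //; measurability.
rewrite [LHS](fubini_tonelli (m1 := mu) (m2 := mu)
  (fun p : R * R => intRd (fun y => f p.2 (row_mx (p.1%:M : 'M[R]_1) y)))) //.
- by measurability.
- by nonneg.
Qed.

Lemma intRd_swap d e (f : 'rV[R]_d -> 'rV[R]_e -> \bar R) :
  measurable_fun setT (fun p : 'rV[R]_d * 'rV[R]_e => f p.1 p.2) ->
  (forall x y, 0 <= f x y) ->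
  intRd (fun x => intRd (f x)) = intRd (fun y => intRd (f^~ y)).
Proof.
elim: d f => [|d IH] f mf f0 //=.
transitivity (\int[mu]_t intRd (fun y => intRd (fun x => f (row_mx (t%:M : 'M[R]_1) x) y))).
  apply: eq_integral => t _; apply: (IH (fun x y => f (row_mx (t%:M : 'M[R]_1) x) y)) => //.
  by measurability.
rewrite -(intRd_integral (f := fun t y => intRd (fun x => f (row_mx (t%:M : 'M[R]_1) x) y))) //.
- by measurability.
- by nonneg.
Qed.

Lemma intRdZl d (k : \bar R) (f : 'rV[R]_d -> \bar R) : measurable_fun setT f ->
  (forall x, 0 <= f x) -> 0 <= k -> intRd (fun x => k * f x) = k * intRd f.
Proof.
move=> + + k0; elim: d f => [|d IH] f mf f0 //=.
rewrite -ge0_integralZl //; [|integral_side..].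
by apply: eq_integral => t _; rewrite IH //; measurability.
Qed.

Lemma intRdD d (f g : 'rV[R]_d -> \bar R) :
  measurable_fun setT f -> measurable_fun setT g ->
  (forall x, 0 <= f x) -> (forall x, 0 <= g x) ->
  intRd (fun x => f x + g x) = intRd f + intRd g.
Proof.
elim: d f g => [|d IH] f g mf mg f0 g0 //=.
rewrite -ge0_integralD //; [|integral_side..].
by apply: eq_integral => t _; rewrite IH //; measurability.
Qed.

Lemma le_intRd d (f g : 'rV[R]_d -> \bar R) :
  measurable_fun setT f -> measurable_fun setT g ->
  (forall x, 0 <= f x) -> (forall x, f x <= g x) -> intRd f <= intRd g.
Proof.
elim: d f g => [|d IH] f g mf mg f0 fg //=.
have g0 x : 0 <= g x by exact: le_trans (fg x).
apply: ge0_le_integral => //; [integral_side..|].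
by move=> t _; apply: IH => //; measurability.
Qed.

Lemma intRd_cat d e (f : 'rV[R]_(d + e) -> \bar R) :
  intRd f = intRd (fun x : 'rV[R]_d => intRd (fun y : 'rV[R]_e => f (row_mx x y))).
Proof.
elim: d f => [|d IH] f /=.
  apply: eq_intRd => y; congr f; apply/rowP => i; rewrite mxE.
  by case: splitP => [[]//|k ik]; congr (y _ _); exact/val_inj.
apply: eq_integral => t _; rewrite IH.
apply: eq_intRd => x; apply: eq_intRd => y; congr f.
by rewrite row_mxA; exact: castmx_id.
Qed.

End iterated_integral_theory.

Section matrix_entries.

Lemma index_allpairs (S T : eqType) (s : seq S) (t : seq T) x y :
  x \in s -> y \in t ->
  index (x, y) [seq (a, b) | a <- s, b <- t] = (index x s * size t + index y t)%N.
Proof.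
move=> + yt; elim: s => //= a s IH; rewrite inE index_cat.
have [->|xa] /= := eqVneq x a.
  move=> _; rewrite mem_map; last by move=> ? ? [].
  by rewrite yt index_map // => ? ? [].
move=> xs; rewrite (negbTE (_ : _ \notin _)); last first.
  by apply/mapP => -[b _ [xa' _]]; rewrite xa' eqxx in xa.
by rewrite size_map IH // mulSn addnA.
Qed.

Lemma mxvec_indexE m n (i : 'I_m) (j : 'I_n) :
  mxvec_index i j = (i * n + j)%N :> nat.
Proof.
rewrite /mxvec_index /=.
have -> : enum_rank (i, j) = index (i, j) (enum {: 'I_m * 'I_n}) :> nat.
  rewrite -[X in index X _](nth_enum_rank (i, j)) index_uniq ?enum_uniq //.
  by rewrite -cardE.
rewrite enumT unlock /= /prod_enum index_allpairs ?mem_enum //.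
by rewrite !index_enum_ord size_enum_ord.
Qed.

Lemma vec_mx_row_mx (R : nzRingType) m n (r : 'rV[R]_n) (w : 'rV[R]_(m * n)) :
  vec_mx (row_mx r w : 'rV[R]_(m.+1 * n)) = col_mx r (vec_mx w) :> 'M[R]_(1 + m, n).
Proof.
apply/matrixP => i j; rewrite [LHS]mxE; case: (split_ordP i) => k ->.
  rewrite ord1 col_mxEu.
  have -> : @mxvec_index m.+1 n (@lshift 1 m ord0) j = lshift (m * n) j.
    by apply/val_inj; rewrite [LHS]mxvec_indexE mul0n.
  by rewrite row_mxEl.
rewrite col_mxEd [RHS]mxE.
have -> : @mxvec_index m.+1 n (@rshift 1 m k) j = rshift n (mxvec_index k j).
  apply/val_inj; rewrite [LHS]mxvec_indexE /=.
  by rewrite -[RHS]/(n + mxvec_index k j)%N mxvec_indexE addnA -mulSn.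
by rewrite row_mxEr.
Qed.

Lemma row_mx_ord0 (R : Type) m n (x : 'cV[R]_m) (y : 'M[R]_(m, n)) i :
  row_mx x y i (ord0 : 'I_n.+1) = x i ord0.
Proof. by rewrite -(row_mxEl x y) lshift0. Qed.

Lemma row_mx_lift0 (R : Type) m n (x : 'cV[R]_m) (y : 'M[R]_(m, n)) i j :
  row_mx x y i (lift ord0 j : 'I_n.+1) = y i j.
Proof. by rewrite -rshift1 row_mxEr. Qed.

Lemma col_mx_ord0 (R : Type) m n (x : 'rV[R]_n) (y : 'M[R]_(m, n)) j :
  col_mx x y (ord0 : 'I_m.+1) j = x ord0 j.
Proof. by rewrite -(col_mxEu x y) lshift0. Qed.

Lemma col_mx_lift0 (R : Type) m n (x : 'rV[R]_n) (y : 'M[R]_(m, n)) i j :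
  col_mx x y (lift ord0 i : 'I_m.+1) j = y i j.
Proof. by rewrite -rshift1 col_mxEd. Qed.

End matrix_entries.

Section affine_substitution.
Variable R : realType.
Local Notation mu := (@lebesgue_measure R).
Local Open Scope ereal_scope.
Implicit Type f : R -> \bar R.

Lemma ge0_integral_affine_gt0 (a c : R) f : (0 < a)%R ->
  measurable_fun setT f -> (forall x, 0 <= f x) ->
  a%:E * \int[mu]_x f (a * x + c)%R = \int[mu]_x f x.
Proof.
move=> a0 mf f0.
pose phi (x : R) : measurableTypeR R := (a * x + c)%R.
have mphi : measurable_fun [set: measurableTypeR R] phi.
  by apply: measurable_funD => //; exact: measurable_funM.
pose nu := mscale (NngNum (ltW a0)) (pushforward mu phi).
transitivity (\int[nu mphi]_x f x).
  by rewrite ge0_integral_mscale // ge0_integral_pushforward // preimage_setT.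
apply: eq_measure_integral => A mA _; apply/esym.
apply: lebesgue_measure_unique => // _ [[s t]] _ <-.
rewrite /= /mscale /= /pushforward.
have -> : phi @^-1` `]s, t] = `](s - c) / a, (t - c) / a]%classic%R.
  apply/seteqP; split => x /=; rewrite !in_itv /= /phi ltr_pdivrMr // ler_pdivlMr //;
  by rewrite ltrBlDr lerBrDr (mulrC a).
rewrite !lebesgue_measure_itv /= !lte_fin ltr_pM2r ?invr_gt0 // ltrD2r.
case: ifP => // _; last by rewrite mule0.
by rewrite -!EFinB -EFinM; congr EFin; field; rewrite gt_eqF.
Qed.

Lemma ge0_integral_opp f : measurable_fun setT f -> (forall x, 0 <= f x) ->
  \int[mu]_x f (- x)%R = \int[mu]_x f x.
Proof.
move=> mf f0.
transitivity (\int[pushforward mu (-%R : R -> measurableTypeR R)]_x f x).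
  by rewrite ge0_integral_pushforward // preimage_setT.
by apply: eq_measure_integral => A mA _; exact: lebesgue_measureN.
Qed.

Lemma ge0_integral_affine (a c : R) f : (a != 0)%R ->
  measurable_fun setT f -> (forall x, 0 <= f x) ->
  `|a|%:E * \int[mu]_x f (a * x + c)%R = \int[mu]_x f x.
Proof.
move=> a0 mf f0; case: (ltP 0%R a) => [ap|aN].
  by rewrite gtr0_norm // ge0_integral_affine_gt0.
have ap : (0 < - a)%R by rewrite oppr_gt0 lt_neqAle a0.
rewrite ltr0_norm -?oppr_gt0 // -ge0_integral_opp; [|integral_side..].
rewrite -(ge0_integral_affine_gt0 c ap mf f0); congr (_ * _).
by apply: eq_integral => x _; rewrite mulrN mulNr.
Qed.

Lemma ge0_integral_scale (a : R) f : (a != 0)%R ->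
  measurable_fun setT f -> (forall x, 0 <= f x) ->
  \int[mu]_x f (a * x)%R = `|a|^-1%:E * \int[mu]_x f x.
Proof.
move=> a0 mf f0; rewrite -(ge0_integral_affine 0 a0 mf f0) muleA -EFinM.
rewrite mulVf ?normr_eq0 // mul1e.
by apply: eq_integral => x _; rewrite addr0.
Qed.

Lemma intRd_affine d (a : R) (c : 'rV[R]_d) (f : 'rV[R]_d -> \bar R) : (a != 0)%R ->
  measurable_fun setT f -> (forall x, 0 <= f x) ->
  (`|a| ^+ d)%:E * intRd (fun x => f (a *: x + c)%R) = intRd f.
Proof.
move=> a0; elim: d c f => [|d IH] c f mf f0.
  by rewrite expr0 mul1e /=; congr f; rewrite [LHS]thinmx0.
pose c0 := lsubmx (c : 'rV[R]_(1 + d)) ord0 ord0.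
pose c' := rsubmx (c : 'rV[R]_(1 + d)).
have affine_row t y : (a *: row_mx (t%:M : 'M[R]_1) y + c =
    row_mx ((a * t + c0)%:M : 'M[R]_1) (a *: y + c'))%R.
  rewrite -[c in LHS](hsubmxK (c : 'rV[R]_(1 + d))) scale_row_mx add_row_mx.
  by congr row_mx; apply/matrixP => i j; rewrite !ord1 !mxE //= !mulr1n /c0 mxE.
transitivity ((`|a| ^+ d.+1)%:E * \int[mu]_t
    intRd (fun y => f (row_mx ((a * t + c0)%:M : 'M[R]_1) (a *: y + c')%R))).
  by congr (_ * _); apply: eq_integral => t _; apply: eq_intRd => y; rewrite affine_row.
pose g s := intRd (fun y => f (row_mx (s%:M : 'M[R]_1) y)).
have mg : measurable_fun setT g by rewrite /g; measurability.
have g0 s : 0 <= g s by exact: intRd_ge0.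
rewrite -[RHS](ge0_integral_affine c0 a0 mg g0) exprS EFinM -muleA; congr (_ * _).
rewrite -ge0_integralZl //; [|integral_side..].
apply: eq_integral => t _.
rewrite -[RHS](IH c' (fun y => f (row_mx ((a * t + c0)%:M : 'M[R]_1) y))) //.
by measurability.
Qed.

Lemma intRd_shift d (c : 'rV[R]_d) (f : 'rV[R]_d -> \bar R) :
  measurable_fun setT f -> (forall x, 0 <= f x) ->
  intRd (fun x => f (x + c)%R) = intRd f.
Proof.
move=> mf f0; rewrite -[RHS](intRd_affine c (oner_neq0 _) mf f0) normr1 expr1n mul1e.
by apply: eq_intRd => x; rewrite scale1r.
Qed.

Lemma intRd_scale d (a : R) (f : 'rV[R]_d -> \bar R) : (a != 0)%R ->
  measurable_fun setT f -> (forall x, 0 <= f x) ->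
  (`|a| ^+ d)%:E * intRd (fun x => f (a *: x)%R) = intRd f.
Proof.
move=> a0 mf f0; rewrite -[RHS](intRd_affine 0 a0 mf f0); congr (_ * _).
by apply: eq_intRd => x; rewrite addr0.
Qed.

End affine_substitution.

Section matrix_integral.
Variable R : realType.
Local Open Scope ereal_scope.

Lemma intM0 n (f : 'M[R]_(0, n) -> \bar R) : intM f = f 0%R.
Proof. by rewrite /intM /=; congr f; rewrite [LHS]flatmx0. Qed.

Lemma intMS m n (f : 'M[R]_(m.+1, n) -> \bar R) :
  intM f = intRd (fun r => intM (fun Y : 'M[R]_(m, n) => f (col_mx r Y : 'M[R]_(1 + m, n)))).
Proof.
rewrite /intM (intRd_cat (d := n) (e := m * n)).
by apply: eq_intRd => r; apply: eq_intRd => w; rewrite vec_mx_row_mx.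
Qed.

Lemma intM_intRd_swap m n e (f : 'M[R]_(m, n) -> 'rV[R]_e -> \bar R) :
  measurable_fun setT (fun p : 'M[R]_(m, n) * 'rV[R]_e => f p.1 p.2) ->
  (forall x y, 0 <= f x y) ->
  intM (fun x => intRd (f x)) = intRd (fun y => intM (f^~ y)).
Proof.
by move=> mf f0; apply: (intRd_swap (f := fun v y => f (vec_mx v) y)); [measurability|].
Qed.

Lemma intM_integral m n (f : R -> 'M[R]_(m, n) -> \bar R) :
  measurable_fun setT (fun p : R * 'M[R]_(m, n) => f p.1 p.2) -> (forall x y, 0 <= f x y) ->
  intM (fun y => \int[lebesgue_measure]_x f x y) = \int[lebesgue_measure]_x intM (f x).
Proof.
by move=> mf f0; apply: (intRd_integral (f := fun x v => f x (vec_mx v))); [measurability|].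
Qed.

Lemma intMZl m n (k : \bar R) (f : 'M[R]_(m, n) -> \bar R) : measurable_fun setT f ->
  (forall x, 0 <= f x) -> 0 <= k -> intM (fun x => k * f x) = k * intM f.
Proof. by move=> mf f0 k0; apply: intRdZl => //; measurability. Qed.

Lemma intMD m n (f g : 'M[R]_(m, n) -> \bar R) :
  measurable_fun setT f -> measurable_fun setT g ->
  (forall x, 0 <= f x) -> (forall x, 0 <= g x) ->
  intM (fun x => f x + g x) = intM f + intM g.
Proof. by move=> mf mg f0 g0; apply: intRdD => //; measurability. Qed.

Lemma le_intM m n (f g : 'M[R]_(m, n) -> \bar R) :
  measurable_fun setT f -> measurable_fun setT g ->
  (forall x, 0 <= f x) -> (forall x, f x <= g x) -> intM f <= intM g.
Proof. by move=> mf mg f0 fg; apply: le_intRd => //; measurability. Qed.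

Lemma intM_shift m n (C : 'M[R]_(m, n)) (f : 'M[R]_(m, n) -> \bar R) :
  measurable_fun setT f -> (forall x, 0 <= f x) ->
  intM (fun x => f (x + C)%R) = intM f.
Proof.
move=> mf f0; rewrite /intM -[RHS](intRd_shift (mxvec C)) //; last by measurability.
by apply: eq_intRd => v; rewrite linearD /= mxvecK.
Qed.

Lemma intM_col d (f : 'cV[R]_d -> \bar R) : intM f = intRd (fun x : 'rV[R]_d => f x^T).
Proof.
elim: d f => [|d IH] f; first by rewrite intM0 /=; congr f; rewrite [RHS]flatmx0.
rewrite intMS /=; apply: eq_integral => t _; rewrite IH; apply: eq_intRd => y; congr f.
transitivity (col_mx (t%:M : 'M[R]_1)^T y^T); last by rewrite -(@tr_row_mx _ 1 1 d).
suff -> : row_mx (t%:M : 'M[R]_1) (0%R : 'rV[R]_0) = (t%:M : 'M[R]_1)^T :> 'rV[R]_1 by [].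
by apply/matrixP => i j; rewrite !ord1 (@row_mx_ord0 _ 1 0) [RHS]mxE.
Qed.

Lemma intM_prod_rows m n (g : 'rV[R]_n -> \bar R) : measurable_fun setT g ->
  (forall r, 0 <= g r) -> intM (fun X : 'M[R]_(m, n) => \prod_i g (row i X)) = intRd g ^+ m.
Proof.
move=> mg g0; elim: m => [|m IH]; first by rewrite intM0 big_ord0.
rewrite intMS expeS -IH muleC -intRdZl //; last by nonneg.
apply: eq_intRd => r; rewrite muleC -intMZl //; [|integral_side..].
apply: eq_intM => Y; rewrite big_ord_recl; congr (_ * _).
  by congr g; apply/rowP => j; rewrite [LHS]mxE col_mx_ord0.
by apply: eq_bigr => i _; congr g; apply/rowP => j; rewrite [LHS]mxE col_mx_lift0 [RHS]mxE.
Qed.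

End matrix_integral.

Section linear_change_of_variables.
Variable R : realType.
Local Open Scope ereal_scope.

Definition left_mul_scales m (A : 'M[R]_m) := forall n (f : 'M[R]_(m, n) -> \bar R),
  measurable_fun setT f -> (forall x, 0 <= f x) ->
  (`|\det A| ^+ n)%:E * intM (fun X => f (A *m X)%R) = intM f.

Lemma left_mul_scalesM m (A B : 'M[R]_m) :
  left_mul_scales A -> left_mul_scales B -> left_mul_scales (A *m B).
Proof.
move=> hA hB n f mf f0.
rewrite det_mulmx normrM exprMn EFinM -muleA -[RHS](hA n f mf f0); congr (_ * _).
rewrite -(hB n (fun X => f (A *m X)%R)) //; last by measurability.
by congr (_ * _); apply: eq_intM => X; rewrite mulmxA.
Qed.

Lemma left_mul_scales_lower_shear m (c : 'cV[R]_m) :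
  left_mul_scales (block_mx (1%:M : 'M[R]_1) 0%R c 1%:M : 'M[R]_(1 + m)).
Proof.
move=> n f mf f0; rewrite det_lblock !det1 mul1r normr1 expr1n mul1e.
rewrite !(@intMS R m n); apply: eq_intRd => r.
rewrite -[RHS](intM_shift (c *m r)) //; last by measurability.
by apply: eq_intM => Y; rewrite mul_block_col !mul1mx mul0mx addr0 addrC.
Qed.

Lemma left_mul_scales_upper_shear m (b : 'rV[R]_m) :
  left_mul_scales (block_mx (1%:M : 'M[R]_1) b 0%R 1%:M : 'M[R]_(1 + m)).
Proof.
move=> n f mf f0; rewrite det_ublock !det1 mul1r normr1 expr1n mul1e.
rewrite !(@intMS R m n).
under eq_intRd do under eq_intM do rewrite mul_block_col !mul1mx mul0mx add0r.
rewrite -(intM_intRd_swap (f := fun Y r => f (col_mx (r + b *m Y)%R Y))) //; last by measurability.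
rewrite -[RHS](intM_intRd_swap (f := fun Y r => f (col_mx r Y))) //; last by measurability.
apply: eq_intM => Y.
by apply: (intRd_shift _ (f := fun r => f (col_mx r Y))) => //; measurability.
Qed.

Lemma left_mul_scales_block_diag m (a : R) (D : 'M[R]_m) : (a != 0)%R ->
  left_mul_scales D ->
  left_mul_scales (block_mx (a%:M : 'M[R]_1) 0%R 0%R D : 'M[R]_(1 + m)).
Proof.
move=> a0 hD n f mf f0; rewrite det_ublock det_scalar1 normrM exprMn.
rewrite !(@intMS R m n).
under eq_intRd do under eq_intM do
  rewrite mul_block_col !mul0mx addr0 add0r mul_scalar_mx.
rewrite EFinM -muleA -intRdZl; [|integral_side..].
transitivity ((`|a| ^+ n)%:E * intRd (fun r : 'rV[R]_n =>
    intM (fun Y : 'M[R]_(m, n) => f (col_mx (a *: r) Y)))).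
  congr (_ * _); apply: eq_intRd => r.
  by rewrite (hD n (fun Y => f (col_mx (a *: r) Y))) //; measurability.
apply: (intRd_scale (f := fun r => intM (fun Y : 'M[R]_(m, n) => f (col_mx r Y)))) => //.
- by measurability.
- by nonneg.
Qed.

Lemma left_mul_scales_pivot m (A : 'M[R]_(1 + m)) :
  (forall D : 'M[R]_m, D \in unitmx -> left_mul_scales D) ->
  A \in unitmx -> A ord0 ord0 != 0%R -> left_mul_scales A.
Proof.
move=> IH uA; set a := A ord0 ord0 => a0.
pose b := ursubmx A; pose c := dlsubmx A; pose D := (drsubmx A - a^-1 *: (c *m b))%R.
have AE : (A = block_mx (1%:M : 'M[R]_1) 0 (a^-1 *: c) 1%:M *m
    (block_mx (a%:M : 'M[R]_1) 0 0 D *m block_mx 1%:M (a^-1 *: b) 0 1%:M))%R.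
  rewrite !mulmx_block !(mul1mx, mul0mx, mulmx1, mulmx0, addr0, add0r) -{1}[A]submxK.
  congr block_mx.
  - by rewrite [LHS]mx11_scalar !mxE; congr (A _ _)%:M; exact/val_inj.
  - by rewrite mul_scalar_mx scalerA divff // scale1r.
  - by rewrite mul_mx_scalar scalerA divff // scale1r.
  - rewrite mul_scalar_mx scalerA divff // scale1r -scalemxAl.
    by rewrite /D addrC subrK.
have uD : D \in unitmx.
  move: uA; rewrite !unitmxE AE !det_mulmx det_lblock !det_ublock !det1 !mul1r mulr1.
  by rewrite det_scalar1 unitrM => /andP[].
rewrite AE; apply: left_mul_scalesM; first exact: left_mul_scales_lower_shear.
apply: left_mul_scalesM; last exact: left_mul_scales_upper_shear.
by apply: left_mul_scales_block_diag => //; exact: IH.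
Qed.

Lemma unitmx_col0_neq0 m (A : 'M[R]_m.+1) : A \in unitmx ->
  exists i, A i ord0 != 0%R.
Proof.
move=> uA; apply/existsP; apply: contraLR uA; rewrite negb_exists => /forallP A0.
rewrite unitmxE (expand_det_col _ ord0) big1 ?unitr0 // => i _.
by move: (A0 i); rewrite negbK => /eqP ->; rewrite mul0r.
Qed.

Lemma left_mul_scales_unitmx m (A : 'M[R]_m) : A \in unitmx -> left_mul_scales A.
Proof.
elim: m A => [|m IH] A uA.
  move=> n f mf f0; rewrite det_mx00 normr1 expr1n mul1e.
  by apply: eq_intM => X; rewrite [A]flatmx0 [X]flatmx0 mulmx0.
have [A00|] := eqVneq (A ord0 ord0) 0%R; last exact: left_mul_scales_pivot.
have [i Ai0] := unitmx_col0_neq0 uA.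
case: (unliftP ord0 i) Ai0 => [{}i ->|->]; last by rewrite A00 eqxx.
move=> Ai0; pose U (s : R) := block_mx (1%:M : 'M[R]_1) (s *: delta_mx ord0 i : 'rV[R]_m)
  0%R 1%:M : 'M[R]_(1 + m).
have -> : A = U (-1)%R *m (U 1%R *m A).
  rewrite mulmxA /U mulmx_block !(mul1mx, mulmx1, mulmx0, mul0mx, addr0, add0r).
  by rewrite scale1r scaleN1r addrN -scalar_mx_block mul1mx.
apply: left_mul_scalesM; first exact: left_mul_scales_upper_shear.
apply: left_mul_scales_pivot => //.
  by rewrite unitmx_mul uA andbT unitmxE /U det_ublock !det1 mulr1 unitr1.
suff -> : (U 1%R *m A) ord0 ord0 = A (lift ord0 i) ord0 by [].
rewrite mxE big_ord_recl A00 mulr0 add0r (bigD1 i) //= big1 => [|j ji].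
  by rewrite addr0 /U block_mxEh row_mx_lift0 col_mx_ord0 !mxE !eqxx !mul1r.
by rewrite /U block_mxEh row_mx_lift0 col_mx_ord0 !mxE (negbTE ji) andbF mulr0 mul0r.
Qed.

Lemma intRd_mulmx d (A : 'M[R]_d) (f : 'rV[R]_d -> \bar R) : A \in unitmx ->
  measurable_fun setT f -> (forall x, 0 <= f x) ->
  `|\det A|%:E * intRd (fun x => f (x *m A)%R) = intRd f.
Proof.
move=> uA mf f0.
have intRd_tr (g : 'rV[R]_d -> \bar R) : intRd g = intM (fun X : 'cV[R]_d => g X^T).
  by rewrite intM_col; apply: eq_intRd => x; rewrite trmxK.
rewrite !intRd_tr -[RHS](left_mul_scales_unitmx (A := A^T) _ (n := 1%N)) ?unitmx_tr //;
  last by measurability.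
rewrite det_tr expr1; congr (_ * _).
by apply: eq_intM => X; rewrite trmx_mul trmxK.
Qed.

End linear_change_of_variables.

Section product_and_null.
Variable R : realType.
Local Notation mu := (@lebesgue_measure R).
Local Open Scope ereal_scope.

Lemma intRd_prod d (g : 'I_d -> R -> \bar R) : (forall i, measurable_fun setT (g i)) ->
  (forall i x, 0 <= g i x) ->
  intRd (fun x : 'rV[R]_d => \prod_(i < d) g i (x ord0 i)) = \prod_(i < d) \int[mu]_x g i x.
Proof.
elim: d g => [|d IH] g mg g0; first by rewrite /= !big_ord0.
have mgi i : measurable_fun setT (g (lift ord0 i)) by [].
rewrite /= big_ord_recl -ge0_integralZr; [|by []|exact: mg|by nonneg|by nonneg].
apply: eq_integral => t _; rewrite -(IH (fun i => g (lift ord0 i))) //.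
rewrite -intRdZl //; [|by measurability; exact: mgi|by nonneg].
apply: eq_intRd => y; rewrite big_ord_recl row_mx_ord0 mxE eqxx mulr1n; congr (_ * _).
by apply: eq_bigr => i _; rewrite row_mx_lift0.
Qed.

Lemma intRd_hyperplane d (c : 'cV[R]_d) (b : R) (f : 'rV[R]_d -> \bar R) : c != 0%R ->
  (forall x, ((x *m c) ord0 ord0 != b)%R -> f x = 0) -> intRd f = 0.
Proof.
elim: d c b f => [|d IH] c b f; first by rewrite [c]flatmx0 eqxx.
move=> c0 fH /=.
pose c1 := usubmx (c : 'cV[R]_(1 + d)) ord0 ord0.
pose c' := dsubmx (c : 'cV[R]_(1 + d)).
have hyperplane_row (t : R) (y : 'rV[R]_d) : ((row_mx (t%:M : 'M[R]_1) y *m c) ord0 ord0 ==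
    b)%R = ((y *m c') ord0 ord0 == b - t * c1)%R.
  rewrite -[c](vsubmxK (c : 'cV[R]_(1 + d))) mul_row_col mxE mul_scalar_mx mxE.
  by rewrite -/c1 -/c' addrC (can2_eq (addrK _) (subrK _)).
have [c'0|c'0] := eqVneq c' 0%R; last first.
  rewrite integral0_eq // => t _; apply: (IH c' (b - t * c1)%R) => // y.
  by rewrite -hyperplane_row => /fH.
have c10 : c1 != 0%R.
  apply: contra_neq c0 => c10; rewrite -[c](vsubmxK (c : 'cV[R]_(1 + d))) -/c' c'0.
  rewrite (_ : usubmx _ = 0%R) ?col_mx0 //.
  by apply/matrixP => i j; rewrite !ord1 -/c1 c10 mxE.
have slice0 (t : R) : (setT `\ (b / c1)%R) t ->
    intRd (fun y => f (row_mx (t%:M : 'M[R]_1) y)) = 0.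
  move=> [_ /= tb]; rewrite -[RHS](@intRd0 R d); apply: eq_intRd => y; apply: fH.
  rewrite hyperplane_row c'0 mulmx0 mxE eq_sym subr_eq0; apply/eqP => bt.
  by case: tb; rewrite bt mulfK.
rewrite -(@integral_setD1 _ _ (b / c1)%R) ?integral0_eq //; first exact: measurableD.
apply: (eq_measurable_fun (cst 0)); last exact: measurable_cst.
by move=> t; rewrite inE => /slice0 ->.
Qed.

End product_and_null.

Section real_functions.
Variable R : realType.
Local Notation mu := (@lebesgue_measure R).
Implicit Types (x r s : R) (f F : R -> R).

Lemma powRD_gt0 x r s : 0 < x -> x `^ (r + s) = x `^ r * x `^ s.
Proof. by move=> x0; rewrite powRD // (gt_eqF x0) implybT. Qed.

Lemma powR_exprn x r n : (x `^ r) ^+ n = x `^ (r * n%:R).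
Proof. by rewrite -powR_mulrn ?powR_ge0 // -powRrM. Qed.

Lemma is_derive1_continuous f x (df : R) : is_derive x 1 f df -> {for x, continuous f}.
Proof. by move=> ?; exact/differentiable_continuous/derivable1_diffP/ex_derive. Qed.

Lemma continuous_powR_gt0 r x : 0 < x -> {for x, continuous (fun y : R => y `^ r)}.
Proof. by move=> x0; exact: is_derive1_continuous (is_derive1_powR r x0). Qed.

Lemma powR_le_expR (p t : R) : 0 < p -> 0 < t -> t `^ p <= (2 * p) `^ p * expR (t / 2).
Proof.
move=> p0 t0; have pp : 0 < 2 * p by rewrite mulr_gt0.
have tp : 0 < t / (2 * p) by rewrite divr_gt0.
have -> : t `^ p = (t / (2 * p)) `^ p * (2 * p) `^ p.
  by rewrite -powRM ?divfK ?(lt0r_neq0 pp) //; exact: ltW.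
rewrite [leRHS]mulrC ler_pM2r ?powR_gt0 //.
have -> : expR (t / 2) = expR (t / (2 * p)) `^ p.
  by rewrite /powR gt_eqF ?expR_gt0 // expRK; congr expR; field; exact: lt0r_neq0.
apply: ge0_ler_powR; rewrite ?nnegrE ?expR_ge0 //; [exact: ltW|exact: ltW|].
by apply: le_trans (expR_ge1Dx _) => //; rewrite lerDr.
Qed.

Lemma integral_itv_indicator (i : interval R) f :
  (\int[mu]_(x in [set` i]) (f x)%:E = \int[mu]_x ((x \in i)%:R * f x)%:E)%E.
Proof.
rewrite integral_mkcond; apply: eq_integral => x _.
rewrite patchE; case: ifPn; first by rewrite inE /= => ->; rewrite mul1r.
by rewrite notin_setE /= => /negP/negbTE ->; rewrite mul0r.
Qed.

Lemma integral_is_derive f F (a b : R) : a <= b ->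
  (forall x, a <= x <= b -> is_derive x 1 F (f x)) ->
  (forall x, a <= x <= b -> {for x, continuous f}) ->
  (\int[mu]_(x in `[a, b]) (f x)%:E = (F b - F a)%:E)%E.
Proof.
rewrite le_eqVlt => /predU1P[->|ab] dF cf.
  by rewrite set_itv1 integral_set1 subrr.
have cF x : a <= x <= b -> {for x, continuous F}.
  by move=> /dF; exact: is_derive1_continuous.
rewrite EFinB; apply: (continuous_FTC2 ab).
- by apply: continuous_in_subspaceT => x; rewrite inE /= in_itv /=; exact: cf.
- split.
  + move=> x; rewrite in_itv /= => /andP[ax xb].
    by have := dF x; rewrite !ltW // => /(_ isT) ?; exact: ex_derive.
  + by apply: cvg_at_right_filter; apply: cF; rewrite lexx ltW.
  + by apply: cvg_at_left_filter; apply: cF; rewrite lexx ltW.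
- move=> x; rewrite in_itv /= => /andP[ax xb]; rewrite derive1E.
  by have := dF x; rewrite !ltW // => /(_ isT) ?; rewrite derive_val.
Qed.

Lemma integral_powR_itv (s a : R) : 0 < s -> 0 < a <= 1 ->
  (\int[mu]_(x in `[a, 1%R]) (x `^ (s - 1))%:E <= (s^-1)%:E)%E.
Proof.
move=> s0 /andP[a0 a1].
have -> : (\int[mu]_(x in `[a, 1%R]) (x `^ (s - 1))%:E =
    (s^-1 * 1 `^ s - s^-1 * a `^ s)%:E)%E; last first.
  by rewrite lee_fin powR1 mulr1 lerBlDr lerDl; nonneg.
apply: (@integral_is_derive _ (fun x => s^-1 * x `^ s)) => //.
- move=> x /andP[/(lt_le_trans a0) x0 _].
  apply: (is_derive_eq (is_deriveZ s^-1 (is_derive1_powR s x0))).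
  by rewrite /GRing.scale /= mulKf // gt_eqF.
- by move=> x /andP[/(lt_le_trans a0) x0 _]; exact: continuous_powR_gt0.
Qed.

Lemma integral_powR01_le (s : R) : 0 < s ->
  (\int[mu]_x ((x \in `]0%R, 1%R])%:R * x `^ (s - 1))%:E <= (s^-1)%:E)%E.
Proof.
move=> s0; rewrite -integral_itv_indicator.
pose F (n : nat) : set R := `[n.+1%:R^-1, 1]%classic.
have FU : `]0, 1]%classic = \bigcup_i F i :> set R.
  apply/seteqP; split => x /=.
    rewrite in_itv /= => /andP[x0 x1]; exists (Num.trunc (x^-1)) => //.
    rewrite /F /= in_itv /= x1 andbT invf_ple ?posrE //.
    by apply/ltW; rewrite truncnS_gt.
  move=> [n _]; rewrite /F /= !in_itv /= => /andP[nx ->]; rewrite andbT.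
  by apply: lt_le_trans nx; rewrite invr_gt0.
have cvgF : (\int[mu]_(x in F i) (x `^ (s - 1))%:E @[i --> \oo] -->
    \int[mu]_(x in `]0%R, 1%R]) (x `^ (s - 1))%:E)%E.
  rewrite FU; apply: (@ge0_nondecreasing_set_cvg_integral _ (measurableTypeR R)).
  - apply/nondecreasing_seqP => n; apply/subsetPset => x; rewrite /F /= !in_itv /=.
    by move=> /andP[h ->]; rewrite andbT (le_trans _ h) // lef_pV2 ?posrE // ler_nat.
  - by move=> n; exact: measurable_itv.
  - by move=> n; apply: measurable_funTS; measurability.
  - by nonneg.
rewrite -(cvg_lim _ cvgF) //; apply: lime_le; first by apply/cvg_ex; eexists; exact: cvgF.
apply: nearW => n; apply: integral_powR_itv => //.
by rewrite invr_gt0 ltr0n /= invf_le1 ?ler1n.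
Qed.

End real_functions.

Section gamma.
Variable R : realType.
Local Notation mu := (@lebesgue_measure R).
Implicit Types s a t : R.

Definition mellin_ker s t : R := (0 < t)%R%:R * t `^ (s - 1).

Definition gamma_ker s t : R := mellin_ker s t * expR (- t).

Lemma mellin_ker_ge0 s t : 0 <= mellin_ker s t.
Proof. by rewrite /mellin_ker; nonneg. Qed.

Lemma gamma_ker_ge0 s t : 0 <= gamma_ker s t.
Proof. by rewrite /gamma_ker /mellin_ker; nonneg. Qed.

Lemma gamma_ker_le0 s t : t <= 0 -> gamma_ker s t = 0.
Proof. by move=> t0; rewrite /gamma_ker /mellin_ker ltNge t0 !mul0r. Qed.

Lemma gamma_kerE s t : 0 < t -> gamma_ker s t = t `^ (s - 1) * expR (- t).
Proof. by move=> t0; rewrite /gamma_ker /mellin_ker t0 mul1r. Qed.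

Lemma measurable_mellin_ker s : measurable_fun setT (mellin_ker s).
Proof. by rewrite /mellin_ker; measurability. Qed.

Lemma measurable_gamma_ker s : measurable_fun setT (gamma_ker s).
Proof. by rewrite /gamma_ker /mellin_ker; measurability. Qed.

End gamma.

#[export] Hint Extern 0 (is_true (Order.le _ _)) => exact: mellin_ker_ge0 : nonneg.
#[export] Hint Extern 0 (is_true (Order.le _ _)) => exact: gamma_ker_ge0 : nonneg.
#[export] Hint Extern 0 (measurable_fun _ _) => exact: measurable_mellin_ker : measurable_fun.
#[export] Hint Extern 0 (measurable_fun _ _) => exact: measurable_gamma_ker : measurable_fun.

Section gamma_function.
Variable R : realType.
Local Notation mu := (@lebesgue_measure R).
Implicit Types s a t : R.

Lemma gamma_ker_le s : exists2 C : R, 0 <= C & forall t,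
  gamma_ker s t <= (t \in `]0%R, 1%R])%:R * t `^ (s - 1) + C * exponential_pdf 2^-1 t.
Proof.
pose p : R := `|s - 1| + 1; have p0 : 0 < p by rewrite ltr_wpDl.
exists ((2 * p) `^ p * 2); first by nonneg.
move=> t; have e0 : 0 <= exponential_pdf 2^-1 t by rewrite exponential_pdf_ge0.
have [t0|t0] := leP t 0; first by rewrite gamma_ker_le0 //; nonneg.
rewrite gamma_kerE // in_itv /= t0; have [t1|t1] := leP t 1.
  rewrite mul1r -[leLHS]addr0 lerD //; last by nonneg.
  by rewrite ler_piMr ?powR_ge0 // -expR0 ler_expR oppr_le0 ltW.
rewrite mul0r add0r exponential_pdfE ?(ltW t0) //.
have -> : - t = - (2^-1) * t - t / 2 by field.
rewrite expRD mulrA mulrAC [leRHS](_ : _ = (2 * p) `^ p * expR (- (2^-1) * t)); last by field.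
rewrite ler_pM2r ?expR_gt0 // expRN ler_pdivrMr ?expR_gt0 //.
apply: le_trans (powR_le_expR p0 t0); apply: ler_powR; first exact: ltW.
by rewrite (le_trans (ler_norm _)) // lerDl.
Qed.

Lemma integral_gamma_ker_lty s : 0 < s -> (\int[mu]_t (gamma_ker s t)%:E < +oo)%E.
Proof.
move=> s0; have [C C0 gC] := gamma_ker_le s.
have me : measurable_fun setT (exponential_pdf 2^-1 : R -> R) by exact: measurable_exponential_pdf.
have e0 t : (0 <= (exponential_pdf 2^-1 t)%:E)%E by rewrite lee_fin exponential_pdf_ge0.
apply: (@le_lt_trans _ _ (\int[mu]_t (((t \in `]0%R, 1%R])%:R * t `^ (s - 1))%:E +
    C%:E * (exponential_pdf 2^-1 t)%:E))%E).
  apply: ge0_le_integral => //; [integral_side..|].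
  by move=> t _; rewrite -EFinM -EFinD lee_fin.
rewrite ge0_integralD //; [|integral_side..].
apply: lte_add_pinfty; first exact: le_lt_trans (integral_powR01_le s0) (ltry _).
rewrite ge0_integralZl //; last exact/measurable_EFinP.
by rewrite integral_exponential_pdf ?invr_gt0 // mule1 ltry.
Qed.

Lemma integral_gamma_ker s : 0 < s -> (\int[mu]_t (gamma_ker s t)%:E = (Gamma s)%:E)%E.
Proof.
move=> s0; rewrite /Gamma /Rintegral integral_itv_indicator.
rewrite [X in fine X](_ : _ = \int[mu]_t (gamma_ker s t)%:E)%E; last first.
  by apply: eq_integral => t _; rewrite in_itv /= andbT mulrA.
by rewrite fineK // ge0_fin_numE; [exact: integral_gamma_ker_lty|nonneg].
Qed.

Lemma Gamma_ge0 s : 0 <= Gamma s.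
Proof. by apply: Rintegral_ge0 => t _; nonneg. Qed.

Lemma Gamma_gt0 s : 0 < s -> 0 < Gamma s.
Proof.
move=> s0; rewrite -lte_fin -integral_gamma_ker //.
pose c : R := (2 `^ `|s - 1|)^-1 * expR (-2).
have c0 : 0 < c by rewrite mulr_gt0 ?invr_gt0 ?powR_gt0 ?expR_gt0.
apply: (@lt_le_trans _ _ (\int[mu]_(t in `[1%R, 2%R]) c%:E)%E).
  rewrite integral_cst //= lebesgue_measure_itv /= lte_fin ltr1n -EFinB -EFinM lte_fin.
  by rewrite mulr_gt0 // subr_gt0 ltr1n.
rewrite integral_itv_indicator; apply: ge0_le_integral => //.
- by nonneg.
- by measurability.
- by measurability.
move=> t _; rewrite lee_fin in_itv /=.
case: andP => [[t1 t2]|_]; last by rewrite mul0r gamma_ker_ge0.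
have t0 : 0 < t by exact: lt_le_trans t1.
rewrite mul1r gamma_kerE //; apply: ler_pM; [by nonneg|by nonneg| |by rewrite ler_expR lerN2].
apply: (@le_trans _ _ (t `^ (- `|s - 1|))).
  rewrite powRN lef_pV2 ?posrE ?powR_gt0 //.
  by apply: ge0_ler_powR => //; rewrite nnegrE ltW.
by apply: ler_powR => //; rewrite lerNl -normrN ler_norm.
Qed.

Lemma integral_mellin_ker_expR s a : 0 < s -> 0 < a ->
  (\int[mu]_t (mellin_ker s t * expR (- (a * t)))%:E = (Gamma s * a `^ (- s))%:E)%E.
Proof.
move=> s0 a0; have an := lt0r_neq0 a0.
have := @ge0_integral_scale R a (fun t => (gamma_ker s t)%:E) an.
rewrite integral_gamma_ker // (gtr0_norm a0) => scale.
rewrite EFinM muleC powRN.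
have -> : (a `^ s)^-1 = (a `^ (s - 1))^-1 * a^-1.
  by rewrite -invfM -(mulr_powRB1 (ltW a0) s0) mulrC.
rewrite EFinM -muleA -scale; [|integral_side..].
rewrite -ge0_integralZl //; [|integral_side..].
apply: eq_integral => t _; rewrite -EFinM; congr EFin.
have [t0|t0] := leP t 0.
  by rewrite gamma_ker_le0 ?mulr0 ?pmulr_rle0 // /mellin_ker ltNge t0 !mul0r.
rewrite gamma_kerE ?mulr_gt0 // /mellin_ker t0 mul1r powRM ?(ltW a0) ?(ltW t0) //.
by rewrite -mulrA mulKf // gt_eqF // powR_gt0.
Qed.

Lemma integral_gamma_ker_expR s a : 0 < s -> 0 <= a ->
  (\int[mu]_t (gamma_ker s t * expR (- (a * t)))%:E = (Gamma s * (1 + a) `^ (- s))%:E)%E.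
Proof.
move=> s0 a0; rewrite -integral_mellin_ker_expR ?ltr_pwDl //; apply: eq_integral => t _.
by rewrite /gamma_ker -mulrA -expRD mulrDl mul1r opprD.
Qed.

Lemma powR_gamma_mixture s a : 0 < s -> 0 <= a ->
  (((1 + a) `^ (- s))%:E = ((Gamma s)^-1)%:E *
    \int[mu]_t (gamma_ker s t * expR (- (a * t)))%:E)%E.
Proof.
move=> s0 a0; rewrite integral_gamma_ker_expR // -EFinM mulKf //.
by rewrite gt_eqF // Gamma_gt0.
Qed.

Lemma integral_exp_tail (y : R) :
  (\int[mu]_s ((y < s)%R%:R * expR (- s))%:E = (expR (- y) * Gamma 1)%:E)%E.
Proof.
have := @ge0_integral_affine R 1 y (fun s => ((y < s)%R%:R * expR (- s))%:E) (oner_neq0 _).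
rewrite normr1 mul1e => <-; [|integral_side..].
rewrite EFinM -integral_gamma_ker // -ge0_integralZl //; [|integral_side..].
apply: eq_integral => s _; rewrite -EFinM /gamma_ker /mellin_ker subrr powRr0.
by rewrite !mul1r mulr1 -ltrBlDr subrr opprD expRD; congr EFin; ring.
Qed.

End gamma_function.

#[export] Hint Extern 0 (is_true (Order.le _ _)) => exact: Gamma_ge0 : nonneg.

Section gaussian_and_beta_prime.
Variable R : realType.
Local Notation mu := (@lebesgue_measure R).
Implicit Types t b : R.

Lemma prodEFin (I : Type) (r : seq I) (P : pred I) (F : I -> R) :
  (\prod_(i <- r | P i) (F i)%:E = (\prod_(i <- r | P i) F i)%:E)%E.
Proof. by rewrite (big_morph EFin (@EFinM R) erefl). Qed.

Lemma enorm_ge0 d (x : 'rV[R]_d) : 0 <= enorm x.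
Proof. exact: sqrtr_ge0. Qed.

Lemma enorm_sqr d (x : 'rV[R]_d) : enorm x ^+ 2 = \sum_(i < d) x ord0 i ^+ 2.
Proof. by rewrite sqr_sqrtr //; nonneg. Qed.

Lemma enormZ d (a : R) (x : 'rV[R]_d) : enorm (a *: x) = `|a| * enorm x.
Proof.
rewrite /enorm -sqrtr_sqr -sqrtrM ?sqr_ge0 //; congr Num.sqrt.
by rewrite mulr_sumr; apply: eq_bigr => i _; rewrite mxE exprMn.
Qed.

Lemma entry_le_enorm d (y : 'rV[R]_d) j : `|y ord0 j| <= enorm y.
Proof.
rewrite /enorm -sqrtr_sqr ler_sqrt; last by nonneg.
by rewrite (bigD1 j) //= lerDl; nonneg.
Qed.

Lemma integral_gauss_scale t : 0 < t ->
  (\int[mu]_x (expR (- (t * x ^+ 2)))%:E = ((pi / t) `^ 2^-1)%:E)%E.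
Proof.
move=> t0; have a0 : 0 < Num.sqrt t by rewrite sqrtr_gt0.
have := @ge0_integral_scale R _ (fun x => (gauss_fun x)%:E) (lt0r_neq0 a0).
rewrite integralT_gauss (gtr0_norm a0) => scale.
rewrite powR12_sqrt ?divr_ge0 ?pi_ge0 ?ltW // sqrtrM ?pi_ge0 // sqrtrV ?(ltW t0) //.
rewrite mulrC EFinM -scale; [|by rewrite /gauss_fun; measurability|].
  by apply: eq_integral => x _; rewrite /gauss_fun exprMn sqr_sqrtr // ltW.
by move=> x; rewrite lee_fin gauss_fun_ge0.
Qed.

Lemma intRd_gauss d t : 0 < t ->
  intRd (fun x : 'rV[R]_d => (expR (- (t * enorm x ^+ 2)))%:E) = ((pi / t) `^ (d%:R / 2))%:E.
Proof.
move=> t0.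
transitivity (intRd (fun x : 'rV[R]_d => \prod_(i < d) (expR (- (t * x ord0 i ^+ 2)))%:E)%E).
  apply: eq_intRd => x; rewrite prodEFin -expR_sum enorm_sqr mulr_sumr; congr (expR _)%:E.
  by rewrite -sumrN.
rewrite (intRd_prod (g := fun i x => (expR (- (t * x ^+ 2)))%:E)).
- under eq_bigr do rewrite integral_gauss_scale //.
  by rewrite prodEFin prodr_const card_ord powR_exprn [2^-1 * _]mulrC.
- by move=> i; measurability.
- by nonneg.
Qed.

Lemma intRd_gauss1 d :
  intRd (fun x : 'rV[R]_d => (expR (- enorm x ^+ 2))%:E) = (pi `^ (d%:R / 2))%:E.
Proof.
rewrite -[pi]divr1 -intRd_gauss //.
by apply: eq_intRd => x; rewrite mul1r.
Qed.

Lemma intRd_beta_prime d b : d%:R / 2 < b ->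
  intRd (fun x : 'rV[R]_d => ((1 + enorm x ^+ 2) `^ (- b))%:E) =
  (pi `^ (d%:R / 2) * Gamma (b - d%:R / 2) / Gamma b)%:E.
Proof.
move=> db; have b0 : 0 < b by apply: le_lt_trans db; nonneg.
under eq_intRd do rewrite powR_gamma_mixture ?sqr_ge0 //.
rewrite intRdZl; [|integral_side..].
rewrite (intRd_integral (f := fun t x => (gamma_ker b t * expR (- (enorm x ^+ 2 * t)))%:E)); [|integral_side..].
rewrite [in RHS]mulrC EFinM; congr (_ * _)%E.
rewrite EFinM -integral_gamma_ker ?subr_gt0 // -ge0_integralZl //; [|integral_side..].
apply: eq_integral => t _; under eq_intRd do rewrite EFinM.
rewrite intRdZl; [|integral_side..].
have [t0|t0] := leP t 0; first by rewrite !gamma_ker_le0 // mul0e mule0.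
under eq_intRd do rewrite mulrC.
rewrite intRd_gauss // -!EFinM; congr EFin; rewrite !gamma_kerE //.
rewrite powRM ?pi_ge0 ?invr_ge0 ?(ltW t0) // -[t^-1]powR_inv1 ?(ltW t0) // -powRrM mulN1r.
rewrite (_ : b - d%:R / 2 - 1 = b - 1 - d%:R / 2); last by ring.
by rewrite [in RHS]powRD_gt0 //; ring.
Qed.

Lemma ctd_ge0 d b : 0 <= ctd d b.
Proof. by rewrite /ctd; nonneg. Qed.

Lemma ctd_gt0 d b : d%:R / 2 < b -> 0 < ctd d b.
Proof.
move=> db; have b0 : 0 < b by apply: le_lt_trans db; nonneg.
by rewrite divr_gt0 ?mulr_gt0 ?Gamma_gt0 ?powR_gt0 ?pi_gt0 ?subr_gt0.
Qed.

Lemma betap_density_ge0 d b (x : 'rV[R]_d) : 0 <= betap_density b x.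
Proof. by rewrite mulr_ge0 ?powR_ge0 ?ctd_ge0. Qed.

Lemma measurable_betap_density d b : measurable_fun setT (@betap_density R d b).
Proof. by rewrite /betap_density; measurability. Qed.

Lemma intRd_betap_density d b : d%:R / 2 < b ->
  intRd (fun x : 'rV[R]_d => (betap_density b x)%:E) = 1%E.
Proof.
move=> db; have b0 : 0 < b by apply: le_lt_trans db; nonneg.
rewrite /betap_density; under eq_intRd do rewrite EFinM.
rewrite intRdZl; [|by measurability|by nonneg|by rewrite lee_fin ctd_ge0].
rewrite intRd_beta_prime // -EFinM -[X in _ * X]invf_div -/(ctd d b) divff //.
by rewrite gt_eqF // ctd_gt0.
Qed.

End gaussian_and_beta_prime.

#[export] Hint Extern 0 (is_true (Order.le _ _)) => exact: betap_density_ge0 : nonneg.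
#[export] Hint Extern 0 (is_true (Order.le _ _)) => exact: ctd_ge0 : nonneg.
#[export] Hint Extern 0 (measurable_fun _ _) => exact: measurable_betap_density : measurable_fun.

Section cone_volume.
Variables (R : realType) (d : nat).
Local Notation mu := (@lebesgue_measure R).
Local Open Scope ereal_scope.
Implicit Type K : 'rV[R]_d -> bool.

Definition cone_ball_vol K (r : R) : \bar R :=
  intRd (fun x => ((K x)%:R * (enorm x < r)%R%:R)%:E).

Definition gauss_mass K : \bar R :=
  intRd (fun x => ((K x)%:R * expR (- enorm x ^+ 2))%:E).

Definition cone K := forall (a : R) x, (0 < a)%R -> K (a *: x)%R = K x.

Lemma gauss_massT : gauss_mass (fun=> true) = (pi `^ (d%:R / 2))%:E.
Proof. by rewrite -intRd_gauss1; apply: eq_intRd => x; rewrite mul1r. Qed.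

Lemma gauss_mass_fin_num K : measurable_fun setT K -> gauss_mass K \is a fin_num.
Proof.
move=> mK; rewrite ge0_fin_numE; last by rewrite /gauss_mass; nonneg.
apply: (@le_lt_trans _ _ (gauss_mass (fun=> true))); last by rewrite gauss_massT ltry.
apply: le_intRd; [integral_side..|].
by move=> x; rewrite lee_fin ler_wpM2r ?expR_ge0 // lern1 leq_b1.
Qed.

Lemma cone_ball_vol_scale K r : measurable_fun setT K -> cone K -> (0 < r)%R ->
  cone_ball_vol K r = (r ^+ d)%:E * cone_ball_vol K 1.
Proof.
move=> mK KZ r0; rewrite /cone_ball_vol.
rewrite -(intRd_scale (lt0r_neq0 r0)); [|integral_side..].
rewrite gtr0_norm //; congr (_ * _); apply: eq_intRd => x.
by rewrite KZ // enormZ gtr0_norm // gtr_pMr.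
Qed.

(* Layer cake: [exp (- |x|^2)] is the integral of [exp (- s)] over [s > |x|^2]. *)
Lemma cone_ball_vol1 K : measurable_fun setT K -> cone K ->
  (Gamma (d%:R / 2 + 1))%:E * cone_ball_vol K 1 = (Gamma 1)%:E * gauss_mass K.
Proof.
move=> mK KZ.
pose f (s : R) x := ((K x)%:R * ((enorm x ^+ 2 < s)%R%:R * expR (- s)))%:E.
transitivity (intRd (fun x => \int[mu]_s f s x)); last first.
  rewrite -intRdZl; [|integral_side..].
  apply: eq_intRd => x; rewrite /f; under eq_integral do rewrite EFinM.
  rewrite ge0_integralZl //; [|integral_side..].
  by rewrite integral_exp_tail -!EFinM; congr EFin; ring.
rewrite intRd_integral; [|by rewrite /f; measurability|by rewrite /f; nonneg].
rewrite -integral_gamma_ker ?ltr_wpDl ?divr_ge0 // -ge0_integralZr //;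
  [|by measurability|by nonneg|by rewrite /cone_ball_vol; nonneg].
apply: eq_integral => s _; rewrite /f; have [s0|s0] := leP s 0%R.
  rewrite gamma_ker_le0 // mul0e -[LHS](@intRd0 R d); apply: eq_intRd => x.
  by rewrite ltNge (le_trans s0) ?sqr_ge0 // mul0r mulr0.
transitivity ((expR (- s))%:E * cone_ball_vol K (Num.sqrt s)).
  rewrite [cone_ball_vol K (Num.sqrt s)]cone_ball_vol_scale ?sqrtr_gt0 // muleA -EFinM gamma_kerE // addrK mulrC.
  by rewrite -powR12_sqrt ?ltW // powR_exprn [(2^-1 * _)%R]mulrC.
rewrite /cone_ball_vol -intRdZl; [|integral_side..].
apply: eq_intRd => x; rewrite -EFinM; congr EFin.
rewrite -[in RHS](sqr_sqrtr (ltW s0)) ltr_pXn2r ?nnegrE ?enorm_ge0 ?sqrtr_ge0 //.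
by rewrite sqr_sqrtr ?ltW //; ring.
Qed.

Lemma cone_ball_vol_ratio K r : measurable_fun setT K -> cone K -> (0 < r)%R ->
  (fine (cone_ball_vol K r) / fine (cone_ball_vol (fun=> true) r) =
   (pi `^ (d%:R / 2))^-1 * fine (gauss_mass K))%R.
Proof.
move=> mK KZ r0; pose c : R := (Gamma 1 / Gamma (d%:R / 2 + 1))%R.
have G1 : (0 < Gamma 1 :> R)%R by exact: Gamma_gt0.
have Gd : (0 < Gamma (d%:R / 2 + 1) :> R)%R by rewrite Gamma_gt0 // ltr_wpDl // divr_ge0.
have volE V : measurable_fun setT V -> cone V ->
    fine (cone_ball_vol V r) = (r ^+ d * c * fine (gauss_mass V))%R.
  move=> mV VZ; rewrite cone_ball_vol_scale //.
  have -> : cone_ball_vol V 1 = c%:E * gauss_mass V.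
    by rewrite /c mulrC EFinM -muleA -cone_ball_vol1 // muleA -EFinM mulVf ?mul1e // gt_eqF.
  by rewrite muleA -EFinM -(fineK (gauss_mass_fin_num mV)).
rewrite !volE // gauss_massT /=.
have rd : (0 < r ^+ d)%R by rewrite exprn_gt0.
have pd : (0 < pi `^ (d%:R / 2) :> R)%R by rewrite powR_gt0 // pi_gt0.
by rewrite /c; field; rewrite !gt_eqF.
Qed.

End cone_volume.

Section face_angle.
Variables (R : realType) (d : nat).
Implicit Types (X : 'M[R]_(d.+1, d)) (k : nat) (l : 'rV[R]_d).

Definition edge_mx X : 'M[R]_d := \matrix_(i, j) (X (lift ord0 i) j - X ord0 j).

Definition face_cone k l : bool :=
  [forall i : 'I_d, (k <= i.+1)%N ==> (0 <= l ord0 i)].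

Lemma face_coneP k l :
  reflect (forall i : 'I_d, (k <= i.+1)%N -> 0 <= l ord0 i) (face_cone k l).
Proof.
apply: (iffP forallP) => h i; first by move=> ki; have := h i; rewrite ki.
by apply/implyP; exact: h.
Qed.

Lemma measurable_face_cone k : measurable_fun setT (face_cone k).
Proof.
apply: measurable_fun_forall => i; case: (k <= i.+1)%N => /=; last exact: measurable_cst.
by measurability.
Qed.

Lemma face_coneZ k : cone (face_cone k).
Proof.
by move=> a l a0; apply/face_coneP/face_coneP => h i /h; rewrite mxE pmulr_rge0.
Qed.

Lemma face_cone_full l : face_cone d.+1 l.
Proof. by apply/face_coneP => i; rewrite ltnS leqNgt ltn_ord. Qed.

Lemma affine_comb_edge X (w : 'I_d.+1 -> R) : \sum_i w i = 1 ->
  \sum_i w i *: row i X = row ord0 X + (\row_i w (lift ord0 i)) *m edge_mx X.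
Proof.
rewrite !big_ord_recl => w1; rewrite mulmx_sum_row.
have row_edge i : row i (edge_mx X) = row (lift ord0 i) X - row ord0 X.
  by apply/rowP => j; rewrite !mxE.
under [in RHS]eq_bigr do rewrite mxE row_edge scalerBr.
rewrite sumrB -scaler_suml (_ : w ord0 = 1 - \sum_(i < d) w (lift ord0 i)).
  by rewrite scalerBl scale1r -addrA [- _ + _]addrC.
by rewrite -w1 addrK.
Qed.

Lemma conv_rows_edge X (x : 'rV[R]_d) : conv_rows X predT x <->
  exists l : 'rV[R]_d, [/\ forall i, 0 <= l ord0 i, \sum_i l ord0 i <= 1 &
    x = row ord0 X + l *m edge_mx X].
Proof.
split=> [[l [l0 _ l1 ->]]|[l [l0 l1 ->]]].
  exists (\row_i l (lift ord0 i)); split.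
  - by move=> i; rewrite mxE.
  - by rewrite -l1 big_ord_recl; under eq_bigr do rewrite mxE; rewrite lerDr.
  - exact: affine_comb_edge.
pose w (i : 'I_d.+1) := if unlift ord0 i is Some j then l ord0 j else 1 - \sum_j l ord0 j.
have wl (j : 'I_d) : w (lift ord0 j) = l ord0 j by rewrite /w liftK.
have w1 : \sum_i w i = 1.
  rewrite big_ord_recl /w unlift_none.
  by under [X in _ + X]eq_bigr do rewrite liftK; rewrite subrK.
exists w; split => //.
- by move=> i; rewrite /w; case: unliftP => [j _|_]; rewrite ?subr_ge0.
- rewrite (affine_comb_edge X w1); congr (_ + _ *m _).
  by apply/rowP => j; rewrite mxE wl.
Qed.

Definition face_coord k : 'rV[R]_d := \row_(i < d) ((i.+1 < k)%N%:R / k%:R).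

Lemma sum_ltn_indicator n k : (k <= n)%N -> \sum_(i < n) (i < k)%N%:R = k%:R :> R.
Proof.
move=> kn; rewrite -natr_sum; congr (_%:R).
rewrite -(subnKC kn) big_split_ord /= [X in (_ + X)%N]big1 ?addn0; last first.
  by move=> i _; rewrite ltnNge leq_addr.
under eq_bigr => i _ do rewrite ltn_ord.
by rewrite sum1_card card_ord.
Qed.

Lemma sum_face_coord k : (0 < k <= d.+1)%N ->
  \sum_i face_coord k ord0 i = 1 - k%:R^-1.
Proof.
move=> /andP[k0 kd]; have := sum_ltn_indicator kd; rewrite big_ord_recl /= k0.
move=> /(canRL (addKr _)) E; under eq_bigr do rewrite mxE.
rewrite -mulr_suml [X in X / _]E addrC mulrBl divff ?mul1r //.
by rewrite pnatr_eq0 -lt0n.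
Qed.

Lemma face_barycentre X k : (0 < k <= d.+1)%N ->
  k%:R^-1 *: (\sum_(i < d.+1 | (i < k)%N) row i X) =
  row ord0 X + face_coord k *m edge_mx X.
Proof.
move=> /andP[k0 kd].
have kR : (k%:R != 0 :> R) by rewrite pnatr_eq0 -lt0n.
pose w (i : 'I_d.+1) : R := (i < k)%N%:R / k%:R.
have w1 : \sum_i w i = 1 by rewrite -mulr_suml sum_ltn_indicator // divff.
rewrite -[face_coord k](_ : \row_i w (lift ord0 i) = _); last first.
  by apply/rowP => i; rewrite !mxE /w.
rewrite -(affine_comb_edge X w1) scaler_sumr big_mkcond; apply: eq_bigr => i _.
by rewrite /w; case: ifP => _; rewrite ?mul1r // mul0r scale0r.
Qed.

Lemma sum_mulmx_le (N : 'M[R]_d) (y : 'rV[R]_d) :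
  \sum_i `|(y *m N) ord0 i| <= enorm y * (\sum_i \sum_j `|N j i|).
Proof.
rewrite mulr_sumr; apply: ler_sum => i _.
rewrite mxE mulr_sumr; apply: le_trans (ler_norm_sum _ _ _) _.
apply: ler_sum => j _; rewrite normrM ler_wpM2r //; exact: entry_le_enorm.
Qed.

Lemma conv_rows_near_face X k : (0 < k <= d)%N -> edge_mx X \in unitmx ->
  exists2 r0 : R, 0 < r0 & forall x,
    let z := row ord0 X + face_coord k *m edge_mx X in
    enorm (x - z) < r0 ->
    (conv_rows X predT x <-> face_cone k ((x - z) *m invmx (edge_mx X))).
Proof.
move=> /andP[k0 kd] uM; set M := edge_mx X; set N := invmx M.
pose C : R := 1 + \sum_i \sum_j `|N j i|.
have C0 : 0 < C by rewrite ltr_pwDl //; nonneg.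
have kR : 0 < k%:R :> R by rewrite ltr0n.
exists (k%:R * C)^-1; first by rewrite invr_gt0 mulr_gt0.
move=> x z xz; rewrite conv_rows_edge; split => [[l [l0 l1 xE]]|/face_coneP h].
  apply/face_coneP => i ki.
  rewrite xE /z opprD addrACA subrr add0r -mulmxBl mulmxK // !mxE.
  by rewrite ltnNge ki mul0r subr0.
set eta := (x - z) *m N in h.
have etaS : \sum_i `|eta ord0 i| <= k%:R^-1.
  apply: le_trans (sum_mulmx_le _ _) _.
  apply: (@le_trans _ _ ((k%:R * C)^-1 * C)); last by rewrite invfM divfK // gt_eqF.
  by apply: ler_pM; rewrite ?enorm_ge0 ?(ltW xz) ?lerDr //; nonneg.
have etai i : `|eta ord0 i| <= k%:R^-1.
  by apply: le_trans etaS; rewrite (bigD1 i) //= lerDl; nonneg.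
exists (face_coord k + eta); split.
- move=> i; rewrite mxE [face_coord _ _ _]mxE; case: (ltnP i.+1 k) => ik.
    rewrite mul1r -lerBlDl sub0r lerNl; apply: le_trans (etai i).
    by rewrite -normrN ler_norm.
  by rewrite mul0r add0r h.
- under eq_bigr do rewrite mxE.
  rewrite big_split /= sum_face_coord ?k0 ?leqW // -lerBrDl opprB addrC subrK.
  by apply: le_trans etaS; apply: ler_sum => i _; exact: ler_norm.
- by rewrite mulmxDl addrA /eta -mulmxA mulVmx // mulmx1 addrC subrK.
Qed.

End face_angle.

#[export] Hint Extern 0 (measurable_fun _ _) => exact: measurable_face_cone : measurable_fun.

Section face_angle_formula.
Variables (R : realType) (d : nat).
Implicit Types (X : 'M[R]_(d.+1, d)) (k : nat).
Local Open Scope ereal_scope.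

Lemma vol_ball_shift (z : 'rV[R]_d) (r : R) (A : set 'rV[R]_d) (K : 'rV[R]_d -> bool) :
  measurable_fun setT K ->
  (forall x, (enorm (x - z) < r)%R -> A x <-> K (x - z)%R) ->
  vol (eball z r `&` A) = cone_ball_vol K r.
Proof.
move=> mK AK; rewrite /vol /cone_ball_vol -[RHS](intRd_shift (- z)%R); [|integral_side..].
apply: eq_intRd => x; rewrite indicE -natrM mulnb; congr (_%:R%:E)%R; congr nat_of_bool.
apply/idP/andP; rewrite inE /eball /=; first by move=> [xz Ax]; split => //; exact/AK.
by move=> [Kx xz]; split => //; exact/AK.
Qed.

Lemma vol_near_face X k : (0 < k <= d)%N -> edge_mx X \in unitmx ->
  let z := (k%:R^-1 *: (\sum_(i < d.+1 | (i < k)%N) row i X))%R in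
  \forall r \near 0^'+, vol (eball z r `&` conv_rows X predT) =
    cone_ball_vol (fun x => face_cone k (x *m invmx (edge_mx X))) r.
Proof.
move=> kd uM z.
have zE : z = (row ord0 X + face_coord R d k *m edge_mx X)%R.
  by rewrite /z face_barycentre //; case/andP: kd => -> /leqW ->.
have [r0 r00 conv_cone] := conv_rows_near_face kd uM.
near=> r; apply: vol_ball_shift; first by measurability.
move=> x xz; have := conv_cone x; rewrite /= -zE; apply; apply: lt_le_trans xz _.
by near: r; exact: nbhs_right_le.
Unshelve. all: by end_near. Qed.

Lemma vol_conv_rows_degenerate X z r : edge_mx X \notin unitmx ->
  vol (eball z r `&` conv_rows X predT) = 0.
Proof.
move=> uM.
have [c c0 Mc] : exists2 c : 'cV[R]_d, c != 0%R & (edge_mx X *m c = 0)%R.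
  have : \det (edge_mx X)^T == 0%R by rewrite det_tr; move: uM; rewrite unitmxE unitfE negbK.
  move=> /det0P[v v0 vM]; exists v^T.
    by apply: contra_neq v0 => v0; rewrite -[v]trmxK v0 trmx0.
  by apply: trmx_inj; rewrite trmx_mul trmxK vM trmx0.
apply: (intRd_hyperplane (b := (row ord0 X *m c) ord0 ord0) c0) => x xc.
rewrite indicE memNset //= => -[_ /conv_rows_edge[l [_ _ xE]]].
by move/eqP: xc; apply; rewrite xE mulmxDl -mulmxA Mc mulmx0 addr0.
Qed.

Lemma face_angle_gauss_mass X k : (0 < k <= d)%N -> edge_mx X \in unitmx ->
  face_angle X k = ((pi `^ (d%:R / 2))^-1 *
    fine (gauss_mass (fun x => face_cone k (x *m invmx (edge_mx X)))))%R.
Proof.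
move=> kd uM; rewrite /face_angle /internal_angle_at; set z := (_ *: _)%R.
set K := fun x : 'rV[R]_d => _.
apply: cvg_lim => //; apply: cvg_near_cst; near=> r.
have -> : vol (eball z r `&` conv_rows X predT) = cone_ball_vol K r.
  by near: r; exact: vol_near_face.
have -> : vol (eball z r) = cone_ball_vol (fun _ : 'rV[R]_d => true) r.
  by rewrite -[eball z r]setIT; apply: vol_ball_shift => // x _; split.
apply: cone_ball_vol_ratio.
- by rewrite /K; measurability.
- by move=> a x a0; rewrite /K -scalemxAl face_coneZ.
- by near: r; exact: nbhs_right_gt.
Unshelve. all: by end_near. Qed.

Lemma face_angleE X k : (0 < k <= d)%N ->
  (face_angle X k)%:E = ((pi `^ (d%:R / 2))^-1 * `|\det (edge_mx X)|)%:E *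
    intRd (fun l : 'rV[R]_d => ((face_cone k l)%:R * expR (- enorm (l *m edge_mx X) ^+ 2))%:E).
Proof.
move=> kd; have [uM|uM] := boolP (edge_mx X \in unitmx).
  set K := fun x : 'rV[R]_d => face_cone k (x *m invmx (edge_mx X)).
  have mK : measurable_fun setT K by rewrite /K; measurability.
  rewrite face_angle_gauss_mass // EFinM fineK ?gauss_mass_fin_num // EFinM -muleA.
  rewrite /gauss_mass -(intRd_mulmx uM); [|integral_side..].
  by congr (_ * (_ * _)); apply: eq_intRd => l; rewrite mulmxK.
have detM : \det (edge_mx X) = 0%R by move: uM; rewrite unitmxE unitfE negbK => /eqP.
rewrite detM normr0 mulr0 mul0e /face_angle /internal_angle_at.
under [X in lim (X @ _)]eq_fun do rewrite vol_conv_rows_degenerate //= mul0r.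
by rewrite lim_cst.
Qed.

End face_angle_formula.

Section rank_one_updates.
Variable R : rcfType.

Definition sqnorm n (u : 'rV[R]_n) : R := \sum_i u ord0 i ^+ 2.

Lemma sqnorm_ge0 n (u : 'rV[R]_n) : 0 <= sqnorm u.
Proof. by apply: sumr_ge0 => i _; exact: sqr_ge0. Qed.

Lemma sqnorm_eq0 n (u : 'rV[R]_n) : (sqnorm u == 0) = (u == 0).
Proof.
rewrite psumr_eq0; last by move=> i _; exact: sqr_ge0.
apply/allP/eqP => [u0|-> i _]; last by rewrite /= mxE expr0n eqxx.
apply/rowP => i; apply/eqP; rewrite mxE -sqrf_eq0.
by have := u0 i; rewrite mem_index_enum => /(_ isT).
Qed.

Lemma mulmx_tr_sqnorm n (u : 'rV[R]_n) : u *m u^T = (sqnorm u)%:M.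
Proof.
rewrite [LHS]mx11_scalar mxE; congr (_%:M).
by apply: eq_bigr => i _; rewrite mxE expr2.
Qed.

Lemma outer_sqr n (u : 'rV[R]_n) :
  (u^T *m u) *m (u^T *m u) = sqnorm u *: (u^T *m u).
Proof.
by rewrite mulmxA -[_ *m u^T]mulmxA mulmx_tr_sqnorm mul_mx_scalar -scalemxAl.
Qed.

Lemma tr_outer n (u : 'rV[R]_n) : (u^T *m u)^T = u^T *m u.
Proof. by rewrite trmx_mul trmxK. Qed.

Lemma tr_outer_update n (a : R) (u : 'rV[R]_n) :
  (1%:M - a *: (u^T *m u))^T = 1%:M - a *: (u^T *m u).
Proof. by rewrite [LHS]linearB /= trmx1 [X in _ - X]linearZ /= tr_outer. Qed.

Lemma mul_outer_updates n (a b : R) (u : 'rV[R]_n) :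
  (1%:M + a *: (u^T *m u)) *m (1%:M + b *: (u^T *m u)) =
  1%:M + (a + b + a * b * sqnorm u) *: (u^T *m u).
Proof.
rewrite mulmxDr mulmx1 mulmxDl mul1mx -scalemxAl -scalemxAr outer_sqr !scalerA.
by rewrite -!addrA -!scalerDl addrA.
Qed.

(* Two block factorizations of [1, v; -u, 1]. *)
Lemma det_rank_one_update n (u : 'cV[R]_n) (v : 'rV[R]_n) :
  \det (1%:M + u *m v) = 1 + (v *m u) ord0 ord0.
Proof.
pose B : 'M[R]_(1 + n) := block_mx (1%:M : 'M[R]_1) v (- u) 1%:M.
transitivity (\det B).
  have -> : B = block_mx (1%:M : 'M[R]_1) 0 (- u) 1%:M *m block_mx 1%:M v 0 (1%:M + u *m v).
    rewrite mulmx_block !mul1mx !mulmx1 !mul0mx ?mulmx0 ?addr0 ?add0r; congr block_mx.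
    by rewrite mulNmx addrC addrK.
  by rewrite det_mulmx det_lblock det_ublock !det1 !mul1r.
have -> : B = block_mx (1%:M : 'M[R]_1) v 0 1%:M *m block_mx (1%:M + v *m u) 0 (- u) 1%:M.
  rewrite mulmx_block !mul1mx !mulmx1 !mul0mx ?mulmx0 ?addr0 ?add0r; congr block_mx.
  by rewrite mulmxN addrK.
by rewrite det_mulmx det_lblock det_ublock !det1 !mul1r mulr1 det_mx11 !mxE.
Qed.

(* For [v = 0] the division by zero makes this the identity. *)
Definition reflection n (v : 'rV[R]_n) : 'M[R]_n :=
  1%:M - (2 / sqnorm v) *: (v^T *m v).

Lemma reflection_orthogonal n (v : 'rV[R]_n) : (reflection v)^T *m reflection v = 1%:M.
Proof.
rewrite tr_outer_update /reflection -scaleNr mul_outer_updates.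
rewrite -[RHS]addr0 -(scale0r (v^T *m v)); congr (_ + _ *: _).
have [->|v0] := eqVneq (sqnorm v) 0; first by rewrite invr0 !(mulr0, oppr0, addr0).
by field.
Qed.

Lemma mul_reflection n (u w : 'rV[R]_n) : sqnorm u = sqnorm w ->
  u *m reflection (u - w) = w.
Proof.
move=> uw; set v := u - w.
have uvT : 2 *: (u *m v^T) = (sqnorm v)%:M.
  rewrite -mulmx_tr_sqnorm /v linearB /= !mulmxBr !mulmxBl !mulmx_tr_sqnorm -uw.
  have -> : w *m u^T = u *m w^T by rewrite [LHS]mx11_scalar -tr_scalar_mx -mx11_scalar trmx_mul trmxK.
  by rewrite scalerBr !scaler_nat !mulr2n; apply/matrixP => i j; rewrite !mxE; ring.
have [v0|v0] := eqVneq (sqnorm v) 0.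
  rewrite /reflection v0 invr0 mulr0 scale0r subr0 mulmx1.
  by move/eqP: v0; rewrite sqnorm_eq0 subr_eq0 => /eqP.
rewrite /reflection mulmxBr mulmx1 -scalemxAr mulmxA mulrC -scalerA.
by rewrite scalemxAl uvT mul_scalar_mx scalerA mulVf // scale1r /v opprB addrC subrK.
Qed.

Lemma orthogonal_to_axis n (w : 'rV[R]_n.+1) : exists2 Q : 'M[R]_n.+1,
  Q^T *m Q = 1%:M & w *m Q = Num.sqrt (sqnorm w) *: delta_mx ord0 ord0.
Proof.
pose e : 'rV[R]_n.+1 := Num.sqrt (sqnorm w) *: delta_mx ord0 ord0.
exists (reflection (w - e)); first exact: reflection_orthogonal.
apply: mul_reflection; rewrite [RHS](bigD1 ord0) //= !mxE !eqxx mulr1.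
rewrite sqr_sqrtr ?sqnorm_ge0 // [X in _ + X]big1 ?addr0 //.
by move=> i i0; rewrite !mxE (negbTE i0) andbF mulr0 expr0n.
Qed.

Lemma normr_det_orthogonal n (Q : 'M[R]_n) : Q^T *m Q = 1%:M -> `|\det Q| = 1.
Proof.
move=> QQ; have /eqP : \det Q ^+ 2 = 1 by rewrite expr2 -{1}det_tr -det_mulmx QQ det1.
by rewrite sqrf_eq1 => /orP[] /eqP ->; rewrite ?normrN normr1.
Qed.

Lemma rank_one_inverse_sqrt n (u : 'rV[R]_n) : exists P : 'M[R]_n,
  [/\ P^T *m (1%:M + u^T *m u) *m P = 1%:M,
      forall w : 'cV[R]_n, u *m w = 0 -> P *m w = w &
      \det P = (Num.sqrt (1 + sqnorm u))^-1].
Proof.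
have m0 := sqnorm_ge0 u; set m := sqnorm u; pose s := Num.sqrt (1 + m).
have s0 : 0 < s by rewrite sqrtr_gt0 ltr_pwDl.
have s2 : m = s ^+ 2 - 1 by rewrite sqr_sqrtr ?addr_ge0 // addrC addKr.
have s1 : 0 < 1 + s by rewrite ltr_wpDr // ltW.
pose c := (s * (1 + s))^-1; exists (1%:M - c *: (u^T *m u)); split.
- have -> : 1%:M + u^T *m u = 1%:M + 1 *: (u^T *m u) by rewrite scale1r.
  rewrite tr_outer_update -scaleNr !mul_outer_updates.
  rewrite -[RHS]addr0 -(scale0r (u^T *m u)) -/m s2 /c; congr (_ + _ *: _).
  by field; rewrite !gt_eqF.
- by move=> w uw; rewrite mulmxBl mul1mx -scalemxAl -mulmxA uw mulmx0 scaler0 subr0.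
- rewrite -scaleNr scalemxAr det_rank_one_update -scalemxAl mulmx_tr_sqnorm !mxE mulr1n.
  by rewrite -/m -/s s2 /c; field; rewrite !gt_eqF.
Qed.

Lemma sqrtr_prod (I : Type) (r : seq I) (F : I -> R) : (forall i, 0 <= F i) ->
  Num.sqrt (\prod_(i <- r) F i) = \prod_(i <- r) Num.sqrt (F i).
Proof.
move=> F0; elim: r => [|i r IH]; first by rewrite !big_nil sqrtr1.
by rewrite !big_cons sqrtrM // IH.
Qed.

(* [A] is the product of [diag t^(-1/2)], of the inverse square root of
   [1 + u^T u] for [u = (h_i / sqrt t_i)_i], and of a reflection. *)
Lemma whitening n (t h : 'rV[R]_n.+1) : (forall i, 0 < t ord0 i) ->
  \sum_i h ord0 i = 0 -> exists A : 'M[R]_n.+1,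
  [/\ A^T *m (diag_mx t + h^T *m h) *m A = 1%:M,
      A *m (Num.sqrt (\sum_i t ord0 i) *: delta_mx ord0 ord0) = const_mx 1 :> 'cV[R]_n.+1 &
      `|\det A| = (Num.sqrt ((\prod_i t ord0 i) * (1 + \sum_i h ord0 i ^+ 2 / t ord0 i)))^-1].
Proof.
move=> t0 h0.
pose w : 'rV[R]_n.+1 := \row_i Num.sqrt (t ord0 i).
have wE i : w ord0 i = Num.sqrt (t ord0 i) by rewrite mxE.
have w0 i : w ord0 i != 0 by rewrite wE gt_eqF // sqrtr_gt0.
have w2 i : w ord0 i ^+ 2 = t ord0 i by rewrite wE sqr_sqrtr // ltW.
pose v : 'rV[R]_n.+1 := \row_i (w ord0 i)^-1.
pose u : 'rV[R]_n.+1 := \row_i (h ord0 i / w ord0 i).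
have u2 : sqnorm u = \sum_i h ord0 i ^+ 2 / t ord0 i.
  by apply: eq_bigr => i _; rewrite mxE expr_div_n w2.
have vw : diag_mx v *m diag_mx w = 1%:M.
  rewrite mulmx_diag -diag_const_mx; congr diag_mx; apply/rowP => i.
  by rewrite !mxE mulVf // -wE.
have uw : u *m diag_mx w = h.
  by apply/rowP => i; rewrite mul_mx_diag !mxE -wE divfK.
have [P [PP Pw detP]] := rank_one_inverse_sqrt u.
have [Q QQ wQ] := orthogonal_to_axis w.
exists (diag_mx v *m P *m Q); split.
- have -> : diag_mx t + h^T *m h = diag_mx w *m (1%:M + u^T *m u) *m diag_mx w.
    rewrite mulmxDr mulmx1 mulmxDl mulmx_diag -uw trmx_mul tr_diag_mx !mulmxA.
    by congr (diag_mx _ + _); apply/rowP => i; rewrite [RHS]mxE -expr2 w2.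
  rewrite !trmx_mul tr_diag_mx !mulmxA -[_ *m diag_mx v *m diag_mx w]mulmxA vw mulmx1.
  rewrite -[_ *m diag_mx w *m diag_mx v]mulmxA diag_mxC vw mulmx1.
  by rewrite -(mulmxA Q^T) -(mulmxA Q^T) PP mulmx1.
- have -> : Num.sqrt (\sum_i t ord0 i) *: delta_mx ord0 ord0 = (w *m Q)^T :> 'cV[R]_n.+1.
    rewrite wQ linearZ /= trmx_delta; congr (Num.sqrt _ *: _).
    by apply: eq_bigr => i _.
  rewrite trmx_mul -!mulmxA [Q *m _]mulmxA (mulmx1C QQ) mul1mx Pw.
    by apply/colP => i; rewrite mul_diag_mx !mxE -wE mulVf.
  apply/matrixP => i j; rewrite !ord1 !mxE -[RHS]h0; apply: eq_bigr => k _.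
  by rewrite !mxE -wE divfK.
- rewrite !det_mulmx !normrM (normr_det_orthogonal QQ) mulr1 detP det_diag u2.
  have -> : \prod_i v ord0 i = (Num.sqrt (\prod_i t ord0 i))^-1.
    rewrite sqrtr_prod => [|i]; last exact: ltW.
    by rewrite -prodfV; apply: eq_bigr => i _; rewrite !mxE.
  rewrite sqrtrM; last by apply: prodr_ge0 => i _; exact: ltW.
  by rewrite invfM !ger0_norm ?invr_ge0 ?sqrtr_ge0.
Qed.

End rank_one_updates.

Section gaussian_determinant.
Variables (R : realType) (d : nat).
Implicit Types (X Z : 'M[R]_(d.+1, d)) (l : 'rV[R]_d) (t : 'rV[R]_d.+1).

Definition balance l : 'rV[R]_d.+1 := row_mx (- (\sum_i l ord0 i))%:M l : 'rV[R]_(1 + d).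

Lemma balance0 l : balance l ord0 ord0 = - \sum_i l ord0 i.
Proof. by rewrite /balance row_mx_ord0 mxE eqxx. Qed.

Lemma balanceS l i : balance l ord0 (lift ord0 i) = l ord0 i.
Proof. by rewrite /balance row_mx_lift0. Qed.

Lemma sum_balance l : \sum_i balance l ord0 i = 0.
Proof. by rewrite big_ord_recl balance0 (eq_bigr _ (fun i _ => balanceS l i)) addNr. Qed.

Lemma balanceZ (a : R) l i : balance (a *: l) ord0 i = a * balance l ord0 i.
Proof.
case: (unliftP ord0 i) => [j|] ->; first by rewrite !balanceS mxE.
by rewrite !balance0 mulrN mulr_sumr; congr (- _); apply: eq_bigr => j _; rewrite mxE.
Qed.

Lemma mul_balance l X : balance l *m X = l *m edge_mx X.
Proof.
apply/rowP => j; rewrite !mxE big_ord_recl balance0.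
under [X in _ + X]eq_bigr do rewrite balanceS.
under [in RHS]eq_bigr do rewrite mxE mulrBr.
by rewrite sumrB -mulr_suml mulNr addrC.
Qed.

Definition balance_form t l : R := \sum_i balance l ord0 i ^+ 2 / t ord0 i.

Lemma measurable_balance_form :
  measurable_fun setT (fun p : 'rV[R]_d.+1 * 'rV[R]_d => balance_form p.1 p.2).
Proof.
rewrite /balance_form; apply: measurable_sum => i; apply: measurable_funM; last by measurability.
apply: measurable_funX; apply: (@measurable_fun_entry _ _ _ _ _ (fun p => balance p.2)).
by rewrite /balance; measurability.
Qed.

Lemma balance_form_ge0 t l : (forall i, 0 < t ord0 i) -> 0 <= balance_form t l.
Proof. by move=> t0; apply: sumr_ge0 => i _; rewrite divr_ge0 ?sqr_ge0 // ltW. Qed.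

Lemma balance_form_scale (a : R) t l : balance_form (a *: t) l = a^-1 * balance_form t l.
Proof.
rewrite mulr_sumr; apply: eq_bigr => i _.
by rewrite [(a *: t) ord0 i]mxE invfM mulrCA.
Qed.

Lemma balance_formZ (a : R) t l : balance_form t (a *: l) = a ^+ 2 * balance_form t l.
Proof. by rewrite mulr_sumr; apply: eq_bigr => i _; rewrite balanceZ exprMn mulrA. Qed.

Lemma det_edge X : \det (edge_mx X) =
  \det (row_mx (const_mx 1 : 'cV[R]_d.+1) X : 'M[R]_(1 + d)).
Proof.
set U := row_mx _ _.
have U0 i : U i ord0 = 1 by rewrite /U row_mx_ord0 mxE.
have US i j : U i (lift ord0 j) = X i j by rewrite /U row_mx_lift0.
move: U U0 US => U U0 US.
pose L : 'M[R]_(1 + d) := block_mx (1%:M : 'M[R]_1) 0 (const_mx (-1)) 1%:M.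
have detL : \det L = 1 by rewrite det_lblock !det1 mulr1.
rewrite -[RHS]mul1r -detL -(det_mulmx L) -[U](@submxK _ 1 d 1 d).
have -> : @ulsubmx _ 1 d 1 d U = 1%:M.
  by apply/matrixP => i j; rewrite !mxE !ord1 lshift0 U0.
have -> : @dlsubmx _ 1 d 1 d U = const_mx 1.
  by apply/matrixP => i j; rewrite !mxE !ord1 lshift0 U0.
rewrite mulmx_block !mul1mx !mul0mx !addr0 mulmx1.
have -> : const_mx (-1) + const_mx 1 = 0 :> 'cV[R]_d.
  by apply/matrixP => i j; rewrite !mxE addNr.
rewrite det_ublock det1 mul1r; congr determinant.
by apply/matrixP => i j; rewrite !mxE big_ord1 !mxE mulN1r addrC !rshift1 lshift0 !US.
Qed.

Lemma mxtrace_gram m n (Z : 'M[R]_(m, n)) : \tr (Z^T *m Z) = \sum_i \sum_j Z i j ^+ 2.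
Proof.
rewrite exchange_big /mxtrace; apply: eq_bigr => j _; rewrite mxE.
by apply: eq_bigr => i _; rewrite mxE expr2.
Qed.

Lemma gaussian_exponent_trace t l X :
  \sum_i t ord0 i * enorm (row i X) ^+ 2 + enorm (l *m edge_mx X) ^+ 2 =
  \tr (X^T *m (diag_mx t + (balance l)^T *m balance l) *m X).
Proof.
rewrite mulmxDr mulmxDl linearD /=; congr (_ + _).
  rewrite /mxtrace [RHS](eq_bigr (fun j => \sum_i t ord0 i * X i j ^+ 2)); last first.
    move=> j _; rewrite mxE; apply: eq_bigr => i _; rewrite mul_mx_diag !mxE.
    by rewrite mulrAC -expr2 mulrC.
  rewrite exchange_big /=; apply: eq_bigr => i _; rewrite enorm_sqr mulr_sumr.
  by apply: eq_bigr => j _; rewrite mxE.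
by rewrite -mul_balance enorm_sqr !mulmxA -trmx_mul -mulmxA mxtrace_gram big_ord1.
Qed.

Lemma normr_det_edge_mulmx (A : 'M[R]_d.+1) (s : R) Z : 0 <= s ->
  A *m (s *: delta_mx ord0 ord0) = const_mx 1 :> 'cV[R]_d.+1 ->
  `|\det (edge_mx (A *m Z))| = `|\det A| * s * `|\det (dsubmx (Z : 'M[R]_(1 + d, d)))|.
Proof.
move=> s0 As; rewrite det_edge -As -(mul_mx_row A) (det_mulmx A) normrM -mulrA.
congr (_ * _).
have -> : (row_mx (s *: delta_mx ord0 ord0 : 'cV[R]_d.+1) Z : 'M[R]_(1 + d)) =
    block_mx (s%:M : 'M[R]_1) (usubmx (Z : 'M[R]_(1 + d, d))) 0 (dsubmx (Z : 'M[R]_(1 + d, d))).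
  rewrite [RHS](@block_mxEh _ 1 d 1 d) -[Z in LHS](@vsubmxK _ 1 d d); congr row_mx.
  apply/colP => i; case: (@split_ordP 1 d i) => k ->.
    by rewrite !ord1 (@col_mxEu _ 1 d 1) !mxE eqxx mulr1 mulr1n.
  by rewrite (@col_mxEd _ 1 d 1) !mxE mulr0.
by rewrite (@det_ublock _ 1 d) det_scalar1 normrM ger0_norm.
Qed.

Local Open Scope ereal_scope.

Definition gaussian_det_moment : \bar R := intM (fun Z : 'M[R]_(d.+1, d) =>
  (`|\det (dsubmx (Z : 'M[R]_(1 + d, d)))| * expR (- \sum_i \sum_j Z i j ^+ 2))%:E).

(* The form [sum_i t_i |X_i|^2 + |sum_i h_i X_i|^2], [h = balance l], is whitened
   by a substitution [X = A Z] that maps the first basis vector to a multiple of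
   [(1, ..., 1)], so that it keeps track of the simplex volume. *)
Lemma gaussian_det_integral t l : (forall i, 0 < t ord0 i)%R ->
  intM (fun X => (`|\det (edge_mx X)| *
    expR (- (\sum_i t ord0 i * enorm (row i X) ^+ 2 + enorm (l *m edge_mx X) ^+ 2)))%:E) =
  gaussian_det_moment * (Num.sqrt (\sum_i t ord0 i) *
    (Num.sqrt ((\prod_i t ord0 i) * (1 + balance_form t l)))^-1 ^+ d.+1)%:E.
Proof.
move=> t0; have [A [AA Ae]] := whitening t0 (sum_balance l).
rewrite -/(balance_form t l); set D := (_^-1)%R => detA.
have D0 : (0 < D)%R.
  by rewrite invr_gt0 sqrtr_gt0 mulr_gt0 ?prodr_gt0 // ltr_pwDl // balance_form_ge0.
have uA : A \in unitmx by rewrite unitmxE unitfE -normr_gt0 detA.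
set S := Num.sqrt (\sum_i t ord0 i) in Ae *.
rewrite -(left_mul_scales_unitmx uA); [|by rewrite /edge_mx; measurability|by nonneg].
rewrite [X in _ * X](_ : _ = (D * S)%:E * gaussian_det_moment).
  by rewrite detA muleA -EFinM muleC; congr (_ * _%:E); rewrite exprS; ring.
rewrite /gaussian_det_moment -intMZl; [|integral_side..|]; last first.
  by rewrite lee_fin mulr_ge0 ?sqrtr_ge0 // ltW.
apply: eq_intM => Z; rewrite -EFinM (normr_det_edge_mulmx _ _ Ae) ?sqrtr_ge0 // detA -mulrA.
congr (_ * (_ * expR (- _)))%:E; rewrite gaussian_exponent_trace.
by rewrite trmx_mul !mulmxA -(mulmxA Z^T) -(mulmxA Z^T) AA mulmx1 mxtrace_gram.
Qed.

End gaussian_determinant.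

#[export] Hint Extern 0 (measurable_fun _ _) => exact: measurable_balance_form : measurable_fun.

Section singular_matrices.
Variable R : realType.
Local Notation mu := (@lebesgue_measure R).
Local Open Scope ereal_scope.

Lemma integral_supported_on_roots (p : {poly R}) (f : R -> \bar R) : p != 0%R ->
  measurable_fun setT f -> (forall s, 0 <= f s) -> (forall s, ~~ root p s -> f s = 0) ->
  \int[mu]_s f s = 0.
Proof.
move=> p0 mf f0 fp; pose N := [set` rootsR p].
have cN : countable N by exact/finite_set_countable/finite_seq.
have mN : measurable N by exact: countable_measurable.
rewrite (@ge0_negligible_integral _ _ _ mu setT N) //; last exact: countable_lebesgue_measure0.
rewrite integral0_eq // => s [_ /= sN]; apply: fp; apply/negP => ps; apply: sN.
by have := roots_on_rootsR p0 s; rewrite in_itv /= ps => h; rewrite /N /= -h.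
Qed.

Lemma integral_singular_shift n (Y : 'M[R]_n) (w : R -> R) : measurable_fun setT w ->
  (forall s, 0 <= w s)%R -> \int[mu]_s (w s * (\det (Y + s%:M) == 0)%R%:R)%:E = 0.
Proof.
move=> mw w0; apply: (@integral_supported_on_roots (char_poly (- Y)%R)).
- by apply: monic_neq0; exact: char_poly_monic.
- by measurability.
- by nonneg.
move=> s; rewrite -eigenvalue_root_char => sY.
case: eqP => [/eqP/det0P[v v0 vY]|_]; last by rewrite mulr0.
case/eigenvalueP: sY; exists v => //.
by move/eqP: vY; rewrite mulmxDr mul_mx_scalar addr_eq0 mulmxN => /eqP ->; rewrite opprK.
Qed.

(* Average over the shifts [Y + s], which are singular for finitely many [s] only. *)
Lemma intM_singular n : intM (fun Y : 'M[R]_n => ((\det Y == 0)%R%:R : R)%:E) = 0.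
Proof.
suff : (Gamma 1)%:E * intM (fun Y : 'M[R]_n => ((\det Y == 0)%R%:R : R)%:E) = 0.
  by move/eqP; rewrite mule_eq0 eqe gt_eqF ?Gamma_gt0 //= => /eqP.
rewrite -integral_gamma_ker // -ge0_integralZr; [|integral_side..].
pose f (s : R) (Y : 'M[R]_n) : \bar R := (gamma_ker 1 s * (\det (Y + s%:M) == 0)%R%:R)%:E.
transitivity (\int[mu]_s intM (f s)).
  apply: eq_integral => s _; rewrite /f.
  rewrite -(intM_shift s%:M); [|integral_side..].
  by rewrite -intMZl; [|integral_side..].
rewrite -intM_integral; [|by rewrite /f; measurability|by rewrite /f; nonneg].
rewrite -[RHS](@intRd0 R (n * n)); apply: eq_intRd => y.
by apply: integral_singular_shift; [measurability|nonneg].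
Qed.

Lemma edge_col_mx d (r : 'rV[R]_d) (Y : 'M[R]_d) :
  (edge_mx (col_mx r Y : 'M[R]_(1 + d, d)) = Y + - (const_mx 1%R *m r))%R.
Proof.
apply/matrixP => i j; rewrite [LHS]mxE col_mx_lift0 col_mx_ord0.
by rewrite !mxE big_ord1 mxE mul1r.
Qed.

Lemma intM_singular_edge d :
  intM (fun X : 'M[R]_(d.+1, d) => ((\det (edge_mx X) == 0)%R%:R : R)%:E) = 0.
Proof.
rewrite intMS -[RHS](@intRd0 R d); apply: eq_intRd => r.
under eq_intM do rewrite edge_col_mx.
rewrite (@intM_shift R d d _ (fun Y : 'M[R]_d => ((\det Y == 0)%R%:R : R)%:E));
  [exact: intM_singular|integral_side..].
Qed.

Lemma intM_nonsingular_edge d (f : 'M[R]_(d.+1, d) -> \bar R) : measurable_fun setT f ->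
  (forall X, 0 <= f X) ->
  intM (fun X => ((\det (edge_mx X) != 0)%R%:R : R)%:E * f X) = intM f.
Proof.
move=> mf f0.
have mdet : measurable_fun setT (fun X : 'M[R]_(d.+1, d) => (\det (edge_mx X) == 0)%R).
  by rewrite /edge_mx; measurability.
have singular0 : intM (fun X => ((\det (edge_mx X) == 0)%R%:R : R)%:E * f X) = 0.
  apply/eqP; rewrite eq_le; apply/andP; split; last by nonneg.
  rewrite -[leRHS](mule0 +oo) -[X in +oo * X](intM_singular_edge d) -intMZl; [|integral_side..].
  apply: le_intM; [integral_side..|] => X; case: (_ == _); last by rewrite mul0e mule0.
  by rewrite mul1e mule1 leey.
rewrite -[LHS]adde0 -singular0 -intMD; [|integral_side..].
by apply: eq_intM => X; case: (_ == _); rewrite /= mul0e mul1e ?adde0 ?add0e.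
Qed.

Lemma mul_intRd d e (f : 'rV[R]_d -> \bar R) (g : 'rV[R]_e -> \bar R) :
  measurable_fun setT f -> measurable_fun setT g ->
  (forall x, 0 <= f x) -> (forall y, 0 <= g y) ->
  intRd f * intRd g = intRd (fun y => intRd (fun x => f x * g y)).
Proof.
move=> mf mg f0 g0; rewrite -intRdZl; [|integral_side..].
apply: eq_intRd => y; rewrite muleC -intRdZl; [|integral_side..].
by apply: eq_intRd => x; rewrite muleC.
Qed.

End singular_matrices.

Section gamma_products.
Variables (R : realType) (n : nat).
Implicit Types (t : 'rV[R]_n) (s : R).

Definition mellin_prod s t : R := \prod_i mellin_ker s (t ord0 i).

Definition gamma_prod s t : R := \prod_i gamma_ker s (t ord0 i).

Lemma mellin_prod_ge0 s t : 0 <= mellin_prod s t.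
Proof. by rewrite /mellin_prod; nonneg. Qed.

Lemma gamma_prod_ge0 s t : 0 <= gamma_prod s t.
Proof. by rewrite /gamma_prod; nonneg. Qed.

Lemma measurable_mellin_prod s : measurable_fun setT (mellin_prod s).
Proof. by rewrite /mellin_prod; measurability. Qed.

Lemma measurable_gamma_prod s : measurable_fun setT (gamma_prod s).
Proof. by rewrite /gamma_prod; measurability. Qed.

Lemma gamma_prodE s t : gamma_prod s t = mellin_prod s t * expR (- \sum_i t ord0 i).
Proof. by rewrite -sumrN expR_sum -big_split. Qed.

Lemma mellin_prod_eq0 s t : ~~ [forall i, 0 < t ord0 i] -> mellin_prod s t = 0.
Proof.
rewrite negb_forall => /existsP[i ti].
by rewrite /mellin_prod (bigD1 i) //= /mellin_ker (negbTE ti) !mul0r.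
Qed.

Lemma gamma_prod_eq0 s t : ~~ [forall i, 0 < t ord0 i] -> gamma_prod s t = 0.
Proof. by move=> t0; rewrite gamma_prodE mellin_prod_eq0 // mul0r. Qed.

Lemma mellin_prod_scale s (a : R) t : 0 < a ->
  mellin_prod s (a *: t) = a `^ ((s - 1) * n%:R) * mellin_prod s t.
Proof.
move=> a0; rewrite -powR_exprn -[X in _ ^+ X](card_ord n) -prodr_const -big_split.
apply: eq_bigr => i _; rewrite /= mxE /mellin_ker pmulr_rgt0 //.
by case: ltP => ti; rewrite ?(mul0r, mulr0) // !mul1r powRM // ltW.
Qed.

Lemma powR_prod (f : 'I_n -> R) p : (forall i, 0 <= f i) ->
  (\prod_i f i) `^ p = \prod_i (f i `^ p).
Proof.
move=> f0; elim: (index_enum _) => [|i s IH]; first by rewrite !big_nil powR1.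
by rewrite !big_cons powRM ?IH // prodr_ge0.
Qed.

Lemma gamma_prod_shift s r t : (forall i, 0 < t ord0 i) ->
  gamma_prod s t * (\prod_i t ord0 i) `^ r = gamma_prod (s + r) t.
Proof.
move=> t0; rewrite powR_prod => [|i]; last exact: ltW.
rewrite -big_split; apply: eq_bigr => i _; rewrite /= !gamma_kerE // mulrAC -powRD_gt0 //.
by congr (_ `^ _ * _); ring.
Qed.

End gamma_products.

#[export] Hint Extern 0 (is_true (Order.le _ _)) => exact: mellin_prod_ge0 : nonneg.
#[export] Hint Extern 0 (is_true (Order.le _ _)) => exact: gamma_prod_ge0 : nonneg.
#[export] Hint Extern 0 (measurable_fun _ _) => exact: measurable_mellin_prod : measurable_fun.
#[export] Hint Extern 0 (measurable_fun _ _) => exact: measurable_gamma_prod : measurable_fun.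

Section gauss_cone_integral.
Variables (R : realType) (d : nat).
Local Notation mu := (@lebesgue_measure R).
Local Open Scope ereal_scope.
Implicit Types (k : nat) (t : 'rV[R]_d.+1) (l : 'rV[R]_d).

Definition gauss_cone_integral k t : \bar R :=
  intRd (fun l => ((face_cone k l)%:R * expR (- balance_form t l))%:E).

Lemma gauss_cone_integral_ge0 k t : 0 <= gauss_cone_integral k t.
Proof. by rewrite /gauss_cone_integral; nonneg. Qed.

Lemma measurable_gauss_cone_integral k : measurable_fun setT (gauss_cone_integral k).
Proof. by rewrite /gauss_cone_integral; measurability. Qed.

Lemma gauss_cone_integral_scale k (a : R) t : (0 < a)%R ->
  gauss_cone_integral k (a *: t)%R = (a `^ (d%:R / 2))%:E * gauss_cone_integral k t.
Proof.
move=> a0; have c0 : (0 < Num.sqrt a)%R by rewrite sqrtr_gt0.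
rewrite /gauss_cone_integral -(intRd_scale (lt0r_neq0 c0)); [|integral_side..].
rewrite gtr0_norm // -powR12_sqrt ?(ltW a0) // powR_exprn [(2^-1 * _)%R]mulrC.
rewrite powR12_sqrt ?(ltW a0) //; congr (_ * _); apply: eq_intRd => l.
rewrite face_coneZ // balance_form_scale balance_formZ sqr_sqrtr ?(ltW a0) //.
by rewrite mulKf // gt_eqF.
Qed.

Lemma cauchy_cone_integral k t : (forall i, 0 < t ord0 i)%R ->
  intRd (fun l => ((face_cone k l)%:R * (1 + balance_form t l) `^ (- (d.+1%:R / 2)))%:E) =
  (Gamma 2^-1 / Gamma (d.+1%:R / 2))%:E * gauss_cone_integral k t.
Proof.
move=> t0; pose n2 : R := (d.+1%:R / 2)%R; have n20 : (0 < n2)%R by rewrite divr_gt0.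
have q0 l := balance_form_ge0 l t0.
pose f (s : R) l : R := ((face_cone k l)%:R * (gamma_ker n2 s * expR (- (balance_form t l * s))))%R.
transitivity (((Gamma n2)^-1)%:E * intRd (fun l => \int[mu]_s (f s l)%:E)).
  rewrite -intRdZl; [|by rewrite /f; measurability|by rewrite /f; nonneg|by nonneg].
  apply: eq_intRd => l; rewrite EFinM powR_gamma_mixture // muleCA; congr (_ * _).
  by rewrite -ge0_integralZl; [|integral_side..].
rewrite mulrC EFinM -muleA; congr (_ * _).
rewrite (intRd_integral (f := fun s l => (f s l)%:E));
  [|by rewrite /f; measurability|by rewrite /f; nonneg].
rewrite -integral_gamma_ker // -ge0_integralZr;
  [|integral_side..|exact: gauss_cone_integral_ge0].
apply: eq_integral => s _; rewrite /f.
have [s0|s0] := leP s 0%R.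
  rewrite !gamma_ker_le0 // mul0e -[RHS](@intRd0 R d); apply: eq_intRd => l.
  by rewrite mul0r mulr0.
transitivity ((gamma_ker n2 s)%:E * gauss_cone_integral k (s^-1 *: t)%R).
  rewrite /gauss_cone_integral -intRdZl; [|integral_side..].
  apply: eq_intRd => l; rewrite -EFinM balance_form_scale invrK [(s * _)%R]mulrC.
  by congr EFin; ring.
rewrite gauss_cone_integral_scale ?invr_gt0 // muleA -EFinM; congr (_%:E * _).
rewrite !gamma_kerE // mulrAC -[(s^-1)%R](powR_inv1 (ltW s0)) -powRrM -powRD_gt0 //.
by congr (_ `^ _ * _)%R; rewrite /n2 -natr1; field.
Qed.

End gauss_cone_integral.

#[export] Hint Extern 0 (is_true (Order.le _ _)) => exact: gauss_cone_integral_ge0 : nonneg.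
#[export] Hint Extern 0 (measurable_fun _ _) =>
  exact: measurable_gauss_cone_integral : measurable_fun.

Section expected_angle.
Variables (R : realType) (d : nat) (alpha : R).
Hypothesis alpha0 : 0 < alpha.
Local Notation mu := (@lebesgue_measure R).
Local Notation b := ((alpha + d%:R) / 2).
Local Notation s := ((alpha - 1) / 2).
Local Open Scope ereal_scope.
Implicit Types (k : nat) (X : 'M[R]_(d.+1, d)) (t : 'rV[R]_d.+1) (l : 'rV[R]_d).

Let b_gt0 : (0 < b)%R. Proof. by rewrite divr_gt0 // ltr_pwDl. Qed.

Let d2_lt_b : (d%:R / 2 < b)%R. Proof. by rewrite ltr_pM2r // ltrDr. Qed.

(* For [k <= d] this is the expected angle; for [k = d + 1] the cone is the whole
   space and the integral is the total mass 1. *)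
Definition expected_cone_angle k : \bar R := intM (fun X =>
  ((pi `^ (d%:R / 2))^-1 * `|\det (edge_mx X)|)%:E *
  intRd (fun l => ((face_cone k l)%:R * expR (- enorm (l *m edge_mx X) ^+ 2))%:E) *
  (\prod_i betap_density b (row i X))%:E).

Lemma expected_angleE k : (0 < k <= d)%N ->
  expected_angle d.+1 k b = expected_cone_angle k.
Proof.
move=> kd; rewrite /expected_angle /expected_cone_angle /intM /=; apply: eq_intRd => v.
by rewrite EFinM face_angleE.
Qed.

Lemma expected_cone_angle_full : expected_cone_angle d.+1 = 1.
Proof.
pose p X : \bar R := \prod_i (betap_density b (row i X))%:E.
transitivity (intM (fun X => ((\det (edge_mx X) != 0)%R%:R : R)%:E * p X)).
  apply: eq_intM => X; rewrite /p prodEFin; congr (_ * _).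
  under eq_intRd do rewrite face_cone_full mul1r.
  have [->|D0] := eqVneq (\det (edge_mx X)) 0%R; first by rewrite normr0 mulr0 mul0e.
  have uX : edge_mx X \in unitmx by rewrite unitmxE unitfE.
  rewrite EFinM -muleA (intRd_mulmx (f := fun x => (expR (- enorm x ^+ 2))%:E) uX);
    [|integral_side..].
  by rewrite intRd_gauss1 -EFinM mulVf // gt_eqF // powR_gt0 // pi_gt0.
rewrite intM_nonsingular_edge; [|by rewrite /p; measurability|by rewrite /p; nonneg].
rewrite (intM_prod_rows d.+1 (g := fun r : 'rV[R]_d => (betap_density b r)%:E)); [|integral_side..].
by rewrite intRd_betap_density //; elim: d.+1 => // m IH; rewrite expeS IH mule1.
Qed.

Lemma prod_betap_density_mixture X :
  (\prod_i betap_density b (row i X))%:E = ((ctd d b / Gamma b) ^+ d.+1)%:E *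
  intRd (fun t => (gamma_prod b t * expR (- \sum_i t ord0 i * enorm (row i X) ^+ 2))%:E).
Proof.
pose g i (u : R) : \bar R := (gamma_ker b u * expR (- (enorm (row i X) ^+ 2 * u)))%:E.
have -> : intRd (fun t : 'rV[R]_d.+1 =>
    (gamma_prod b t * expR (- \sum_i t ord0 i * enorm (row i X) ^+ 2))%:E) =
    intRd (fun t : 'rV[R]_d.+1 => \prod_i g i (t ord0 i)).
  apply: eq_intRd => t; rewrite prodEFin big_split; congr (_ * _)%:E.
  by rewrite -sumrN expR_sum; apply: eq_bigr => i _; rewrite mulrC.
rewrite intRd_prod; [|by rewrite /g; measurability|by rewrite /g; nonneg].
have gE i : \int[mu]_u g i u = (Gamma b * (1 + enorm (row i X) ^+ 2) `^ (- b))%:E.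
  by rewrite integral_gamma_ker_expR ?sqr_ge0.
rewrite (eq_bigr _ (fun i _ => gE i)).
rewrite prodEFin -EFinM -[X in (_ ^+ X)%R](card_ord d.+1) -prodr_const -big_split /=.
congr EFin; apply: eq_bigr => i _.
by rewrite mulrA divfK // gt_eqF // Gamma_gt0.
Qed.

Lemma gamma_prod_form_weight t l :
  (gamma_prod b t * (Num.sqrt (\sum_i t ord0 i) *
    (Num.sqrt ((\prod_i t ord0 i) * (1 + balance_form t l)))^-1 ^+ d.+1) =
  gamma_prod s t * Num.sqrt (\sum_i t ord0 i) * (1 + balance_form t l) `^ (- (d.+1%:R / 2)))%R.
Proof.
have [/forallP t0|t0] := boolP [forall i, (0 < t ord0 i)%R]; last first.
  by rewrite !gamma_prod_eq0 // !mul0r.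
have p0 : (0 <= \prod_i t ord0 i)%R by apply: prodr_ge0 => i _; exact: ltW.
have q1 : (0 <= 1 + balance_form t l)%R by rewrite addr_ge0 // balance_form_ge0.
have sqrtVX x : (0 <= x)%R -> ((Num.sqrt x)^-1 ^+ d.+1 = x `^ (- (d.+1%:R / 2)))%R.
  by move=> x0; rewrite -powR12_sqrt // -powRN powR_exprn; congr powR; field.
rewrite sqrtVX ?mulr_ge0 // powRM //.
rewrite !mulrA; congr (_ * _)%R; rewrite mulrAC gamma_prod_shift //.
congr (gamma_prod _ _ * _)%R.
by rewrite -natr1; field.
Qed.

Definition weighted_cone_integral k : \bar R := intRd (fun t =>
  (gamma_prod s t * Num.sqrt (\sum_i t ord0 i))%:E * gauss_cone_integral k t).

Let integrand k X t l : R :=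
  (gamma_prod b t * ((face_cone k l)%:R * (`|\det (edge_mx X)| *
    expR (- (\sum_i t ord0 i * enorm (row i X) ^+ 2 + enorm (l *m edge_mx X) ^+ 2)))))%R.

Let integrand_ge0 k X t l : (0 <= integrand k X t l)%R.
Proof. by rewrite /integrand; nonneg. Qed.

Let measurable_integrand (e : measure_display) (T : measurableType e) k
    (X : T -> 'M[R]_(d.+1, d)) (t : T -> 'rV[R]_d.+1) (l : T -> 'rV[R]_d) :
  measurable_fun setT X -> measurable_fun setT t -> measurable_fun setT l ->
  measurable_fun setT (fun p => integrand k (X p) (t p) (l p)).
Proof. by move=> mX mt ml; rewrite /integrand /edge_mx; measurability. Qed.

Lemma expected_cone_angle_mixture k : expected_cone_angle k =
  ((pi `^ (d%:R / 2))^-1 * (ctd d b / Gamma b) ^+ d.+1)%:E *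
  intRd (fun t => intRd (fun l => intM (fun X => (integrand k X t l)%:E))).
Proof.
transitivity (intM (fun X => ((pi `^ (d%:R / 2))^-1 * (ctd d b / Gamma b) ^+ d.+1)%:E *
    intRd (fun t => intRd (fun l => (integrand k X t l)%:E)))).
  apply: eq_intM => X; rewrite prod_betap_density_mixture -!muleA [X in _ * X]muleCA.
  rewrite mul_intRd; [|integral_side..].
  rewrite [X in _ = X * _]EFinM -!muleA [(_ * `|_|)%R]mulrC EFinM -muleA muleCA; congr (_ * _).
  rewrite muleCA; congr (_ * _); rewrite -intRdZl; [|integral_side..].
  apply: eq_intRd => t; rewrite -intRdZl; [|integral_side..].
  by apply: eq_intRd => l; rewrite -!EFinM /integrand opprD expRD; congr EFin; ring.
rewrite intMZl; [|by measurability; apply: measurable_integrand; measurability|by nonneg|by nonneg].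
congr (_ * _); rewrite (intM_intRd_swap (f := fun X t => intRd (fun l => (integrand k X t l)%:E)));
  [|by measurability; apply: measurable_integrand; measurability|by nonneg].
apply: eq_intRd => t; apply: intM_intRd_swap; last by nonneg.
by measurability; apply: measurable_integrand; measurability.
Qed.

Lemma intM_integrand k t l : intM (fun X => (integrand k X t l)%:E) =
  gaussian_det_moment R d * (gamma_prod s t * Num.sqrt (\sum_i t ord0 i))%:E *
    ((face_cone k l)%:R * (1 + balance_form t l) `^ (- (d.+1%:R / 2)))%:E.
Proof.
have [/forallP t0|t0] := boolP [forall i, (0 < t ord0 i)%R]; last first.
  rewrite gamma_prod_eq0 // mul0r mule0 mul0e -[RHS](@intRd0 R (d.+1 * d)).
  by apply: eq_intRd => v; rewrite /integrand gamma_prod_eq0 // mul0r.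
transitivity ((gamma_prod b t * (face_cone k l)%:R)%:E * intM (fun X => (`|\det (edge_mx X)| *
    expR (- (\sum_i t ord0 i * enorm (row i X) ^+ 2 + enorm (l *m edge_mx X) ^+ 2)))%:E)).
  rewrite -intMZl; [|by rewrite /edge_mx; measurability|by nonneg|by nonneg].
  by apply: eq_intM => X; rewrite -EFinM /integrand; congr EFin; rewrite [LHS]mulrA.
rewrite gaussian_det_integral // muleCA -!muleA; congr (_ * _); rewrite -!EFinM; congr EFin.
by rewrite mulrAC gamma_prod_form_weight; ring.
Qed.

Lemma expected_cone_angle_weighted : exists a : \bar R,
  forall k, expected_cone_angle k = a * weighted_cone_integral k.
Proof.
pose c : R := (Gamma 2^-1 / Gamma (d.+1%:R / 2))%R.
exists (((pi `^ (d%:R / 2))^-1 * (ctd d b / Gamma b) ^+ d.+1)%:E *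
  (gaussian_det_moment R d * c%:E)) => k.
rewrite expected_cone_angle_mixture -muleA; congr (_ * _).
have G0 : 0 <= gaussian_det_moment R d by rewrite /gaussian_det_moment; nonneg.
rewrite /weighted_cone_integral -intRdZl; [|by measurability|by nonneg|by rewrite /c; nonneg].
apply: eq_intRd => t; under eq_intRd do rewrite intM_integrand.
have [/forallP t0|t0] := boolP [forall i, (0 < t ord0 i)%R]; last first.
  rewrite gamma_prod_eq0 // mul0r mul0e !mule0 -[RHS](@intRd0 R d).
  by apply: eq_intRd => l; rewrite mul0e.
rewrite intRdZl; [|by measurability|by nonneg|by nonneg].
by rewrite cauchy_cone_integral // -/c -!muleA; congr (_ * _); rewrite muleCA.
Qed.

Definition mellin_cone_integral (a : R) k : \bar R := intRd (fun t =>
  (mellin_prod s t * expR (- (a * \sum_i t ord0 i)) * Num.sqrt (\sum_i t ord0 i))%:E *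
  gauss_cone_integral k t).

Lemma weighted_cone_integralE k : weighted_cone_integral k = mellin_cone_integral 1 k.
Proof. by apply: eq_intRd => t; rewrite gamma_prodE mul1r. Qed.

(* The integrand is homogeneous of degree [alpha * (d + 1) / 2 - (d + 1)] up to
   the exponential. *)
Lemma mellin_cone_integral_scale (a : R) k : (0 < a)%R ->
  mellin_cone_integral a k =
  (a `^ (- (alpha * d.+1%:R / 2)))%:E * mellin_cone_integral 1 k.
Proof.
move=> a0; rewrite [in RHS]/mellin_cone_integral -(intRd_scale (lt0r_neq0 a0)); [|integral_side..].
rewrite gtr0_norm // /mellin_cone_integral muleA -EFinM -intRdZl; [|integral_side..].
apply: eq_intRd => t; rewrite gauss_cone_integral_scale // muleA -EFinM muleA -EFinM.
have -> : (\sum_i (a *: t)%R ord0 i = a * \sum_i t ord0 i)%R.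
  by rewrite mulr_sumr; apply: eq_bigr => i _; rewrite mxE.
congr (_%:E * _); rewrite mul1r mellin_prod_scale // sqrtrM ?(ltW a0) // -(powR12_sqrt (ltW a0)).
set S := (\sum_i _)%R; set M := mellin_prod s t.
have exponents : (a `^ (- (alpha * d.+1%:R / 2)) * a ^+ d.+1 * a `^ ((s - 1) * d.+1%:R) *
    a `^ 2^-1 * a `^ (d%:R / 2) = 1)%R.
  rewrite -powR_mulrn ?(ltW a0) // -!powRD_gt0 // -[RHS](powRr0 a); congr powR.
  by rewrite -natr1; field.
by rewrite -[LHS]mul1r -[X in (X * _)%R]exponents; ring.
Qed.

Definition cone_integral k : \bar R := intRd (fun t =>
  (gamma_prod s t)%:E * gauss_cone_integral k t).

(* Insert [1 = sqrt S / Gamma(1/2) * int_0^oo u^(-1/2) exp (- S u) du], [S = sum_i t_i]. *)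
Lemma cone_integral_weighted : exists c : \bar R,
  forall k, cone_integral k = c * weighted_cone_integral k.
Proof.
exists (\int[mu]_u (mellin_ker 2^-1 u * (1 + u) `^ (- (alpha * d.+1%:R / 2)) / Gamma 2^-1)%:E).
move=> k; rewrite weighted_cone_integralE -ge0_integralZr; [|integral_side..|]; last first.
  by rewrite /mellin_cone_integral; nonneg.
pose f (u : R) t : \bar R := (mellin_ker 2^-1 u / Gamma 2^-1)%:E *
  ((mellin_prod s t * expR (- ((1 + u) * \sum_i t ord0 i)) * Num.sqrt (\sum_i t ord0 i))%:E *
  gauss_cone_integral k t).
transitivity (\int[mu]_u intRd (f u)); last first.
  apply: eq_integral => u _; rewrite /f intRdZl; [|integral_side..].
  have [u0|u0] := leP u 0%R.
    by rewrite /mellin_ker ltNge u0 !mul0r !mul0e.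
  rewrite -/(mellin_cone_integral (1 + u) k) mellin_cone_integral_scale ?addr_gt0 //.
  by rewrite muleA -EFinM mulrAC.
rewrite -(intRd_integral (f := f)); [|by rewrite /f; measurability|by rewrite /f; nonneg].
apply: eq_intRd => t; rewrite /f.
have [/forallP t0|t0] := boolP [forall i, (0 < t ord0 i)%R]; last first.
  rewrite gamma_prod_eq0 // mul0e integral0_eq // => u _.
  by rewrite mellin_prod_eq0 // !mul0r mul0e mule0.
set S := (\sum_i t ord0 i)%R.
have S0 : (0 < S)%R by rewrite /S big_ord_recl ltr_pwDl // sumr_ge0 // => i _; exact: ltW.
transitivity (\int[mu]_u ((gamma_prod s t * Num.sqrt S / Gamma 2^-1)%:E * gauss_cone_integral k t *
    (mellin_ker 2^-1 u * expR (- (S * u)))%:E)); last first.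
  apply: eq_integral => u _; rewrite muleA -EFinM muleAC -EFinM; congr (_%:E * _).
  have -> : (- ((1 + u) * S) = - S - S * u)%R by ring.
  by rewrite gamma_prodE -/S expRD; ring.
rewrite ge0_integralZl; [|integral_side..].
rewrite integral_mellin_ker_expR // muleAC -EFinM; congr (_%:E * _).
rewrite powRN powR12_sqrt ?(ltW S0) //.
by field; rewrite !gt_eqF ?Gamma_gt0 ?sqrtr_gt0.
Qed.

Lemma expected_angle_ratio k : (0 < k <= d)%N ->
  expected_angle d.+1 k b * cone_integral d.+1 = cone_integral k.
Proof.
move=> kd; rewrite expected_angleE //.
have [a aE] := expected_cone_angle_weighted; have [c cE] := cone_integral_weighted.
have a1 : a * weighted_cone_integral d.+1 = 1 by rewrite -aE expected_cone_angle_full.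
by rewrite aE !cE [c * weighted_cone_integral d.+1]muleC muleACA a1 mul1e muleC.
Qed.

End expected_angle.

Section real_integrals.
Variable R : realType.
Local Notation mu := (@lebesgue_measure R).
Implicit Types f h : R -> R.

Lemma integrable_measurable_fun f : mu.-integrable setT (EFin \o f) -> measurable_fun setT f.
Proof. by move=> intf; apply/measurable_EFinP; exact: (measurable_int _ intf). Qed.

Lemma integrable_mul_bounded (C : R) h f : measurable_fun setT h -> (forall x, `|h x| <= C) ->
  mu.-integrable setT (EFin \o f) -> mu.-integrable setT (fun x => (h x * f x)%:E).
Proof.
move=> mh hC; apply: integrableMr => //; exists C; split; first exact: num_real.
by move=> M /ltW CM x _ /=; exact: le_trans (hC x) CM.
Qed.

Lemma integrable_fine (f : R -> \bar R) : mu.-integrable setT f ->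
  mu.-integrable setT (EFin \o (fine \o f)).
Proof.
move=> intf; apply: (le_integrable _ _ _ intf) => //.
  apply/measurable_EFinP/(measurableT_comp (@fine_measurable R setT measurableT)).
  exact: measurable_int intf.
by move=> x _ /=; case: (f x) => [r| |] /=; rewrite ?normr0 ?leey.
Qed.

Lemma integral_mul_fine (f g : R -> \bar R) : mu.-integrable setT f -> measurable_fun setT g ->
  (\int[mu]_x ((fine (f x))%:E * g x) = \int[mu]_x (f x * g x))%E.
Proof.
move=> intf mg; apply: ae_eq_integral => //.
- apply: emeasurable_funM => //.
  by apply/measurable_EFinP; exact: integrable_measurable_fun (integrable_fine intf).
- by apply: emeasurable_funM => //; exact: measurable_int intf.
- have := integrable_ae measurableT intf; apply: filterS => x fx _.
  by rewrite fineK // fx.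
Qed.

Lemma integral_fine (f : R -> \bar R) : mu.-integrable setT f ->
  (\int[mu]_x (fine (f x))%:E = \int[mu]_x f x)%E.
Proof.
move=> intf; have := integral_mul_fine (g := fun=> 1%:E) intf (measurable_cst _).
by under eq_integral do rewrite mule1; under [RHS]eq_integral do rewrite mule1.
Qed.

Lemma ge0_RintegralZl (c : R) f : measurable_fun setT f -> (forall x, 0 <= f x) ->
  \int[mu]_x (c * f x) = c * \int[mu]_x f x.
Proof.
move=> mf f0; have mF : measurable_fun setT (EFin \o f) by exact/measurable_EFinP.
have F0 : (0 <= \int[mu]_x (f x)%:E)%E by apply: integral_ge0 => x _; rewrite lee_fin.
have posZ (a : R) : 0 <= a -> (\int[mu]_x (a * f x)%:E = a%:E * \int[mu]_x (f x)%:E)%E.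
  by move=> a0; rewrite -ge0_integralZl; [|integral_side..].
have [Fy|] := ltP (\int[mu]_x (f x)%:E)%E +oo%E.
  rewrite RintegralZl //; apply/integrableP; split => //.
  by under eq_integral do rewrite abse_EFin ger0_norm //.
rewrite leye_eq => /eqP Fy; rewrite /Rintegral Fy mulr0.
have [->|c0] := eqVneq c 0; first by rewrite posZ // mul0e.
have [c1|c1] := leP 0 c; first by rewrite posZ // Fy gt0_muley // lte_fin lt_neqAle eq_sym c0.
have -> : (\int[mu]_x (c * f x)%:E = - \int[mu]_x (- c * f x)%:E)%E.
  rewrite -integral_ge0N => [|x _]; last by rewrite lee_fin mulr_ge0 // oppr_ge0 ltW.
  by apply: eq_integral => x _; rewrite -EFinN mulNr opprK.
by rewrite posZ ?oppr_ge0 ?(ltW c1) // Fy gt0_muley // lte_fin oppr_gt0.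
Qed.

Lemma integrable_scale (c : R) f : c != 0 -> mu.-integrable setT (EFin \o f) ->
  mu.-integrable setT (fun x => (f (c * x))%:E).
Proof.
move=> c0 intf; have mf := integrable_measurable_fun intf.
apply/integrableP; split; first by measurability.
under eq_integral do rewrite abse_EFin.
rewrite (ge0_integral_scale (f := fun x => (`|f x|)%:E) c0); [|integral_side..].
case/integrableP: intf => _ fy.
by rewrite lte_mul_pinfty // lee_fin invr_ge0.
Qed.

Lemma Rintegral_scale (c : R) f : c != 0 -> mu.-integrable setT (EFin \o f) ->
  \int[mu]_x f (c * x) = `|c|^-1 * \int[mu]_x f x.
Proof.
move=> c0 intf; have mF : measurable_fun setT (EFin \o f) := measurable_int _ intf.
rewrite /Rintegral -[RHS]/(fine _%:E * _) -fineM //; last exact: integrable_fin_num.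
congr fine; rewrite integralE [in RHS]integralE muleDr //; last first.
  by apply: fin_num_adde_defl; rewrite fin_numN; exact: integrable_neg_fin_num intf.
congr (_ + _)%E.
- rewrite -(ge0_integral_scale c0 (measurable_funepos mF) (funepos_ge0 _)).
  by apply: eq_integral => x _; rewrite !funeposE.
- rewrite muleN -(ge0_integral_scale c0 (measurable_funeneg mF) (funeneg_ge0 _)).
  by congr (- _)%E; apply: eq_integral => x _; rewrite !funenegE.
Qed.

Lemma Rintegral_odd f : measurable_fun setT f -> (forall x, f (- x) = - f x) ->
  \int[mu]_x f x = 0.
Proof.
move=> mf fN; have mF : measurable_fun setT (EFin \o f) by exact/measurable_EFinP.
rewrite /Rintegral integralE -(ge0_integral_opp (measurable_funepos mF) (funepos_ge0 _)).
rewrite (_ : (\int[mu]_x _ = \int[mu]_x ((EFin \o f)^\- x))%E).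
  by case: (\int[mu]_x _)%E => [r| |] //=; rewrite subrr.
by apply: eq_integral => x _; rewrite funeposE funenegE /= fN EFinN.
Qed.

Lemma Rintegral_even f : mu.-integrable setT (EFin \o f) -> (forall x, f (- x) = f x) ->
  \int[mu]_x f x = 2 * \int[mu]_x ((0 <= x)%R%:R * f x).
Proof.
move=> intf fN; pose p x : R := (0 <= x)%R%:R * f x; pose n x : R := (0 < x)%R%:R * f x.
have intp : mu.-integrable setT (EFin \o p).
  apply: (@integrable_mul_bounded 1) intf; first by measurability.
  by move=> x; rewrite normr_nat lern1 leq_b1.
have intn : mu.-integrable setT (EFin \o n).
  apply: (@integrable_mul_bounded 1) intf; first by measurability.
  by move=> x; rewrite normr_nat lern1 leq_b1.
have N1 : (-1 : R) != 0 by rewrite oppr_eq0 oner_eq0.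
have -> : \int[mu]_x f x = \int[mu]_x p x + \int[mu]_x n (-1 * x).
  rewrite -RintegralD //; last exact: integrable_scale.
  apply: eq_Rintegral => x _; rewrite /p /n mulN1r fN oppr_gt0 -mulrDl ltNge.
  by case: (0 <= x); rewrite ?addr0 ?add0r mul1r.
rewrite (Rintegral_scale N1 intn) normrN1 invr1 mul1r [in RHS]mulr_natl mulr2n; congr (_ + _).
rewrite /Rintegral; congr fine; apply: ae_eq_integral => //;
  [exact: (measurable_int _ intn)|exact: (measurable_int _ intp)|].
exists [set 0]; split; [exact: measurable_set1|exact: lebesgue_measure_set1|].
move=> x /= np; apply: contrapT => x0; apply: np => _; rewrite /n /p.
by rewrite lt_neqAle; move/eqP: x0; rewrite eq_sym => ->.
Qed.

Lemma integral2_tensor_lty (f : R * R -> R) (a b : R -> R) : measurable_fun setT f ->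
  mu.-integrable setT (EFin \o a) -> mu.-integrable setT (EFin \o b) ->
  (forall x, 0 <= a x) -> (forall y, 0 <= b y) ->
  (forall x y, `|f (x, y)| <= a x * b y) ->
  (\int[mu]_x \int[mu]_y `|f (x, y)|%:E < +oo)%E.
Proof.
move=> mf inta intb a0 b0 fab.
have ma := integrable_measurable_fun inta; have mb := integrable_measurable_fun intb.
have ge0_lty (h : R -> R) : mu.-integrable setT (EFin \o h) -> (forall x, 0 <= h x) ->
    (\int[mu]_x (h x)%:E < +oo)%E.
  move=> /integrableP[_]; under eq_integral do rewrite abse_EFin.
  by move=> + h0; under eq_integral do rewrite ger0_norm //.
apply: (@le_lt_trans _ _ (\int[mu]_x ((a x)%:E * \int[mu]_y (b y)%:E))%E).
  apply: ge0_le_integral => //.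
  - by move=> x _; nonneg.
  - by measurability.
  - by measurability.
  move=> x _; rewrite -ge0_integralZl; [|integral_side..].
  apply: ge0_le_integral => //; [by measurability|by measurability|].
  by move=> y _; rewrite lee_fin.
rewrite ge0_integralZr; [|integral_side..].
apply: lte_mul_pinfty; [by nonneg| |exact: ge0_lty].
by rewrite ge0_fin_numE ?ge0_lty //; nonneg.
Qed.

Section fubini.
Variable f : R * R -> R.
Hypothesis mf : measurable_fun setT f.
Hypothesis fy : (\int[mu]_x \int[mu]_y `|f (x, y)|%:E < +oo)%E.

Let intf : (mu \x mu)%E.-integrable setT (EFin \o f).
Proof. by apply/integrable12ltyP => //; exact/measurable_EFinP. Qed.

Let intf_swap : (mu \x mu)%E.-integrable setT (EFin \o (fun p => f (p.2, p.1))).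
Proof.
apply/integrable12ltyP; last exact: ((integrable21ltyP mu mu (measurable_int _ intf)).1 intf).
by apply/measurable_EFinP; apply: (measurableT_comp mf); exact: measurable_swap.
Qed.

Lemma integral_Rintegral1 :
  (\int[mu]_x (\int[mu]_y f (x, y))%:E = (\int[mu]_x \int[mu]_y f (x, y))%:E)%E.
Proof.
rewrite -[LHS]fineK //; apply: (integrable_fin_num measurableT).
exact: integrable_fine (integrable_fubini_F intf).
Qed.

Lemma integral_Rintegral2 :
  (\int[mu]_y (\int[mu]_x f (x, y))%:E = (\int[mu]_y \int[mu]_x f (x, y))%:E)%E.
Proof.
rewrite -[LHS]fineK //; apply: (integrable_fin_num measurableT).
exact: integrable_fine (integrable_fubini_F intf_swap).
Qed.

Lemma Rintegral_fubini :
  \int[mu]_x \int[mu]_y f (x, y) = \int[mu]_y \int[mu]_x f (x, y).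
Proof.
rewrite /Rintegral; congr fine.
rewrite (integral_fine (integrable_fubini_F intf)) (integral_fine (integrable_fubini_F intf_swap)).
exact: (Fubini intf).
Qed.

End fubini.

End real_integrals.

Section kernel_transform.
Variable R : realType.
Local Notation mu := (@lebesgue_measure R).
Implicit Types h g : R -> R.

Definition kernel_transform h g (v : R) : R := \int[mu]_x (g x * h (v * x)).

Section bounded_kernel.
Variables h g : R -> R.
Hypothesis mh : measurable_fun setT h.
Hypothesis h1 : forall x, `|h x| <= 1.
Hypothesis intg : mu.-integrable setT (EFin \o g).

Let mg := integrable_measurable_fun intg.

Lemma integrable_kernel (v : R) : mu.-integrable setT (fun x => (g x * h (v * x))%:E).
Proof.
under eq_fun do rewrite mulrC.
by apply: (@integrable_mul_bounded _ 1) intg => //; measurability.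
Qed.

Hypothesis g0 : forall x, 0 <= g x.

Lemma measurable_kernel_transform : measurable_fun setT (kernel_transform h g).
Proof.
have h1_ge0 x : 0 <= 1 + h x.
  by rewrite -lerBlDl sub0r; have := h1 x; rewrite ler_norml => /andP[].
pose shifted (v : R) : \bar R := (\int[mu]_x (g x * (1 + h (v * x)))%:E)%E.
have m_shifted : measurable_fun setT shifted by rewrite /shifted; measurability; nonneg.
rewrite (_ : kernel_transform h g = (fun v => fine (shifted v) - \int[mu]_x g x)).
  by apply: measurable_funB => //; exact: (measurableT_comp (@fine_measurable R setT measurableT)).
apply/funext => v; rewrite -/(Rintegral mu setT (fun x => g x * (1 + h (v * x)))).
rewrite (_ : Rintegral _ _ _ = \int[mu]_x g x + kernel_transform h g v); first by rewrite addrC addKr.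
rewrite -RintegralD //; last exact: integrable_kernel.
by apply: eq_Rintegral => x _; rewrite mulrDr mulr1.
Qed.

Lemma normr_kernel_transform_le (v : R) : `|kernel_transform h g v| <= \int[mu]_x g x.
Proof.
have intk := integrable_kernel v.
apply: (le_trans (le_normr_Rintegral measurableT intk)).
apply: le_Rintegral => //; first exact: (integrable_abse intk).
by move=> x _; rewrite normrM (ger0_norm (g0 x)) ler_piMr.
Qed.

End bounded_kernel.

End kernel_transform.

Section half_gauss.
Variable R : realType.
Local Notation mu := (@lebesgue_measure R).
Implicit Types (f h : R -> R) (a y : R).

Lemma integral_is_derive_halfline f F : (forall y, is_derive y 1 F (f y)) ->
  continuous f -> mu.-integrable setT (fun y => ((0 <= y)%R%:R * f y)%:E) ->
  F n%:R @[n --> \oo] --> 0 -> \int[mu]_y ((0 <= y)%R%:R * f y) = - F 0.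
Proof.
move=> dF cf intf F0; have mf := continuous_measurable_fun cf.
pose f_ n y : \bar R := ((y \in `[0%R, n%:R])%:R * f y)%:E.
have f_cvg : (\int[mu]_y f_ n y @[n --> \oo] --> \int[mu]_y ((0 <= y)%R%:R * f y)%:E)%E.
  apply: (@dominated_cvg _ _ _ mu setT _ f_ _ _ _ _ _ (integrable_abse intf)) => //.
  - by move=> n; rewrite /f_; measurability.
  - move=> y _; apply: cvg_near_cst; exists (Num.trunc y).+1 => // n /= yn.
    by rewrite /f_ in_itv /= (le_trans (ltW (truncnS_gt y))) ?andbT // ler_nat.
  - move=> n y _; rewrite /f_ /= lee_fin !normrM ler_wpM2r // in_itv /= !normr_nat ler_nat.
    by case: (0 <= y) => //=; case: (y <= _).
have f_E n : (\int[mu]_y f_ n y = (F n%:R - F 0)%:E)%E.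
  rewrite -integral_itv_indicator; apply: integral_is_derive => // x _; exact: cf.
have F_cvg : ((F n%:R - F 0)%:E @[n --> \oo] --> (- F 0)%:E)%E.
  apply: cvg_EFin; first exact: nearW.
  by rewrite -[X in _ --> X]add0r; apply: cvgB => //; exact: cvg_cst.
rewrite /Rintegral; move: f_cvg; under eq_fun do rewrite f_E.
by move=> /(cvg_unique _) /(_ F_cvg) ->.
Qed.

Lemma is_derive_mull a y : is_derive y 1 (fun y : R => a * y) a.
Proof.
by apply: (is_derive_eq (is_deriveZ a (is_derive_id y (1 : R)))); rewrite /GRing.scale /= mulr1.
Qed.

Lemma is_derive_gauss_fun y : is_derive y 1 gauss_fun (- (2 * y * gauss_fun y)).
Proof.
have dsqr : is_derive y 1 (fun y : R => - y ^+ 2) (- (2 * y)).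
  by apply: is_derive_eq; rewrite /GRing.scale /= mulr1; ring.
by apply: is_derive_eq (is_derive1_comp (f := expR) _ dsqr) _; rewrite mulrC mulNr.
Qed.

Lemma cvg_gauss_fun_mul_bounded h : (forall x, `|h x| <= 1) ->
  gauss_fun n%:R * h n%:R @[n --> \oo] --> 0.
Proof.
move=> h1; have g0 : gauss_fun n%:R @[n --> \oo] --> (0 : R).
  exact: (cvg_comp _ _ (@cvgr_idn R) (@cvg_gauss_fun R)).
have gN0 : - gauss_fun n%:R @[n --> \oo] --> (0 : R).
  by rewrite -[X in _ --> X]oppr0; exact: cvgN.
apply: (squeeze_cvgr _ gN0 g0); apply: nearW => n /=.
by rewrite -ler_norml normrM ger0_norm ?gauss_fun_ge0 // ler_piMr ?gauss_fun_ge0.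
Qed.

Definition half_gauss_fun y : R := (0 <= y)%R%:R * gauss_fun y.

Definition half_gauss h : R -> R := kernel_transform h half_gauss_fun.

Definition half_gauss_moment h : R -> R :=
  kernel_transform h (fun y => y * half_gauss_fun y).

Lemma half_gauss_fun_ge0 y : 0 <= half_gauss_fun y.
Proof. by rewrite /half_gauss_fun /gauss_fun; nonneg. Qed.

Lemma half_gauss_fun_lt0 y : y < 0 -> half_gauss_fun y = 0.
Proof. by move=> y0; rewrite /half_gauss_fun leNgt y0 mul0r. Qed.

Lemma integrable_half_gauss_fun : mu.-integrable setT (EFin \o half_gauss_fun).
Proof.
apply: (@integrable_mul_bounded _ 1 (fun y => (0 <= y)%R%:R) gauss_fun); [by measurability| |].
  by move=> y; rewrite normr_nat lern1 leq_b1.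
exact: integrableT_gauss.
Qed.

Lemma mul_half_gauss_fun_ge0 y : 0 <= y * half_gauss_fun y.
Proof.
have [y0|y0] := ltP y 0; first by rewrite half_gauss_fun_lt0 ?mulr0.
by rewrite mulr_ge0 ?half_gauss_fun_ge0.
Qed.

Lemma mul_half_gauss_fun_le y : y * half_gauss_fun y <= expR (- (2^-1 * y ^+ 2)).
Proof.
have [y0|y0] := ltP y 0; first by rewrite half_gauss_fun_lt0 // mulr0 expR_ge0.
rewrite /half_gauss_fun y0 mul1r /gauss_fun.
have -> : - y ^+ 2 = - (2^-1 * y ^+ 2) - 2^-1 * y ^+ 2 by field.
rewrite expRD mulrCA ler_piMr ?expR_ge0 // expRN ler_pdivrMr ?expR_gt0 // mul1r.
by apply: le_trans (expR_ge1Dx _); nra.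
Qed.

Lemma integrable_gauss_scale (t : R) : 0 < t ->
  mu.-integrable setT (fun y => (expR (- (t * y ^+ 2)))%:E).
Proof.
move=> t0; have s0 : Num.sqrt t != 0 by rewrite gt_eqF // sqrtr_gt0.
apply: (eq_integrable measurableT _ _ _ (integrable_scale s0 integrableT_gauss)) => y _.
by rewrite /gauss_fun exprMn sqr_sqrtr // ltW.
Qed.

Lemma integrable_mul_half_gauss_fun :
  mu.-integrable setT (fun y => (y * half_gauss_fun y)%:E).
Proof.
have half0 : 0 < 2^-1 :> R by rewrite invr_gt0.
apply: (le_integrable _ _ _ (integrable_gauss_scale half0)) => // [|y _].
  by rewrite /half_gauss_fun /gauss_fun; measurability.
rewrite /= lee_fin ger0_norm ?mul_half_gauss_fun_ge0 // ger0_norm ?expR_ge0 //.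
exact: mul_half_gauss_fun_le.
Qed.

Section derivative.
Variables h h' : R -> R.
Hypothesis dh : forall x : R, is_derive x 1 h (h' x).
Hypothesis ch' : continuous h'.
Hypothesis h1 : forall x : R, `|h x| <= 1.
Hypothesis h1' : forall x, `|h' x| <= 1.

Let ch : continuous h. Proof. by move=> x; exact: is_derive1_continuous (dh x). Qed.
Let mh := continuous_measurable_fun ch.
Let mh' := continuous_measurable_fun ch'.

Let is_derive_scale a y : is_derive y 1 (fun y => h (a * y)) (a * h' (a * y)).
Proof.
by apply: (is_derive_eq (is_derive1_comp (dh (a * y)) (is_derive_mull a y))); rewrite mulrC.
Qed.

Lemma half_gauss_momentE a : half_gauss_moment h a = (h 0 + a * half_gauss h' a) / 2.
Proof.
pose f y := a * (gauss_fun y * h' (a * y)) - 2 * (y * gauss_fun y * h (a * y)).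
have df y : is_derive y 1 (fun y => gauss_fun y * h (a * y)) (f y).
  apply: (is_derive_eq (is_deriveM (is_derive_gauss_fun y) (is_derive_scale a y))).
  by rewrite /GRing.scale /= /f; ring.
have cf : continuous f.
  have cg : continuous (@gauss_fun R) := @continuous_gauss_fun R.
  have ca (k : R -> R) : continuous k -> continuous (fun y => k (a * y)).
    by move=> ck y; apply: (continuous_comp (f := fun y => a * y)); [exact: mulrl_continuous|exact: ck].
  move=> y; apply: cvgB; apply: cvgM; try exact: cvg_cst.
    by apply: cvgM; [exact: cg|exact: ca].
  by apply: cvgM; [apply: cvgM; [exact: cvg_id|exact: cg]|exact: ca].
have fE : (fun y => ((0 <= y)%R%:R * f y)%:E) =
    (fun y => (a * (half_gauss_fun y * h' (a * y)) - 2 * (y * half_gauss_fun y * h (a * y)))%:E).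
  by apply/funext => y; rewrite /f /half_gauss_fun; congr EFin; ring.
have int_h' := integrable_kernel mh' h1' integrable_half_gauss_fun a.
have int_h := integrable_kernel mh h1 integrable_mul_half_gauss_fun a.
have int_ah' := integrableZl measurableT a int_h'; have int_2h := integrableZl measurableT 2 int_h.
have intf : mu.-integrable setT (fun y => ((0 <= y)%R%:R * f y)%:E).
  by rewrite fE; exact: (integrableB measurableT int_ah' int_2h).
have := integral_is_derive_halfline df cf intf (cvg_gauss_fun_mul_bounded (fun y => h1 (a * y))).
rewrite /Rintegral fE -!/(Rintegral mu setT _) RintegralB //.
rewrite (RintegralZl _ measurableT int_h) (RintegralZl _ measurableT int_h').
rewrite mulr0 /gauss_fun expr0n /= oppr0 expR0 mul1r => by_parts.
by rewrite /half_gauss_moment /half_gauss /kernel_transform; lra.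
Qed.

Lemma is_derive_half_gauss_moment a : is_derive a 1 (half_gauss h) (half_gauss_moment h' a).
Proof.
pose f (x y : R) : R := half_gauss_fun y * h (x * y).
have df (x y : R) : is_derive x 1 (f^~ y) (y * half_gauss_fun y * h' (x * y)).
  have dxy : is_derive x 1 (fun x => h (x * y)) (y * h' (x * y)).
    rewrite [x * y]mulrC (_ : (fun x => _) = (fun x => h (y * x))); first exact: is_derive_scale.
    by apply/funext => z; rewrite mulrC.
  apply: (is_derive_eq (is_deriveZ (half_gauss_fun y) dxy)).
  by rewrite /GRing.scale /=; ring.
have d1 (x y : R) : partial1of2 f x y = y * half_gauss_fun y * h' (x * y).
  by rewrite partial1of2E; have := df x y => ?; rewrite derive_val.
have Ia : `](a - 1), (a + 1)[%classic a by rewrite /= in_itv /= ltrBlDr ltrDl ltr01.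
have d1_le (x y : R) : `](a - 1), (a + 1)[%classic x -> setT y ->
    `|partial1of2 f x y| <= y * half_gauss_fun y.
  by move=> _ _; rewrite d1 normrM ger0_norm ?mul_half_gauss_fun_ge0 // ler_piMr
    ?mul_half_gauss_fun_ge0.
have derf (x y : R) : `](a - 1), (a + 1)[%classic x -> setT y -> derivable (f^~ y) x 1.
  by move=> _ _; have := df x y => ?; exact: ex_derive.
have intf (x : R) : `](a - 1), (a + 1)[%classic x -> mu.-integrable setT (EFin \o f x).
  by move=> _; exact: (integrable_kernel mh h1 integrable_half_gauss_fun).
apply: DeriveDef.
  exact: (@derivable_under_integral R _ (measurableTypeR R) mu f setT measurableT a _ _ Ia intf derf
    _ mul_half_gauss_fun_ge0 integrable_mul_half_gauss_fun d1_le).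
rewrite -derive1E (@differentiation_under_integral R _ (measurableTypeR R) mu f setT measurableT a _ _
  Ia intf derf _ mul_half_gauss_fun_ge0 integrable_mul_half_gauss_fun d1_le).
by apply: eq_Rintegral => y _; rewrite d1.
Qed.

End derivative.

Lemma is_derive_half_gauss h h' a : (forall x : R, is_derive x 1 h (h' x)) ->
  (forall x : R, is_derive x 1 h' (- h x)) ->
  (forall x, `|h x| <= 1) -> (forall x, `|h' x| <= 1) ->
  is_derive a 1 (half_gauss h) ((h' 0 - a * half_gauss h a) / 2).
Proof.
move=> dh dh' h1 h1'.
have ch : continuous h by move=> x; exact: is_derive1_continuous (dh x).
have cN : continuous (fun x => - h x) by move=> x; apply: cvgN; exact: ch.
apply: is_derive_eq (is_derive_half_gauss_moment dh h1 h1' a) _.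
rewrite (half_gauss_momentE dh' cN h1') => [|x]; last by rewrite normrN.
congr ((_ + _) / _); rewrite -mulrN; congr (_ * _).
rewrite -[RHS]mulN1r -RintegralZl //; first by apply: eq_Rintegral => y _; rewrite mulN1r mulrN.
exact: (integrable_kernel (continuous_measurable_fun ch) h1 integrable_half_gauss_fun).
Qed.

End half_gauss.

Section gauss_transforms.
Variable R : realType.
Local Notation mu := (@lebesgue_measure R).
Implicit Types a c x : R.

Lemma normr_cos_le1 x : `|cos x| <= 1.
Proof. by rewrite ler_norml cos_geN1 cos_le1. Qed.

Lemma normr_sin_le1 x : `|sin x| <= 1.
Proof. by rewrite ler_norml sin_geN1 sin_le1. Qed.

Lemma is_derive_half_gauss_cos a :
  is_derive a 1 (half_gauss cos) (- (a * half_gauss cos a) / 2).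
Proof.
have dcos x : is_derive x 1 (@cos R) (- sin x) by exact: is_derive_cos.
have dNsin x : is_derive x 1 (fun x => - sin x) (- cos x) by exact: is_deriveN.
have Nsin1 x : `|- sin x| <= 1 by rewrite normrN normr_sin_le1.
apply: is_derive_eq (is_derive_half_gauss a dcos dNsin normr_cos_le1 Nsin1) _.
by rewrite sin0 oppr0 sub0r.
Qed.

Lemma is_derive_half_gauss_sin a :
  is_derive a 1 (half_gauss sin) ((1 - a * half_gauss sin a) / 2).
Proof.
have dsin x : is_derive x 1 (@sin R) (cos x) by exact: is_derive_sin.
have dcos x : is_derive x 1 (@cos R) (- sin x) by exact: is_derive_cos.
apply: is_derive_eq (is_derive_half_gauss a dsin dcos normr_sin_le1 normr_cos_le1) _.
by rewrite cos0.
Qed.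

Lemma is_derive_expR_sqr c a :
  is_derive a 1 (fun a => expR (c * a ^+ 2)) (2 * c * a * expR (c * a ^+ 2)).
Proof.
have dsqr : is_derive a 1 (fun a : R => c * a ^+ 2) (2 * c * a).
  by apply: is_derive_eq; rewrite /GRing.scale /=; ring.
by apply: is_derive_eq (is_derive1_comp (f := expR) _ dsqr) _; rewrite mulrC.
Qed.

Lemma half_gauss_cosE a : half_gauss cos a = Num.sqrt pi / 2 * expR (- (a ^+ 2 / 4)).
Proof.
have d0 x : is_derive x 1 (fun x => half_gauss cos x * expR (4^-1 * x ^+ 2)) 0.
  apply: (is_derive_eq (is_deriveM (is_derive_half_gauss_cos x) (is_derive_expR_sqr 4^-1 x))).
  by rewrite /GRing.scale /=; field.
have := is_derive_0_is_cst a 0 d0; rewrite expr0n /= mulr0 expR0 mulr1 [4^-1 * _]mulrC => gE.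
rewrite expRN -[LHS](mulfK (lt0r_neq0 (expR_gt0 (a ^+ 2 / 4)))) gE; congr (_ / _).
rewrite /half_gauss /kernel_transform /Rintegral -[RHS]/(fine (Num.sqrt pi / 2)%:E) -integral0y_gauss.
rewrite integral_itv_indicator; congr fine; apply: eq_integral => y _.
by rewrite mul0r cos0 mulr1 in_itv /= andbT.
Qed.

(* Dawson's integral: both sides solve [2 f' = 1 - a f], [f 0 = 0]. *)
Lemma half_gauss_sinE a : half_gauss sin a =
  a / 2 * \int[mu]_u ((u \in `[0, 1]%R)%:R * expR (- (a ^+ 2 / 4 * (1 - u ^+ 2)))).
Proof.
pose F u := half_gauss sin (a * u) * expR (4^-1 * a ^+ 2 * u ^+ 2) * expR (- (a ^+ 2 / 4)).
pose f u : R := expR (a ^+ 2 / 4 * u ^+ 2) * expR (- (a ^+ 2 / 4)).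
have fE u : expR (- (a ^+ 2 / 4 * (1 - u ^+ 2))) = f u.
  by rewrite /f -expRD; congr expR; ring.
have dF (u : R) : is_derive u 1 F (a / 2 * f u).
  have dsin := is_derive1_comp (is_derive_half_gauss_sin (a * u)) (is_derive_mull a u).
  have dexp := is_deriveM dsin (is_derive_expR_sqr (4^-1 * a ^+ 2) u).
  apply: (is_derive_eq (is_deriveM dexp (is_derive_cst (expR (- (a ^+ 2 / 4))) u (1 : R)))).
  by rewrite /GRing.scale /= /f [a ^+ 2 / 4]mulrC; field.
have cf (u : R) : {for u, continuous (fun u => a / 2 * f u)}.
  apply: cvgM; first exact: cvg_cst.
  by apply: cvgM (is_derive1_continuous (is_derive_expR_sqr _ _)) (cvg_cst _).
rewrite -ge0_RintegralZl; [|by measurability|by nonneg].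
have := @integral_is_derive R _ F 0 1 ler01 (fun u _ => dF u) (fun u _ => cf u).
rewrite integral_itv_indicator => /(congr1 fine) FE.
rewrite /Rintegral; under eq_integral do rewrite mulrCA fE.
rewrite {}FE /F /= mulr0 expr1n !mulr1 [4^-1 * _]mulrC -mulrA -expRD subrr expR0 mulr1.
rewrite [half_gauss sin 0](_ : _ = 0) ?mul0r ?subr0 //.
rewrite /half_gauss /kernel_transform /Rintegral integral0_eq // => y _.
by rewrite mul0r sin0 mulr0.
Qed.

End gauss_transforms.

Section complex_plane.
Variable R : realType.
Implicit Types (x y : R) (z w : R[i]).

Definition cis x : R[i] := Complex (cos x) (sin x).

Lemma cisD x y : cis (x + y) = cis x * cis y.
Proof. by rewrite /cis cosD sinD; apply/eqP; rewrite eq_complex /= [sin x * _ + _]addrC !eqxx. Qed.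

Definition l1norm z : R := `|complex.Re z| + `|complex.Im z|.

Lemma l1norm_ge0 z : 0 <= l1norm z.
Proof. exact: addr_ge0. Qed.

Lemma normr_Re_le z : `|complex.Re z| <= l1norm z.
Proof. by rewrite lerDl. Qed.

Lemma l1normM z w : l1norm (z * w) <= l1norm z * l1norm w.
Proof.
case: z w => [a b] [c e]; rewrite /l1norm /= mulrDl !mulrDr -!normrM.
rewrite [leRHS](_ : _ = (`|a * c| + `|b * e|) + (`|a * e| + `|b * c|)); last by ring.
by rewrite lerD ?ler_normB ?ler_normD.
Qed.

Lemma l1normX z n : l1norm (z ^+ n) <= l1norm z ^+ n.
Proof.
elim: n => [|n IH]; first by rewrite !expr0 /l1norm /= normr1 normr0 addr0.
by rewrite !exprS; apply: le_trans (l1normM _ _) _; rewrite ler_wpM2l ?l1norm_ge0.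
Qed.

Lemma normr_Re_mul_cis_le z x : `|complex.Re (z * cis x)| <= l1norm z.
Proof.
case: z => a b /=; apply: le_trans (ler_normB _ _) _; rewrite /l1norm /= !normrM.
by rewrite lerD // ler_piMr ?normr_cos_le1 ?normr_sin_le1.
Qed.

Lemma Re_real_mul x z : complex.Re (x%:C%C * z) = x * complex.Re z.
Proof. by case: z => a b /=; rewrite mul0r subr0. Qed.

Lemma Im_real_mul x z : complex.Im (x%:C%C * z) = x * complex.Im z.
Proof. by case: z => a b /=; rewrite mul0r addr0. Qed.

End complex_plane.

#[export] Hint Extern 0 (is_true (Order.le _ _)) => exact: l1norm_ge0 : nonneg.

Section fourier_transform.
Variable R : realType.
Local Notation mu := (@lebesgue_measure R).
Implicit Types (g : R -> R) (Z : R -> R[i]) (v s x : R).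

Definition fourier_transform g v : R[i] :=
  Complex (kernel_transform cos g v) (kernel_transform sin g v).

Definition complex_integrable Z := mu.-integrable setT (fun v => (complex.Re (Z v))%:E) /\
  mu.-integrable setT (fun v => (complex.Im (Z v))%:E).

Lemma integrable_l1norm Z : complex_integrable Z ->
  mu.-integrable setT (fun v => (l1norm (Z v))%:E).
Proof.
by move=> [intR intI]; exact: (integrableD measurableT (integrable_abse intR) (integrable_abse intI)).
Qed.

Lemma measurable_Re_mul_cis (d : measure_display) (T : measurableType d)
    (z : T -> R[i]) (f : T -> R) : measurable_fun setT (fun p => complex.Re (z p)) ->
  measurable_fun setT (fun p => complex.Im (z p)) -> measurable_fun setT f ->
  measurable_fun setT (fun p => complex.Re (z p * cis (f p))).
Proof.
move=> mR mI mf; rewrite (_ : (fun p => _) = (fun p =>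
  complex.Re (z p) * cos (f p) - complex.Im (z p) * sin (f p))); first by measurability.
by apply/funext => p; case: (z p).
Qed.

Lemma integrable_Re_mul_cis Z f : complex_integrable Z -> measurable_fun setT f ->
  mu.-integrable setT (fun v => (complex.Re (Z v * cis (f v)))%:E).
Proof.
move=> intZ mf; apply: (le_integrable _ _ _ (integrable_l1norm intZ)) => //.
  have [intR intI] := intZ; apply/measurable_EFinP.
  exact: measurable_Re_mul_cis (integrable_measurable_fun intR) (integrable_measurable_fun intI) mf.
by move=> v _; rewrite /= lee_fin (ger0_norm (l1norm_ge0 _)) normr_Re_mul_cis_le.
Qed.

Section positive_function.
Variable g : R -> R.
Hypothesis g0 : forall x, 0 <= g x.
Hypothesis intg : mu.-integrable setT (EFin \o g).

Let mcos : measurable_fun setT (@cos R). Proof. by measurability. Qed.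
Let msin : measurable_fun setT (@sin R). Proof. by measurability. Qed.

Lemma complex_integrable_mul_fourier Z : complex_integrable Z ->
  complex_integrable (fun v => Z v * fourier_transform g v).
Proof.
move=> [intR intI].
have mul_cos (f : R -> R) := integrable_mul_bounded (f := f)
  (measurable_kernel_transform mcos (@normr_cos_le1 R) intg g0)
  (normr_kernel_transform_le mcos (@normr_cos_le1 R) intg g0).
have mul_sin (f : R -> R) := integrable_mul_bounded (f := f)
  (measurable_kernel_transform msin (@normr_sin_le1 R) intg g0)
  (normr_kernel_transform_le msin (@normr_sin_le1 R) intg g0).
split.
- apply: eq_integrable (integrableB measurableT (mul_cos _ intR) (mul_sin _ intI)) => // v _.
  by case: (Z v) => a b; rewrite /= -EFinB mulrC [b * _]mulrC.
- apply: eq_integrable (integrableD measurableT (mul_sin _ intR) (mul_cos _ intI)) => // v _.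
  by case: (Z v) => a b; rewrite /= -EFinD mulrC [b * _]mulrC.
Qed.

Lemma Rintegral_Re_mul_cis w v :
  \int[mu]_x (g x * complex.Re (w * cis (v * x))) = complex.Re (w * fourier_transform g v).
Proof.
case: w => a b; rewrite /= /kernel_transform.
have intc := integrable_kernel mcos (@normr_cos_le1 R) intg v.
have ints := integrable_kernel msin (@normr_sin_le1 R) intg v.
have intac := integrableZl measurableT a intc; have intbs := integrableZl measurableT b ints.
rewrite -(RintegralZl a measurableT intc) -(RintegralZl b measurableT ints) -RintegralB //.
by apply: eq_Rintegral => x _; ring.
Qed.

Lemma integral_translate_cis Z s : complex_integrable Z ->
  (\int[mu]_x (g x * \int[mu]_v complex.Re (Z v * cis (v * (s + x))))%:E =
  (\int[mu]_v complex.Re (Z v * fourier_transform g v * cis (v * s)))%:E)%E.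
Proof.
move=> intZ; have [intR intI] := intZ.
pose f (p : R * R) := g p.1 * complex.Re (Z p.2 * cis (p.2 * (s + p.1))).
have mg := integrable_measurable_fun intg.
have mR := integrable_measurable_fun intR; have mI := integrable_measurable_fun intI.
have mf : measurable_fun setT f.
  apply: measurable_funM; first by measurability.
  by apply: measurable_Re_mul_cis; [exact: (measurableT_comp mR)|exact: (measurableT_comp mI)|
    measurability].
have fy : (\int[mu]_x \int[mu]_v `|f (x, v)|%:E < +oo)%E.
  apply: (integral2_tensor_lty mf intg (integrable_l1norm intZ)) => [//|v|x v].
    exact: l1norm_ge0.
  by rewrite /f normrM (ger0_norm (g0 x)) ler_wpM2l ?normr_Re_mul_cis_le.
transitivity (\int[mu]_x (\int[mu]_v f (x, v))%:E)%E.
  apply: eq_integral => x _; congr EFin; rewrite -RintegralZl //.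
  by apply: integrable_Re_mul_cis => //; measurability.
rewrite (integral_Rintegral1 mf fy) (Rintegral_fubini mf fy); congr EFin.
apply: eq_Rintegral => v _; rewrite mulrAC -Rintegral_Re_mul_cis.
by apply: eq_Rintegral => x _; rewrite /f mulrDr cisD mulrA.
Qed.

End positive_function.

Definition gauss_weight (tau v : R) : R :=
  Num.sqrt tau / (2 * Num.sqrt pi) * expR (- (tau / 4 * v ^+ 2)).

Lemma gauss_weight_gt0 tau v : 0 < tau -> 0 < gauss_weight tau v.
Proof. by move=> tau0; rewrite mulr_gt0 ?expR_gt0 // divr_gt0 ?mulr_gt0 ?sqrtr_gt0 ?pi_gt0. Qed.

Lemma measurable_gauss_weight tau : measurable_fun setT (gauss_weight tau).
Proof. by rewrite /gauss_weight; measurability. Qed.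

Lemma integrable_gauss_weight tau : 0 < tau -> mu.-integrable setT (EFin \o gauss_weight tau).
Proof.
move=> tau0; have tau4 : 0 < tau / 4 by rewrite divr_gt0.
exact: (integrableZl measurableT _ (integrable_gauss_scale tau4)).
Qed.

Lemma gauss_weight_transform tau s : 0 < tau ->
  \int[mu]_v (gauss_weight tau v * cos (v * s)) = expR (- (s ^+ 2 / tau)).
Proof.
move=> tau0; pose c := Num.sqrt tau / 2.
have st0 : 0 < Num.sqrt tau by rewrite sqrtr_gt0.
have c0 : 0 < c by rewrite divr_gt0.
have sp0 : 0 < Num.sqrt (pi : R) by rewrite sqrtr_gt0 pi_gt0.
have c2 : c ^+ 2 = tau / 4 by rewrite expr_div_n sqr_sqrtr ?(ltW tau0) // -natrX.
pose f y := gauss_fun y * cos (s / c * y).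
have intf : mu.-integrable setT (EFin \o f).
  apply: (integrable_kernel _ (@normr_cos_le1 R) integrableT_gauss).
  by measurability.
transitivity (\int[mu]_v (Num.sqrt tau / (2 * Num.sqrt pi) * f (c * v))).
  apply: eq_Rintegral => v _; rewrite /gauss_weight -[LHS]mulrA /f /gauss_fun exprMn c2; congr (_ * (_ * cos _)).
  by field; rewrite gt_eqF.
rewrite RintegralZl //; last exact: (integrable_scale (lt0r_neq0 c0) intf).
rewrite (Rintegral_scale (lt0r_neq0 c0) intf) Rintegral_even // => [|y]; last first.
  by rewrite /f /gauss_fun sqrrN mulrN cosN.
under eq_Rintegral do rewrite mulrA.
rewrite -[Rintegral _ _ _]/(half_gauss cos (s / c)) half_gauss_cosE.
rewrite (gtr0_norm c0) expr_div_n c2 (_ : s ^+ 2 / (tau / 4) / 4 = s ^+ 2 / tau); last first.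
  by field; rewrite gt_eqF.
by rewrite /c; field; rewrite !gt_eqF.
Qed.

End fourier_transform.

Section gauss_product.
Variable R : realType.
Local Notation mu := (@lebesgue_measure R).
Implicit Types (tau s v : R) (m : nat).

Lemma intRd_prod_fine m (g : 'I_m -> R -> \bar R) (F : 'rV[R]_m -> R) :
  (forall i x, (0 <= g i x)%E) -> (forall i, mu.-integrable setT (g i)) ->
  measurable_fun setT F -> (forall x, 0 <= F x) ->
  intRd (fun x => (\prod_i g i (x ord0 i)) * (F x)%:E)%E =
  intRd (fun x => ((\prod_i fine (g i (x ord0 i))) * F x)%:E).
Proof.
elim: m g F => [|m IH] g F g0 intg mF F0; first by rewrite /= !big_ord0 mul1e mul1r.
have mg i : measurable_fun setT (g i) := measurable_int _ (intg i).
have mfine i : measurable_fun setT (fine \o g i) :=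
  integrable_measurable_fun (integrable_fine (intg i)).
have fine0 i x : 0 <= fine (g i x) by exact: fine_ge0.
pose rest x : \bar R := intRd (fun y : 'rV[R]_m =>
  ((\prod_i fine (g (lift ord0 i) (y ord0 i))) * F (row_mx x%:M y))%:E).
have m_rest : measurable_fun setT rest by rewrite /rest; measurability.
rewrite [RHS](_ : _ = \int[mu]_x ((fine (g ord0 x))%:E * rest x))%E; last first.
  apply: eq_integral => x _; rewrite -intRdZl; [|integral_side..].
  apply: eq_intRd => y; rewrite -EFinM big_ord_recl row_mx_ord0 mxE eqxx -mulrA.
  by congr (_ * (_ * _))%:E; apply: eq_bigr => i _; rewrite row_mx_lift0.
rewrite integral_mul_fine //; apply: eq_integral => x _.
rewrite /rest -(IH (fun i => g (lift ord0 i)) (fun y => F (row_mx x%:M y))) //; last first.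
  by measurability.
rewrite -intRdZl; [|integral_side..].
apply: eq_intRd => y; rewrite big_ord_recl row_mx_ord0 mxE eqxx -muleA.
by congr (_ * (_ * _))%E; apply: eq_bigr => i _; rewrite row_mx_lift0.
Qed.

Definition gauss_product tau m (g : 'I_m -> R -> R) v : R[i] :=
  (gauss_weight tau v)%:C%C * \prod_i fourier_transform (g i) v.

Lemma gauss_product_recl tau m (g : 'I_m.+1 -> R -> R) v : gauss_product tau g v =
  gauss_product tau (fun i => g (lift ord0 i)) v * fourier_transform (g ord0) v.
Proof. by rewrite /gauss_product big_ord_recl mulrCA mulrC. Qed.

Lemma complex_integrable_gauss_product tau m (g : 'I_m -> R -> R) : 0 < tau ->
  (forall i x, 0 <= g i x) -> (forall i, mu.-integrable setT (EFin \o g i)) ->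
  complex_integrable (gauss_product tau g).
Proof.
move=> tau0; elim: m g => [|m IH] g g0 intg.
  rewrite (_ : gauss_product tau g = fun v => Complex (gauss_weight tau v) 0); last first.
    by apply/funext => v; rewrite /gauss_product big_ord0 mulr1.
  by split; [exact: integrable_gauss_weight|exact: integrable0].
have := complex_integrable_mul_fourier (g0 ord0) (intg ord0)
  (IH _ (fun i => g0 (lift ord0 i)) (fun i => intg (lift ord0 i))).
by rewrite -(funext (gauss_product_recl tau g)).
Qed.

Lemma intRd_gauss_product tau s m (g : 'I_m -> R -> R) : 0 < tau ->
  (forall i x, 0 <= g i x) -> (forall i, mu.-integrable setT (EFin \o g i)) ->
  intRd (fun x : 'rV[R]_m => ((\prod_i g i (x ord0 i)) *
    expR (- ((s + \sum_i x ord0 i) ^+ 2 / tau)))%:E) =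
  (\int[mu]_v complex.Re (gauss_product tau g v * cis (v * s)))%:E.
Proof.
move=> tau0; elim: m s g => [|m IH] s g g0 intg.
  rewrite /= !big_ord0 mul1r addr0 -gauss_weight_transform //; congr EFin.
  apply: eq_Rintegral => v _.
  by rewrite /gauss_product big_ord0 mulr1 Re_real_mul.
have mg i : measurable_fun setT (g i) := integrable_measurable_fun (intg i).
pose h i := g (lift ord0 i).
have h0 i x : 0 <= h i x by exact: g0.
have inth i : mu.-integrable setT (EFin \o h i) by exact: intg.
have mh i : measurable_fun setT (h i) := mg (lift ord0 i).
transitivity (\int[mu]_x (g ord0 x *
    \int[mu]_v complex.Re (gauss_product tau h v * cis (v * (s + x))))%:E)%E; last first.
  rewrite (integral_translate_cis (g0 ord0) (intg ord0)); last first.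
    exact: complex_integrable_gauss_product.
  by congr EFin; apply: eq_Rintegral => v _; rewrite gauss_product_recl.
apply: eq_integral => x _; rewrite EFinM -IH // -intRdZl; [|integral_side..].
apply: eq_intRd => y; rewrite -EFinM !big_ord_recl row_mx_ord0 mxE eqxx addrA -[in LHS]mulrA.
by congr (_ * (_ * expR (- ((_ + _) ^+ 2 / _))))%:E; apply: eq_bigr => i _;
  rewrite row_mx_lift0.
Qed.

End gauss_product.

Section face_factors.
Variables (R : realType) (alpha : R).
Hypothesis alpha0 : 0 < alpha.
Local Notation mu := (@lebesgue_measure R).
Local Notation s := ((alpha - 1) / 2).
Local Open Scope ereal_scope.
Implicit Types (k : nat) (t x : R).

Definition gauss_mixture_ker t x : R := (gamma_ker s t * expR (- (x ^+ 2 / t)))%R.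

(* Infinite at [x = 0] when [alpha <= 1]. *)
Definition gauss_mixture x : \bar R := \int[mu]_t (gauss_mixture_ker t x)%:E.

Definition face_factor k (i : nat) x : \bar R :=
  ((k <= i.+1)%N ==> (0 <= x)%R)%:R%:E * gauss_mixture x.

Lemma gauss_mixture_ker_ge0 t x : (0 <= gauss_mixture_ker t x)%R.
Proof. by rewrite /gauss_mixture_ker; nonneg. Qed.

Lemma measurable_gauss_mixture_ker :
  measurable_fun setT (fun p : R * R => gauss_mixture_ker p.1 p.2).
Proof. by rewrite /gauss_mixture_ker; measurability. Qed.

Lemma gauss_mixture_ge0 x : 0 <= gauss_mixture x.
Proof. by apply: integral_ge0 => t _; rewrite lee_fin gauss_mixture_ker_ge0. Qed.

Lemma measurable_gauss_mixture : measurable_fun setT gauss_mixture.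
Proof. by rewrite /gauss_mixture /gauss_mixture_ker; measurability. Qed.

Lemma gauss_mixtureN x : gauss_mixture (- x) = gauss_mixture x.
Proof. by apply: eq_integral => t _; rewrite /gauss_mixture_ker sqrrN. Qed.

Lemma gamma_ker_sqrt t : (gamma_ker s t * Num.sqrt t = gamma_ker (alpha / 2) t)%R.
Proof.
have [t0|t0] := leP t 0%R; first by rewrite !gamma_ker_le0 // mul0r.
rewrite !gamma_kerE // mulrAC -powR12_sqrt ?(ltW t0) // -powRD_gt0 //.
by congr (_ `^ _ * _)%R; field.
Qed.

Lemma integral_gauss_mixture :
  \int[mu]_x gauss_mixture x = (Num.sqrt pi * Gamma (alpha / 2))%:E.
Proof.
rewrite [LHS](fubini_tonelli (m1 := mu) (m2 := mu)
  (fun p : R * R => (gauss_mixture_ker p.2 p.1)%:E)); last 2 first.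
- by rewrite /gauss_mixture_ker; measurability.
- by move=> p; rewrite lee_fin gauss_mixture_ker_ge0.
rewrite EFinM -integral_gamma_ker ?divr_gt0 // -ge0_integralZl; [|integral_side..].
apply: eq_integral => t _ /=; rewrite -gamma_ker_sqrt.
have [t0|t0] := leP t 0%R.
  rewrite gamma_ker_le0 // mul0r mule0; apply: integral0_eq => x _.
  by rewrite /gauss_mixture_ker gamma_ker_le0 // mul0r.
under eq_integral do rewrite /gauss_mixture_ker [(_ / t)%R]mulrC EFinM.
rewrite ge0_integralZl; [|integral_side..].
rewrite integral_gauss_scale ?invr_gt0 // invrK -!EFinM powR12_sqrt ?mulr_ge0 ?pi_ge0 ?(ltW t0) //.
by rewrite sqrtrM ?pi_ge0 //; congr EFin; ring.
Qed.

Lemma integrable_gauss_mixture : mu.-integrable setT gauss_mixture.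
Proof.
apply/integrableP; split; first exact: measurable_gauss_mixture.
by under eq_integral do rewrite gee0_abs ?gauss_mixture_ge0 //; rewrite integral_gauss_mixture ltry.
Qed.

Lemma face_factor_ge0 k i x : 0 <= face_factor k i x.
Proof. by rewrite mule_ge0 ?lee_fin ?gauss_mixture_ge0. Qed.

Lemma measurable_face_factor k i : measurable_fun setT (face_factor k i).
Proof.
by rewrite /face_factor; case: (k <= i.+1)%N; measurability; exact: measurable_gauss_mixture.
Qed.

Lemma integrable_face_factor k i : mu.-integrable setT (face_factor k i).
Proof.
apply: (le_integrable _ _ _ integrable_gauss_mixture) => //; first exact: measurable_face_factor.
move=> x _; rewrite !gee0_abs ?face_factor_ge0 ?gauss_mixture_ge0 // /face_factor.
by case: (_ ==> _); rewrite ?mul1e ?mul0e ?gauss_mixture_ge0.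
Qed.

End face_factors.

#[export] Hint Extern 0 (is_true (Order.le _ _)) => exact: gauss_mixture_ker_ge0 : nonneg.
#[export] Hint Extern 0 (is_true (Order.le _ _)) => exact: gauss_mixture_ge0 : nonneg.
#[export] Hint Extern 0 (is_true (Order.le _ _)) => exact: face_factor_ge0 : nonneg.
#[export] Hint Extern 0 (measurable_fun _ _) => exact: measurable_gauss_mixture : measurable_fun.
#[export] Hint Extern 0 (measurable_fun _ _) =>
  exact: measurable_gauss_mixture_ker : measurable_fun.

Section cone_integral_product.
Variables (R : realType) (d : nat) (alpha : R).
Hypothesis alpha0 : 0 < alpha.
Local Notation mu := (@lebesgue_measure R).
Local Notation s := ((alpha - 1) / 2).
Implicit Types (k : nat) (t : R) (l u : 'rV[R]_d).

Lemma face_cone_prod k l :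
  (face_cone k l)%:R = \prod_(i < d) ((k <= i.+1)%N ==> (0 <= l ord0 i))%:R :> R.
Proof.
rewrite /face_cone; case: (boolP [forall i : 'I_d, _]) => [/forallP lk|].
  by rewrite big1 // => i _; rewrite lk.
by rewrite negb_forall => /existsP[i li]; rewrite (bigD1 i) //= (negbTE li) mul0r.
Qed.

Lemma gamma_prod_balance_form k t u l :
  gamma_prod s (row_mx t%:M u : 'rV[R]_(1 + d)) *
    ((face_cone k l)%:R * expR (- balance_form (row_mx t%:M u) l)) =
  gamma_ker s t * expR (- ((\sum_i l ord0 i) ^+ 2 / t)) *
    \prod_(i < d) (((k <= i.+1)%N ==> (0 <= l ord0 i))%:R * gauss_mixture_ker alpha (u ord0 i) (l ord0 i)).
Proof.
have formE : balance_form (row_mx t%:M u) l =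
    (\sum_i l ord0 i) ^+ 2 / t + \sum_i l ord0 i ^+ 2 / u ord0 i.
  rewrite [LHS]big_ord_recl balance0 sqrrN row_mx_ord0 mxE eqxx; congr (_ + _).
  by apply: eq_bigr => i _; rewrite balanceS row_mx_lift0.
have prodE : gamma_prod s (row_mx t%:M u : 'rV[R]_(1 + d)) =
    gamma_ker s t * \prod_i gamma_ker s (u ord0 i).
  rewrite [LHS]big_ord_recl row_mx_ord0 mxE eqxx; congr (_ * _).
  by apply: eq_bigr => i _; rewrite row_mx_lift0.
rewrite formE prodE opprD expRD -sumrN expR_sum face_cone_prod !big_split /=.
by ring.
Qed.

Lemma cone_integral_face_factors k : cone_integral d alpha k =
  (\int[mu]_t ((gamma_ker s t)%:E * intRd (fun l : 'rV[R]_d =>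
    (\prod_(i < d) face_factor alpha k i (l ord0 i)) *
    (expR (- ((\sum_i l ord0 i) ^+ 2 / t)))%:E)))%E.
Proof.
apply: eq_integral => t _.
pose F u l : \bar R := (gamma_ker s t * expR (- ((\sum_i l ord0 i) ^+ 2 / t)) *
  \prod_(i < d) (((k <= i.+1)%N ==> (0 <= l ord0 i))%:R * gauss_mixture_ker alpha (u ord0 i) (l ord0 i)))%:E.
have mind (i : 'I_d) (e : measure_display) (T : measurableType e) (f : T -> R) :
    measurable_fun setT f -> measurable_fun setT (fun p => ((k <= i.+1)%N ==> (0 <= f p))%:R : R).
  by move=> mf; case: (k <= i.+1)%N; measurability.
have mF : measurable_fun setT (fun p => F p.1 p.2).
  by rewrite /F; measurability; apply: mind; measurability.
transitivity (intRd (fun u => intRd (F u))).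
  apply: eq_intRd => u; rewrite /gauss_cone_integral -intRdZl; [|integral_side..].
  by apply: eq_intRd => l; rewrite -EFinM gamma_prod_balance_form.
rewrite intRd_swap //; last by rewrite /F; nonneg.
have mprod : measurable_fun setT (fun l : 'rV[R]_d =>
    (\prod_(i < d) face_factor alpha k i (l ord0 i))%E).
  by measurability; apply: (measurableT_comp (measurable_face_factor alpha k _)); measurability.
rewrite -intRdZl; [|by measurability|by nonneg|by nonneg].
apply: eq_intRd => l; rewrite /F; under eq_intRd do rewrite EFinM.
rewrite intRdZl; [|by measurability|by nonneg|by nonneg].
under eq_intRd do rewrite -prodEFin.
rewrite (@intRd_prod _ _ (fun i t => (((k <= i.+1)%N ==> (0 <= l ord0 i))%:R *
  gauss_mixture_ker alpha t (l ord0 i))%:E));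
  [|by measurability|by nonneg].
rewrite EFinM -muleA [X in (_ * X)%E]muleC; congr (_ * (_ * _))%E.
apply: eq_bigr => i _; under eq_integral do rewrite EFinM.
by rewrite ge0_integralZl; [|integral_side..].
Qed.

End cone_integral_product.

Section cauchy_weight.
Variable R : realType.
Local Notation mu := (@lebesgue_measure R).
Implicit Types (p v y : R).

Definition cauchy_weight p v : R := (1 + v ^+ 2 / 4) `^ (- (p / 2)).

Lemma one_plus_sqr_gt0 y : 0 < 1 + y ^+ 2.
Proof. by rewrite ltr_pwDl // sqr_ge0. Qed.

Let base_ge1 v : 1 <= 1 + v ^+ 2 / 4.
Proof. by rewrite lerDl divr_ge0 ?sqr_ge0. Qed.

Let base_gt0 v : 0 < 1 + v ^+ 2 / 4 := lt_le_trans ltr01 (base_ge1 v).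

Lemma cauchy_weight_ge0 p v : 0 <= cauchy_weight p v.
Proof. exact: powR_ge0. Qed.

Lemma measurable_cauchy_weight p : measurable_fun setT (cauchy_weight p).
Proof. by rewrite /cauchy_weight; measurability. Qed.

Lemma cauchy_weightD p q v : cauchy_weight (p + q) v = cauchy_weight p v * cauchy_weight q v.
Proof. by rewrite -powRD_gt0 //; congr powR; field. Qed.

Lemma cauchy_weightX p v n : cauchy_weight p v ^+ n = cauchy_weight (p * n%:R) v.
Proof. by rewrite powR_exprn; congr powR; field. Qed.

Lemma le_cauchy_weight p q v : p <= q -> cauchy_weight q v <= cauchy_weight p v.
Proof. by move=> pq; rewrite ler_powR // lerN2 ler_pM2r ?invr_gt0. Qed.

Lemma cauchy_weight_double p y : cauchy_weight p (2 * y) = (1 + y ^+ 2) `^ (- (p / 2)).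
Proof. by congr powR; field. Qed.

Lemma integral_powR_cauchy b : 1 / 2 < b ->
  (\int[mu]_y ((1 + y ^+ 2) `^ (- b))%:E = ((ct b)^-1)%:E)%E.
Proof.
move=> b2; have /= cauchyE := @intRd_beta_prime R 1 b b2.
rewrite /ct /ctd invf_div -cauchyE; apply: eq_integral => y _.
by rewrite enorm_sqr big_ord1 row_mx_ord0 mxE eqxx.
Qed.

Lemma integrable_cauchy_weight p : 1 < p -> mu.-integrable setT (EFin \o cauchy_weight p).
Proof.
move=> p1; have p2 : 1 / 2 < p / 2 by rewrite ltr_pM2r ?invr_gt0.
have half0 : (2^-1 : R) != 0 by rewrite invr_eq0 pnatr_eq0.
have intc : mu.-integrable setT (fun y => ((1 + y ^+ 2) `^ (- (p / 2)))%:E).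
  apply/integrableP; split; first by measurability.
  under eq_integral do rewrite abse_EFin ger0_norm ?powR_ge0 //.
  by rewrite integral_powR_cauchy // ltry.
apply: (eq_integrable measurableT _ _ _ (integrable_scale half0 intc)) => v _ /=.
by rewrite -cauchy_weight_double mulVKf // pnatr_eq0.
Qed.

End cauchy_weight.

#[export] Hint Extern 0 (is_true (Order.le _ _)) => exact: cauchy_weight_ge0 : nonneg.
#[export] Hint Extern 0 (measurable_fun _ _) => exact: measurable_cauchy_weight : measurable_fun.

Section fourier_inversion.
Variables (R : realType) (d : nat) (alpha : R).
Hypothesis alpha0 : 0 < alpha.
Local Notation mu := (@lebesgue_measure R).
Local Notation s := ((alpha - 1) / 2).
Implicit Types (k : nat) (t v : R).

Definition cone_transform k v : R[i] :=
  \prod_(i < d) fourier_transform (fine \o face_factor alpha k i) v.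

Let fine_face_factor_ge0 k (i : nat) x : 0 <= (fine \o face_factor alpha k i) x.
Proof. exact/fine_ge0/face_factor_ge0. Qed.

Let integrable_fine_face_factor k (i : nat) :
  mu.-integrable setT (EFin \o (fine \o face_factor alpha k i)).
Proof. exact: integrable_fine (integrable_face_factor alpha0 k i). Qed.

Lemma integrable_gauss_weight_Re_cone_transform k t : 0 < t ->
  mu.-integrable setT (fun v => (gauss_weight t v * complex.Re (cone_transform k v))%:E).
Proof.
move=> t0; have [intR _] := complex_integrable_gauss_product t0
  (fun i : 'I_d => fine_face_factor_ge0 k i) (fun i => integrable_fine_face_factor k i).
by apply: (eq_integrable measurableT _ _ _ intR) => v _; rewrite Re_real_mul.
Qed.

Lemma measurable_Re_cone_transform k :
  measurable_fun setT (fun v => complex.Re (cone_transform k v)).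
Proof.
have mR := integrable_measurable_fun (integrable_gauss_weight_Re_cone_transform k (@ltr01 R)).
have mw := measurable_gauss_weight (1 : R).
rewrite (_ : (fun v => _) = (fun v => (gauss_weight 1 v)^-1 *
    (gauss_weight 1 v * complex.Re (cone_transform k v)))); first by measurability.
by apply/funext => v; rewrite mulKf // gt_eqF // gauss_weight_gt0.
Qed.

Lemma intRd_face_factors k t : 0 < t ->
  intRd (fun l : 'rV[R]_d => (\prod_(i < d) face_factor alpha k i (l ord0 i)) *
    (expR (- ((\sum_i l ord0 i) ^+ 2 / t)))%:E)%E =
  (\int[mu]_v (gauss_weight t v * complex.Re (cone_transform k v)))%:E.
Proof.
move=> t0; rewrite (intRd_prod_fine (g := fun i : 'I_d => face_factor alpha k i));
  [|by move=> i x; exact: face_factor_ge0|by move=> i; exact: integrable_face_factor|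
  by measurability|by nonneg].
have := intRd_gauss_product 0 t0 (fun i : 'I_d => fine_face_factor_ge0 k i)
  (fun i => integrable_fine_face_factor k i).
under eq_intRd do rewrite add0r; move=> ->; congr EFin.
apply: eq_Rintegral => v _.
by rewrite mulr0 /cis cos0 sin0 [Complex 1 0](_ : _ = 1) // mulr1 Re_real_mul.
Qed.

Lemma gamma_ker_gauss_weight t v : gamma_ker s t * gauss_weight t v =
  (2 * Num.sqrt pi)^-1 * (gamma_ker (alpha / 2) t * expR (- (v ^+ 2 / 4 * t))).
Proof.
rewrite -[gamma_ker (alpha / 2) t]gamma_ker_sqrt /gauss_weight [t / 4 * _](_ : _ = v ^+ 2 / 4 * t); last by ring.
by ring.
Qed.

Lemma cone_integral_fourier k :
  mu.-integrable setT (fun v => (cauchy_weight alpha v * complex.Re (cone_transform k v))%:E) ->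
  cone_integral d alpha k = (Gamma (alpha / 2) / (2 * Num.sqrt pi) *
    \int[mu]_v (cauchy_weight alpha v * complex.Re (cone_transform k v)))%:E.
Proof.
move=> intW; pose W v := complex.Re (cone_transform k v).
have mW : measurable_fun setT W := measurable_Re_cone_transform k.
have a20 : 0 < alpha / 2 by rewrite divr_gt0.
pose K : R := (2 * Num.sqrt pi)^-1; have K0 : 0 <= K by rewrite /K; nonneg.
pose f (p : R * R) : R :=
  K * W p.1 * (gamma_ker (alpha / 2) p.2 * expR (- (p.1 ^+ 2 / 4 * p.2))).
have mf : measurable_fun setT f by rewrite /f; measurability.
have v40 v : 0 <= v ^+ 2 / 4 by rewrite divr_ge0 ?sqr_ge0.
have ker0 v t : 0 <= gamma_ker (alpha / 2) t * expR (- (v ^+ 2 / 4 * t)) by nonneg.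
have normfE v : (\int[mu]_t `|f (v, t)|%:E =
    (K * Gamma (alpha / 2))%:E * `|cauchy_weight alpha v * W v|%:E)%E.
  under eq_integral do rewrite /f /= normrM (ger0_norm (ker0 _ _)) EFinM.
  rewrite ge0_integralZl; [|integral_side..].
  rewrite integral_gamma_ker_expR // !normrM (ger0_norm K0).
  by rewrite (ger0_norm (cauchy_weight_ge0 _ _)) /cauchy_weight -!EFinM; congr EFin; ring.
have fy : (\int[mu]_v \int[mu]_t `|f (v, t)|%:E < +oo)%E.
  under eq_integral do rewrite normfE.
  have Gamma0 : 0 <= K * Gamma (alpha / 2) by rewrite mulr_ge0 ?Gamma_ge0.
  rewrite ge0_integralZl; [|integral_side..].
  by apply: lte_mul_pinfty => //; case/integrableP: intW.
rewrite cone_integral_face_factors //.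
transitivity (\int[mu]_t (\int[mu]_v f (v, t))%:E)%E.
  apply: eq_integral => t _; have [t0|t0] := leP t 0.
    rewrite gamma_ker_le0 // mul0e; congr EFin; rewrite /Rintegral integral0_eq // => v _.
    by rewrite /f /= gamma_ker_le0 // mul0r mulr0.
  rewrite intRd_face_factors // -EFinM -RintegralZl //; last first.
    exact: integrable_gauss_weight_Re_cone_transform.
  congr EFin; apply: eq_Rintegral => v _; rewrite mulrA gamma_ker_gauss_weight /f /W /K /=.
  by ring.
rewrite (integral_Rintegral2 mf fy) -(Rintegral_fubini mf fy); congr EFin.
rewrite -RintegralZl //; apply: eq_Rintegral => v _.
rewrite /f /= ge0_RintegralZl; [|by measurability|by nonneg].
by rewrite /Rintegral integral_gamma_ker_expR //= /K -/(W v) /cauchy_weight; ring.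
Qed.
End fourier_inversion.

Section half_mixture.
Variables (R : realType) (alpha : R).
Hypothesis alpha0 : 0 < alpha.
Local Notation mu := (@lebesgue_measure R).
Local Notation s := ((alpha - 1) / 2).
Implicit Types (h : R -> R) (t u v x : R).

Definition half_mixture x : R := (0 <= x)%R%:R * fine (gauss_mixture alpha x).

Lemma scaled_half_gauss h v t : measurable_fun setT h -> (forall x, `|h x| <= 1) ->
  \int[mu]_x ((0 <= x)%R%:R * gauss_mixture_ker alpha t x * h (v * x)) =
  gamma_ker (alpha / 2) t * half_gauss h (v * Num.sqrt t).
Proof.
move=> mh h1; rewrite -gamma_ker_sqrt; have [t0|t0] := leP t 0.
  rewrite gamma_ker_le0 // !mul0r /Rintegral integral0_eq // => x _.
  by rewrite /gauss_mixture_ker gamma_ker_le0 // mul0r mulr0 mul0r.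
have c0 : 0 < Num.sqrt t by rewrite sqrtr_gt0.
have cV0 : (Num.sqrt t)^-1 != 0 by rewrite invr_eq0 gt_eqF.
have intF := integrable_kernel mh h1 (@integrable_half_gauss_fun R) (v * Num.sqrt t).
have := Rintegral_scale cV0 intF; rewrite gtr0_norm ?invr_gt0 // invrK => scaleE.
rewrite -mulrA -scaleE -RintegralZl //; last exact: (integrable_scale cV0 intF).
apply: eq_Rintegral => x _.
rewrite /gauss_mixture_ker /half_gauss_fun /gauss_fun pmulr_rge0 ?invr_gt0 //.
rewrite exprMn exprVn sqr_sqrtr ?(ltW t0) // [x ^+ 2 / t]mulrC.
have -> : v * Num.sqrt t * ((Num.sqrt t)^-1 * x) = v * x by field; rewrite gt_eqF.
by ring.
Qed.

Lemma kernel_transform_half_mixture h v : measurable_fun setT h -> (forall x, `|h x| <= 1) ->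
  kernel_transform h half_mixture v =
  \int[mu]_t (gamma_ker (alpha / 2) t * half_gauss h (v * Num.sqrt t)).
Proof.
move=> mh h1.
pose f (p : R * R) : R := h (v * p.1) * (0 <= p.1)%R%:R * gauss_mixture_ker alpha p.2 p.1.
have mf : measurable_fun setT f by rewrite /f; measurability.
have fy : (\int[mu]_x \int[mu]_t `|f (x, t)|%:E < +oo)%E.
  apply: (@le_lt_trans _ _ (\int[mu]_x gauss_mixture alpha x)%E); last first.
    by rewrite integral_gauss_mixture ?ltry.
  apply: ge0_le_integral => //; [by move=> x _; nonneg|by measurability|by measurability|].
  move=> x _; apply: ge0_le_integral => //; [by measurability|by measurability|].
  move=> t _; rewrite lee_fin /f normrM (ger0_norm (gauss_mixture_ker_ge0 _ _ _)).
  rewrite ler_piMl ?gauss_mixture_ker_ge0 // normrM mulr_ile1 //.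
  by rewrite normr_nat lern1 leq_b1.
transitivity (\int[mu]_x \int[mu]_t f (x, t)).
  apply: eq_Rintegral => x _; rewrite /f /= ge0_RintegralZl; [|by measurability|by nonneg].
  by rewrite mulrC mulrA.
rewrite Rintegral_fubini //; apply: eq_Rintegral => t _; rewrite -scaled_half_gauss //.
by apply: eq_Rintegral => x _; rewrite /f /=; ring.
Qed.

Lemma cosine_transform_half_mixture v : kernel_transform cos half_mixture v =
  Num.sqrt pi / 2 * Gamma (alpha / 2) * cauchy_weight alpha v.
Proof.
rewrite kernel_transform_half_mixture; [|by measurability|exact: normr_cos_le1].
transitivity (\int[mu]_t (Num.sqrt pi / 2 *
    (gamma_ker (alpha / 2) t * expR (- (v ^+ 2 / 4 * t))))).
  apply: eq_Rintegral => t _; rewrite half_gauss_cosE.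
  have [t0|t0] := leP t 0; first by rewrite gamma_ker_le0 // !mul0r mulr0.
  by rewrite exprMn sqr_sqrtr ?(ltW t0) // [v ^+ 2 * t / 4]mulrAC; ring.
rewrite ge0_RintegralZl; [|by measurability|by nonneg].
by rewrite /Rintegral integral_gamma_ker_expR ?divr_gt0 ?divr_ge0 ?sqr_ge0 //= mulrA.
Qed.

Definition dawson v : R := \int[mu]_u ((u \in `[0, 1]%R)%:R *
  (1 + v ^+ 2 / 4 * (1 - u ^+ 2)) `^ (- ((alpha + 1) / 2))).

Lemma gamma_half_gauss_sin v t : gamma_ker (alpha / 2) t * half_gauss sin (v * Num.sqrt t) =
  v / 2 * \int[mu]_u ((u \in `[0, 1]%R)%:R *
    (gamma_ker ((alpha + 1) / 2) t * expR (- (v ^+ 2 / 4 * (1 - u ^+ 2) * t)))).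
Proof.
have [t0|t0] := leP t 0.
  rewrite !gamma_ker_le0 // mul0r /Rintegral integral0_eq ?mulr0 // => u _.
  by rewrite mul0r mulr0.
have shape u : (u \in `[0, 1]%R)%:R * (gamma_ker ((alpha + 1) / 2) t *
    expR (- (v ^+ 2 / 4 * (1 - u ^+ 2) * t))) = gamma_ker ((alpha + 1) / 2) t *
    ((u \in `[0, 1]%R)%:R * expR (- ((v * Num.sqrt t) ^+ 2 / 4 * (1 - u ^+ 2)))).
  rewrite mulrCA; congr (_ * (_ * expR (- _))).
  by rewrite exprMn sqr_sqrtr ?(ltW t0) //; ring.
under [in RHS]eq_Rintegral do rewrite shape.
rewrite ge0_RintegralZl; [|by measurability|by nonneg].
rewrite half_gauss_sinE -(gamma_ker_sqrt (alpha + 1)) addrK.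
by ring.
Qed.

Lemma integrable_gamma_ker p : 0 < p -> mu.-integrable setT (fun t => (gamma_ker p t)%:E).
Proof.
move=> p0; apply/integrableP; split; first by measurability.
under eq_integral do rewrite abse_EFin ger0_norm ?gamma_ker_ge0 //.
by rewrite integral_gamma_ker // ltry.
Qed.

Lemma integrable_in_itv01 : mu.-integrable setT (fun u => ((u \in `[0, 1]%R)%:R)%:E).
Proof.
apply/integrableP; split; first by measurability.
under eq_integral do rewrite abse_EFin normr_nat -[_%:R]mulr1.
rewrite -integral_itv_indicator integral_cst // mul1e.
by rewrite [ltLHS](lebesgue_measure_itv `[0, 1]%R) /= lte_fin ltr01 -EFinB ltry.
Qed.

Lemma sine_transform_half_mixture v : kernel_transform sin half_mixture v =
  v / 2 * Gamma ((alpha + 1) / 2) * dawson v.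
Proof.
have a20 : 0 < (alpha + 1) / 2 by rewrite divr_gt0 // addr_gt0.
pose f (p : R * R) : R := (p.2 \in `[0, 1]%R)%:R * (gamma_ker ((alpha + 1) / 2) p.1 *
  expR (- (v ^+ 2 / 4 * (1 - p.2 ^+ 2) * p.1))).
have mf : measurable_fun setT f by rewrite /f; measurability.
have exponent_ge0 u : u \in `[0, 1]%R -> 0 <= v ^+ 2 / 4 * (1 - u ^+ 2).
  by rewrite in_itv /= => /andP[u0 u1]; rewrite mulr_ge0 ?divr_ge0 ?sqr_ge0 // subr_ge0 expr_le1.
have fy : (\int[mu]_t \int[mu]_u `|f (t, u)|%:E < +oo)%E.
  apply: (integral2_tensor_lty mf (integrable_gamma_ker a20) integrable_in_itv01) => [t|//|t u]; first exact: gamma_ker_ge0.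
  rewrite ger0_norm; last by rewrite /f; nonneg.
  rewrite /f /= mulrC; case: (boolP (u \in _)) => u01; last by rewrite !mulr0.
  rewrite !mulr1; have [t0|t0] := leP t 0; first by rewrite gamma_ker_le0 // mul0r.
  by rewrite ler_piMr ?gamma_ker_ge0 // -[leRHS]expR0 ler_expR oppr_le0 mulr_ge0 ?exponent_ge0 // ltW.
rewrite kernel_transform_half_mixture; [|by measurability|exact: normr_sin_le1].
under eq_Rintegral do rewrite gamma_half_gauss_sin.
rewrite ge0_RintegralZl; [| |by move=> t; apply: Rintegral_ge0 => u _; nonneg].
  rewrite -[RHS]mulrA (Rintegral_fubini mf fy); congr (_ * _).
  rewrite /dawson -ge0_RintegralZl; [|by measurability|by nonneg].
  apply: eq_Rintegral => u _; rewrite /f /=.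
  rewrite ge0_RintegralZl; [|by measurability|by nonneg].
  case: (boolP (u \in _)) => u01; last by rewrite !mul0r mulr0.
  by rewrite !mul1r /Rintegral integral_gamma_ker_expR ?exponent_ge0.
by rewrite /Rintegral; measurability.
Qed.
End half_mixture.

Section oriented_integral.
Variable R : realType.
Local Notation mu := (@lebesgue_measure R).

Lemma is_derive_oint (f : R -> R) (a b c x : R) : a < c < b ->
  (forall y, a < y < b -> {for y, continuous f}) -> a < x < b ->
  is_derive x 1 (fun y => oint c y f) (f x).
Proof.
move=> /andP[ac cb] cf /andP[ax xb].
pose p := (a + Num.min x c) / 2; pose q := (b + Num.max x c) / 2.
have am : a < Num.min x c by rewrite lt_min ax.
have Mb : Num.max x c < b by rewrite gt_max xb.
have ap : a < p by rewrite midf_lt.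
have qb : q < b by rewrite /q addrC midf_lt.
have /andP[px pc] : (p < x) && (p < c) by rewrite -lt_min midf_lt.
have /andP[xq cq] : (x < q) && (c < q) by rewrite -gt_max /q addrC midf_lt.
have intf : mu.-integrable `[p, q] (EFin \o f).
  apply: continuous_compact_integrable; first exact: segment_compact.
  apply: continuous_in_subspaceT => y; rewrite inE /= in_itv /= => /andP[py yq].
  by apply: cf; rewrite (lt_le_trans ap py) (le_lt_trans yq qb).
pose P y := \int[mu]_(t in `[p, y]) f t.
have sub y z : p <= y -> z <= q -> mu.-integrable `[y, z] (EFin \o f).
  move=> py zq; apply: integrableS intf; [exact: measurable_itv|exact: measurable_itv|].
  by apply: subset_itv; rewrite bnd_simp.
have PE y z : p <= y -> y <= z -> z <= q -> P z - P y = \int[mu]_(t in `[y, z]) f t.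
  move=> py yz zq; rewrite /P Rintegral_itvB ?bnd_simp //; last exact: sub.
  rewrite Rintegral_itv_obnd_cbnd //; apply: integrableS (sub y z py zq);
    [exact: measurable_itv|exact: measurable_itv|].
  by apply: subset_itv; rewrite bnd_simp.
have [dP dPE] := continuous_FTC1_closed xq intf px (cf x ltac:(by rewrite ax xb)).
have iP : is_derive x 1 P (f x) by apply: DeriveDef; [exact: dP|rewrite -derive1E; exact: dPE].
have iPB : is_derive x 1 (fun y => P y - P c) (f x).
  by apply: (is_derive_eq (is_deriveB iP (is_derive_cst (P c) x (1 : R)))); rewrite subr0.
apply: (near_eq_is_derive (f := fun y => P y - P c)) iPB.
have : \forall y \near x, p < y < q by apply: near_in_itvoo; rewrite in_itv /= px.
apply: filterS => y /andP[py yq]; rewrite /oint.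
case: leP => yc; first by rewrite PE // ltW.
by rewrite -PE ?opprB ?(ltW py) ?(ltW yc) ?(ltW cq).
Qed.

End oriented_integral.

Section secant_integral.
Variables (R : realType) (alpha : R).
Local Notation mu := (@lebesgue_measure R).
Local Notation c := (ct ((alpha + 1) / 2)).
Implicit Types u w x : R.

Definition secant_integral x : R := oint 0 x (fun y => c * cos y `^ (- alpha)).

Lemma continuous_cos_powR p x : - (pi / 2) < x < pi / 2 ->
  {for x, continuous (fun y : R => cos y `^ p)}.
Proof.
move=> xp; apply: (@continuous_comp _ _ _ (@cos R) (fun y : R => y `^ p)).
  exact: continuous_cos.
by apply: continuous_powR_gt0; exact: cos_gt0_pihalf.
Qed.

Lemma secant_integral0 : secant_integral 0 = 0.
Proof. by rewrite /secant_integral /oint lexx set_itv1 Rintegral_set1. Qed.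

Lemma is_derive_secant_integral x : - (pi / 2) < x < pi / 2 ->
  is_derive x 1 secant_integral (c * cos x `^ (- alpha)).
Proof.
move=> xp; apply: (@is_derive_oint R (fun y => c * cos y `^ (- alpha)) (- (pi / 2)) (pi / 2)) => //.
  by rewrite oppr_lt0 divr_gt0 ?pi_gt0.
by move=> y yp; apply: cvgM; [exact: cvg_cst|exact: continuous_cos_powR].
Qed.

Lemma is_derive_secant_integral_asin w : -1 < w < 1 ->
  is_derive w 1 (fun w => secant_integral (asin w)) (c * (1 - w ^+ 2) `^ (- ((alpha + 1) / 2))).
Proof.
move=> /[dup] w1 /andP[Nw w_lt1].
have p0 : 0 < 1 - w ^+ 2 by nra.
have asin_itv : - (pi / 2) < asin w < pi / 2.
  by rewrite asin_gtNpi2 ?Nw ?ltW // asin_ltpi2 // w_lt1 ltW.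
apply: (is_derive_eq (is_derive1_comp (is_derive_secant_integral asin_itv) (is_derive1_asin w1))).
rewrite cos_asin; last by rewrite !ltW.
rewrite -mulrA; congr (_ * _).
rewrite -powR12_sqrt ?(ltW p0) // -powRN -powRrM -powRD_gt0 //.
by congr (_ `^ _); field.
Qed.

Definition binomial_integral x : R :=
  \int[mu]_u ((u \in `[0, 1]%R)%:R * (1 - (u * sin x) ^+ 2) `^ (- ((alpha + 1) / 2))).

Lemma sqr_mul_sin_lt1 u x : 0 <= u <= 1 -> - (pi / 2) < x < pi / 2 -> (u * sin x) ^+ 2 < 1.
Proof.
move=> /andP[u0 u1] /cos_gt0_pihalf c0; rewrite exprMn.
apply: (@le_lt_trans _ _ (sin x ^+ 2)); first by rewrite ler_piMl ?sqr_ge0 // exprn_ile1.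
by rewrite -[ltRHS](cos2Dsin2 x) ltrDr exprn_gt0.
Qed.

(* The substitution [sin y = u sin x]. *)
Lemma secant_integralE x : - (pi / 2) < x < pi / 2 ->
  secant_integral x = c * sin x * binomial_integral x.
Proof.
move=> xp; have sqr_lt1 u (u01 : 0 <= u <= 1) := sqr_mul_sin_lt1 u01 xp.
pose F u := secant_integral (asin (sin x * u)).
pose f u := c * sin x * (1 - (u * sin x) ^+ 2) `^ (- ((alpha + 1) / 2)).
have dF u : 0 <= u <= 1 -> is_derive u 1 F (f u).
  move=> /sqr_lt1 u1; have w1 : -1 < sin x * u < 1.
    by move: u1; rewrite mulrC; move: (sin x * u) => w w1; apply/andP; split; nra.
  apply: (is_derive_eq (is_derive1_comp (is_derive_secant_integral_asin w1) (is_derive_mull _ u))).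
  by rewrite /f [u * _]mulrC mulrAC.
have cf u : 0 <= u <= 1 -> {for u, continuous f}.
  move=> u01; apply: cvgM; first exact: cvg_cst.
  apply: (@continuous_comp _ _ _ (fun u : R => 1 - (u * sin x) ^+ 2) (fun y : R => y `^ _)).
    apply: cvgB; first exact: cvg_cst.
    by apply: cvgM; (apply: cvgM; [exact: cvg_id|exact: cvg_cst]).
  by apply: continuous_powR_gt0; rewrite subr_gt0 sqr_lt1.
have := integral_is_derive ler01 dF cf; rewrite integral_itv_indicator => /(congr1 fine) /=.
have asin0 : asin 0 = 0 :> R.
  by rewrite -[in LHS](@sin0 R) sinK // in_itv /= oppr_le0 divr_ge0 ?pi_ge0.
rewrite /F mulr1 mulr0 asin0 secant_integral0 subr0 sinK; last first.
  by rewrite in_itv /=; case/andP: xp => a b; rewrite !ltW.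
move=> <-.
rewrite -ge0_RintegralZl; [|by measurability|by nonneg].
by apply: eq_Rintegral => u _; rewrite /f mulrCA.
Qed.

Lemma oneDtan2 x : - (pi / 2) < x < pi / 2 -> 1 + tan x ^+ 2 = cos x `^ (-2).
Proof.
by move=> /cos_gt0_pihalf c0; rewrite -cos2_tan2 ?gt_eqF // powRN powR_mulrn ?ltW.
Qed.

Lemma cauchy_weight_tan p x : - (pi / 2) < x < pi / 2 ->
  cauchy_weight p (2 * tan x) = cos x `^ p.
Proof.
by move=> xp; rewrite cauchy_weight_double oneDtan2 // -powRrM; congr (_ `^ _); field.
Qed.

Lemma dawson_tan x : - (pi / 2) < x < pi / 2 ->
  dawson alpha (2 * tan x) = cos x `^ (alpha + 1) * binomial_integral x.
Proof.
move=> xp; have c0 := cos_gt0_pihalf xp.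
rewrite /binomial_integral -ge0_RintegralZl; [|by measurability|by nonneg].
apply: eq_Rintegral => u _; rewrite [RHS]mulrCA.
case: (boolP (u \in `[0, 1]%R)) => [|_]; last by rewrite !mul0r.
rewrite in_itv /= => u01; rewrite !mul1r.
have -> : 1 + (2 * tan x) ^+ 2 / 4 * (1 - u ^+ 2) = cos x `^ (-2) * (1 - (u * sin x) ^+ 2).
  rewrite -oneDtan2 // /tan !exprMn; have := cos2Dsin2 x => /(canRL (addKr _)) ->.
  by field; rewrite gt_eqF.
rewrite powRM ?powR_ge0 // ?subr_ge0 ?(ltW (sqr_mul_sin_lt1 u01 xp)) // -powRrM.
by congr (_ `^ _ * _); field.
Qed.

Lemma tan_dawson x : - (pi / 2) < x < pi / 2 ->
  c * (tan x * dawson alpha (2 * tan x)) = cos x `^ alpha * secant_integral x.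
Proof.
move=> xp; have c0 := cos_gt0_pihalf xp.
rewrite dawson_tan // secant_integralE // powRD_gt0 // powRr1 ?ltW // /tan.
by field; rewrite gt_eqF.
Qed.

Lemma secant_integralN x : - (pi / 2) < x < pi / 2 -> secant_integral (- x) = - secant_integral x.
Proof.
move=> xp; have Nxp : - (pi / 2) < - x < pi / 2 by case/andP: xp => a b; rewrite ltrN2 b ltrNl a.
rewrite !secant_integralE // /binomial_integral sinN mulrN mulNr.
by congr (- (_ * _)); apply: eq_Rintegral => u _; rewrite mulrN sqrrN.
Qed.

Hypothesis alpha0 : 0 < alpha.

Lemma ct_Gamma : Num.sqrt pi * Gamma (alpha / 2) * c = Gamma ((alpha + 1) / 2).
Proof.
have G0 : 0 < Gamma (alpha / 2) by rewrite Gamma_gt0 // divr_gt0.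
have sp0 : 0 < Num.sqrt (pi : R) by rewrite sqrtr_gt0 pi_gt0.
rewrite /ct /ctd (_ : (alpha + 1) / 2 - 1%:R / 2 = alpha / 2); last by field.
by rewrite mul1r powR12_sqrt ?pi_ge0 //; field; rewrite !gt_eqF.
Qed.

Lemma fourier_transform_half_mixture_tan x : - (pi / 2) < x < pi / 2 ->
  fourier_transform (half_mixture alpha) (2 * tan x) =
  (Num.sqrt pi * Gamma (alpha / 2) * cos x `^ alpha)%:C%C * Complex 2^-1 (secant_integral x).
Proof.
move=> xp; have tanE := tan_dawson xp.
rewrite /fourier_transform cosine_transform_half_mixture // sine_transform_half_mixture //.
rewrite cauchy_weight_tan // -ct_Gamma.
apply/eqP; rewrite eq_complex /=; apply/andP; split; apply/eqP; first by rewrite mul0r subr0; field.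
rewrite mul0r addr0 -[RHS]mulrA -tanE.
by field.
Qed.

End secant_integral.

Section cone_transform_factors.
Variables (R : realType) (d : nat) (alpha : R).
Hypothesis alpha0 : 0 < alpha.
Local Notation mu := (@lebesgue_measure R).
Implicit Types (k : nat) (v : R).

Lemma fourier_transform_even (g : R -> R) v : mu.-integrable setT (EFin \o g) ->
  (forall x, g (- x) = g x) ->
  fourier_transform g v = (2 * kernel_transform cos (fun x => (0 <= x)%R%:R * g x) v)%:C%C.
Proof.
move=> intg gN; have mg := integrable_measurable_fun intg.
have mcos : measurable_fun setT (@cos R) by measurability.
rewrite /fourier_transform /real_complex_def; congr Complex.
- rewrite /kernel_transform Rintegral_even; last by move=> x; rewrite gN mulrN cosN.
    by congr (_ * _); apply: eq_Rintegral => x _; rewrite mulrA.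
  exact: integrable_kernel mcos (@normr_cos_le1 R) intg v.
- rewrite /kernel_transform Rintegral_odd //; first by measurability.
  by move=> x; rewrite gN mulrN sinN mulrN.
Qed.

Lemma fine_face_factor k i : fine \o face_factor alpha k i =
  if (k <= i.+1)%N then half_mixture alpha else fine \o gauss_mixture alpha.
Proof.
apply/funext => x; rewrite /= /face_factor /half_mixture.
case: (k <= i.+1)%N => /=; last by rewrite mul1e.
by case: (0 <= x); rewrite ?mul1e ?mul0e ?mul1r ?mul0r.
Qed.

Lemma prod_threshold (S : comPzRingType) (a b : S) n k : (0 < k <= n.+1)%N ->
  \prod_(i < n) (if (k <= i.+1)%N then b else a) = a ^+ k.-1 * b ^+ (n.+1 - k).
Proof.
elim: n => [|n IH] in k *.
  by case: k => [|[|k]] //; rewrite big_ord0 mulr1.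
case/andP=> k0; rewrite leq_eqVlt => /orP[/eqP ->|kn].
  rewrite subnn mulr1 (eq_bigr (fun=> a)) => [|i _]; last by rewrite leqNgt ltnS ltn_ord.
  by rewrite prodr_const card_ord.
by rewrite big_ord_recr /= IH ?k0 // -ltnS kn [in RHS]subSn // exprSr mulrA.
Qed.

Lemma cone_transformE k v : (0 < k <= d.+1)%N -> cone_transform d alpha k v =
  (2 * kernel_transform cos (half_mixture alpha) v)%:C%C ^+ k.-1 *
  fourier_transform (half_mixture alpha) v ^+ (d.+1 - k).
Proof.
move=> kd; rewrite -prod_threshold //; apply: eq_bigr => i _.
rewrite fine_face_factor; case: ifP => // _; apply: fourier_transform_even => [|x].
  exact: integrable_fine (integrable_gauss_mixture alpha0).
by rewrite /= gauss_mixtureN.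
Qed.

End cone_transform_factors.

Section transform_bounds.
Variables (R : realType) (d : nat) (alpha : R).
Hypothesis alpha0 : 0 < alpha.
Local Notation mu := (@lebesgue_measure R).
Implicit Types (k : nat) (theta u v : R).

Lemma dawson_integrand_le theta u v : 0 < theta -> theta <= alpha -> 0 <= u < 1 ->
  (1 + v ^+ 2 / 4 * (1 - u ^+ 2)) `^ (- ((alpha + 1) / 2)) <=
  cauchy_weight (1 + theta) v * (1 - u) `^ (- ((1 + theta) / 2)).
Proof.
move=> t0 ta /andP[u0 u1]; have Nu0 : 0 < 1 - u by rewrite subr_gt0.
have v0 : 0 <= v ^+ 2 / 4 by rewrite divr_ge0 ?sqr_ge0.
have w0 : 0 < 1 + v ^+ 2 / 4 by rewrite ltr_pwDl.
have base_ge1 : 1 <= 1 + v ^+ 2 / 4 * (1 - u ^+ 2).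
  by rewrite lerDl mulr_ge0 // subr_ge0 expr_le1 // ltW.
have base_ge : (1 + v ^+ 2 / 4) * (1 - u) <= 1 + v ^+ 2 / 4 * (1 - u ^+ 2).
  rewrite -subr_ge0 (_ : _ - _ = u + v ^+ 2 / 4 * (u * (1 - u))); last by ring.
  by rewrite addr_ge0 // mulr_ge0 // mulr_ge0 // ltW.
rewrite /cauchy_weight -powRM ?(ltW w0) ?(ltW Nu0) //.
apply: (@le_trans _ _ ((1 + v ^+ 2 / 4 * (1 - u ^+ 2)) `^ (- ((1 + theta) / 2)))).
  by rewrite ler_powR // lerN2 ler_pM2r ?invr_gt0 // addrC lerD2r.
rewrite !powRN lef_pV2 ?posrE ?powR_gt0 ?mulr_gt0 //; last exact: lt_le_trans base_ge1.
rewrite ge0_ler_powR ?nnegrE //; first by rewrite divr_ge0 // addr_ge0 // ltW.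
- by rewrite mulr_ge0 // ltW.
- by rewrite (le_trans _ base_ge1).
Qed.

Lemma dawson_ge0 v : 0 <= dawson alpha v.
Proof. by apply: Rintegral_ge0 => u _; nonneg. Qed.

Lemma dawson_le theta v : 0 < theta -> theta <= alpha -> theta < 1 ->
  dawson alpha v <= cauchy_weight (1 + theta) v * ((1 - theta) / 2)^-1.
Proof.
move=> t0 ta t1; pose s := (1 - theta) / 2; have s0 : 0 < s by rewrite divr_gt0 // subr_gt0.
pose g (t : R) : \bar R := ((t \in `]0, 1]%R)%:R * t `^ (s - 1))%:E.
pose f u := (1 + v ^+ 2 / 4 * (1 - u ^+ 2)) `^ (- ((alpha + 1) / 2)).
have mf : measurable_fun setT f by rewrite /f; measurability.
have mg : measurable_fun setT g by rewrite /g; measurability.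
have g0 t : (0 <= g t)%E by rewrite /g; nonneg.
have reflected : (\int[mu]_u g (-1 * u + 1)%R <= (s^-1)%:E)%E.
  have N1 : (-1 : R) != 0 by rewrite oppr_eq0 oner_eq0.
  have := ge0_integral_affine 1 N1 mg g0; rewrite normrN1 mul1e => ->.
  exact: integral_powR01_le.
have dawson_leE : (\int[mu]_(u in `[0%R, 1%R]) (f u)%:E <=
    (cauchy_weight (1 + theta) v * s^-1)%:E)%E.
  rewrite -integral_itv_bndo_bndc; last by apply/measurable_funTS/measurable_EFinP.
  rewrite integral_itv_indicator EFinM.
  apply: le_trans (lee_wpmul2l _ reflected); last by rewrite lee_fin cauchy_weight_ge0.
  rewrite -ge0_integralZl; [|integral_side..].
  apply: ge0_le_integral => //; [by move=> u _; rewrite /f; nonneg|by measurability| |].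
    by measurability.
  move=> u _; rewrite /g -EFinM lee_fin (_ : -1 * u + 1 = 1 - u); last by ring.
  rewrite !in_itv /= subr_gt0 lerBlDr lerDl andbC.
  case: andP => [[u1 u0]|_]; last by rewrite !mul0r mulr0.
  rewrite !mul1r (_ : s - 1 = - ((1 + theta) / 2)); last by rewrite /s; field.
  by apply: dawson_integrand_le; rewrite // u0.
rewrite /dawson /Rintegral -integral_itv_indicator -lee_fin fineK //.
rewrite ge0_fin_numE; first exact: le_lt_trans dawson_leE (ltry _).
by apply: integral_ge0 => u _; rewrite lee_fin powR_ge0.
Qed.

Lemma l1norm_fourier_half_mixture_le theta : 0 < theta -> theta <= alpha -> theta < 1 ->
  exists2 K : R, 0 <= K & forall v,
    l1norm (fourier_transform (half_mixture alpha) v) <= K * cauchy_weight theta v.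
Proof.
move=> t0 ta t1.
have Gamma1_ge0 := Gamma_ge0 ((alpha + 1) / 2); have Gamma2_ge0 := Gamma_ge0 (alpha / 2).
have theta1 : 0 <= ((1 - theta) / 2)^-1 by rewrite invr_ge0 divr_ge0 // subr_ge0 ltW.
exists (Num.sqrt pi / 2 * Gamma (alpha / 2) + Gamma ((alpha + 1) / 2) * ((1 - theta) / 2)^-1).
  by nonneg.
move=> v; rewrite /l1norm /= mulrDl; apply: lerD.
  rewrite cosine_transform_half_mixture // ger0_norm; last by nonneg.
  by rewrite ler_wpM2l ?le_cauchy_weight //; nonneg.
rewrite sine_transform_half_mixture // !normrM (ger0_norm Gamma1_ge0) (ger0_norm (dawson_ge0 v)).
have half_v : `|v| * `|2^-1| <= cauchy_weight (-1) v.
  rewrite /cauchy_weight mulN1r opprK powR12_sqrt; last by rewrite addr_ge0 ?divr_ge0 ?sqr_ge0.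
  rewrite -normrM -sqrtr_sqr ler_wsqrtr //.
  by rewrite exprMn (_ : _ ^+ 2 / 4 = v ^+ 2 * 2^-1 ^+ 2) ?lerDr //; field.
have -> : cauchy_weight theta v = cauchy_weight (-1) v * cauchy_weight (1 + theta) v.
  by rewrite -cauchy_weightD addKr.
rewrite [leRHS](_ : _ = cauchy_weight (-1) v * Gamma ((alpha + 1) / 2) *
    (cauchy_weight (1 + theta) v * ((1 - theta) / 2)^-1)); last by ring.
by apply: ler_pM; [nonneg|exact: dawson_ge0|exact: ler_wpM2r|exact: dawson_le].
Qed.

Lemma exists_decay_exponent n k : (0 < k <= n)%N -> 1 < alpha * n%:R ->
  exists theta : R, [/\ 0 < theta, theta <= alpha, theta < 1 &
    1 < alpha * k%:R + theta * (n - k)%:R].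
Proof.
move=> /andP[k0 kn] an1; have [a1|a1] := ltP alpha 1.
  by exists alpha; split => //; rewrite -mulrDr -natrD subnKC.
exists 2^-1; split; rewrite ?invf_lt1 ?ltr1n ?invr_gt0 //.
  by rewrite (le_trans _ a1) // invf_le1 ?ler1n.
move: kn; rewrite leq_eqVlt => /orP[/eqP ->|kn]; first by rewrite subnn mulr0 addr0.
have k1 : 1 <= k%:R :> R by rewrite ler1n.
have : 0 < 2^-1 * (n - k)%:R :> R by rewrite mulr_gt0 // ltr0n subn_gt0.
have : 1 <= alpha * k%:R by rewrite mulr_ege1.
by lra.
Qed.

Lemma integrable_cone_transform k : (0 < k <= d.+1)%N -> 1 < alpha * d.+1%:R ->
  mu.-integrable setT
    (fun v => (cauchy_weight alpha v * complex.Re (cone_transform d alpha k v))%:E).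
Proof.
move=> kd an1; have [theta [t0 ta t1 p1]] := exists_decay_exponent kd an1.
have [K K0 transform_le] := l1norm_fourier_half_mixture_le t0 ta t1.
pose C : R := 2 * (Num.sqrt pi / 2 * Gamma (alpha / 2)).
have C0 : 0 <= C by rewrite mulr_ge0 // mulr_ge0 ?Gamma_ge0 // divr_ge0 ?sqrtr_ge0.
pose p := alpha * k%:R + theta * (d.+1 - k)%:R; pose M := C ^+ k.-1 * K ^+ (d.+1 - k).
have int_bound := integrableZl measurableT M (integrable_cauchy_weight p1).
apply: (le_integrable _ _ _ int_bound) => // [|v _].
  have mW := measurable_Re_cone_transform d alpha0 k.
  by apply/measurable_EFinP; measurability.
rewrite /= lee_fin normrM (ger0_norm (cauchy_weight_ge0 _ _)).
rewrite [leRHS]ger0_norm; last by rewrite mulr_ge0 ?cauchy_weight_ge0 // mulr_ge0 // exprn_ge0.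
have cos_norm : l1norm ((2 * kernel_transform cos (half_mixture alpha) v)%:C%C) =
    C * cauchy_weight alpha v.
  rewrite cosine_transform_half_mixture // /l1norm /= normr0 addr0 mulrA -/C.
  by rewrite ger0_norm // mulr_ge0 ?cauchy_weight_ge0.
rewrite cone_transformE //.
apply: (@le_trans _ _ (cauchy_weight alpha v * ((C * cauchy_weight alpha v) ^+ k.-1 *
    (K * cauchy_weight theta v) ^+ (d.+1 - k)))).
  rewrite ler_wpM2l ?cauchy_weight_ge0 //; apply: (le_trans (normr_Re_le _)).
  apply: (le_trans (l1normM _ _)); apply: ler_pM; rewrite ?l1norm_ge0 //.
    by rewrite -cos_norm l1normX.
  apply: (le_trans (l1normX _ _)); rewrite lerXn2r ?nnegrE ?l1norm_ge0 //.
  by rewrite mulr_ge0 ?cauchy_weight_ge0.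
have weightE : cauchy_weight p v = cauchy_weight alpha v * cauchy_weight alpha v ^+ k.-1 *
    cauchy_weight theta v ^+ (d.+1 - k).
  have -> : p = alpha + alpha * k.-1%:R + theta * (d.+1 - k)%:R.
    have kE : k%:R = k.-1%:R + 1 :> R by rewrite natr1 prednK //; case/andP: kd.
    by rewrite /p kE; ring.
  by rewrite 2!cauchy_weightD 2!cauchy_weightX.
rewrite [leRHS]mulrC weightE /M !exprMn le_eqVlt; apply/orP; left; apply/eqP.
by ring.
Qed.

End transform_bounds.

Section tangent_substitution.
Variable R : realType.
Local Notation mu := (@lebesgue_measure R).
Local Notation I := (`](- (pi / 2)), (pi / 2)[%classic : set R).
Implicit Types (a b x y : R) (H : R -> R).

Lemma atan_itv y : - (pi / 2) < atan y < pi / 2.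
Proof. by rewrite atan_gtNpi2 atan_ltpi2. Qed.

Lemma continuous_derive1_atan : continuous (derive1 (@atan R)).
Proof. by rewrite (funext (@derive1_atan R)); exact: continuous_oneDsqrV. Qed.

Lemma integral_atan_itv H a b : a <= b ->
  (forall x, - (pi / 2) < x < pi / 2 -> {for x, continuous H}) ->
  (\int[mu]_(x in `[atan a, atan b]) (H x)%:E =
   \int[mu]_(y in `[a, b]) (H (atan y) / (1 + y ^+ 2))%:E)%E.
Proof.
move=> ab cH; rewrite (@integration_by_substitution_increasing R atan H a b) //.
- by apply: eq_integral => y _; rewrite /= fctE derive1_atan.
- by move=> x y _ _; exact: lt_atan.
- by move=> x _; exact: continuous_derive1_atan.
- by apply/cvg_ex; eexists; apply: cvg_at_right_filter; exact: continuous_derive1_atan.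
- by apply/cvg_ex; eexists; apply: cvg_at_left_filter; exact: continuous_derive1_atan.
- split; first by move=> x _; exact: derivable_atan.
    by apply: cvg_at_right_filter; exact: continuous_atan.
  by apply: cvg_at_left_filter; exact: continuous_atan.
- apply: continuous_in_subspaceT => x; rewrite inE /= in_itv /= => /andP[ax xb].
  by apply: cH; rewrite (lt_le_trans (atan_gtNpi2 _) ax) (le_lt_trans xb (atan_ltpi2 _)).
Qed.

Lemma bigcup_itv_atan : I = \bigcup_n `[atan (- n%:R), atan n%:R]%classic.
Proof.
apply/seteqP; split => x /=.
  rewrite in_itv /= => xp; exists (Num.trunc `|tan x|).+1 => //=; rewrite in_itv /=.
  have xT : atan (tan x) = x by rewrite tanK // in_itv.
  have := ltW (truncnS_gt `|tan x|); rewrite ler_norml => /andP[lo hi].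
  by apply/andP; split; [rewrite -[leRHS]xT|rewrite -[leLHS]xT]; exact: le_atan.
move=> [n _]; rewrite /= !in_itv /= => /andP[lo hi].
by rewrite (lt_le_trans (atan_gtNpi2 _) lo) (le_lt_trans hi (atan_ltpi2 _)).
Qed.

Lemma bigcup_itv_nat : [set: R] = \bigcup_n `[- n%:R, n%:R]%classic.
Proof.
apply/seteqP; split => x //= _; exists (Num.trunc `|x|).+1 => //=.
by rewrite in_itv /= -ler_norml ltW // truncnS_gt.
Qed.

Lemma measurable_fun_itv_continuous H :
  (forall x, - (pi / 2) < x < pi / 2 -> {for x, continuous H}) -> measurable_fun I H.
Proof.
move=> cH; apply: open_continuous_measurable_fun; first exact: interval_open.
by move=> x; rewrite inE /= in_itv /= => xp; exact: cH.
Qed.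

Lemma continuous_comp_atan H :
  (forall x, - (pi / 2) < x < pi / 2 -> {for x, continuous H}) ->
  continuous (fun y => H (atan y) / (1 + y ^+ 2)).
Proof.
move=> cH y; apply: cvgM; last exact: continuous_oneDsqrV.
apply: (@continuous_comp _ _ _ (@atan R) H); first exact: continuous_atan.
exact/cH/atan_itv.
Qed.

Lemma ge0_integral_tan H : (forall x, 0 <= H x) ->
  (forall x, - (pi / 2) < x < pi / 2 -> {for x, continuous H}) ->
  (\int[mu]_(x in I) (H x)%:E = \int[mu]_y (H (atan y) / (1 + y ^+ 2))%:E)%E.
Proof.
move=> H0 cH; have mH := measurable_fun_itv_continuous cH.
have mG : measurable_fun setT (fun y => (H (atan y) / (1 + y ^+ 2))%:E).
  by apply/measurable_EFinP; apply: continuous_measurable_fun; exact: continuous_comp_atan.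
have cvg_I : (\int[mu]_(x in `[atan (- n%:R), atan n%:R]%classic) (H x)%:E @[n --> \oo] -->
    \int[mu]_(x in I) (H x)%:E)%E.
  rewrite bigcup_itv_atan.
  apply: (@ge0_nondecreasing_set_cvg_integral _ (measurableTypeR R) R _ (fun x => (H x)%:E) mu).
  - apply/nondecreasing_seqP => n; apply/subsetPset => x; rewrite /= !in_itv /= => /andP[lo hi].
    by rewrite (le_trans _ lo) ?(le_trans hi) // le_atan // ?lerN2 ler_nat.
  - by move=> n; exact: measurable_itv.
  - move=> n; apply/measurable_EFinP; apply: measurable_funS mH; first exact: measurable_itv.
    by rewrite bigcup_itv_atan => x xn; exists n.
  - by move=> n x _; rewrite lee_fin.
have cvg_T : (\int[mu]_(y in `[(- n%:R)%R, n%:R%R]%classic) (H (atan y) / (1 + y ^+ 2))%:E @[n --> \oo] -->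
    \int[mu]_y (H (atan y) / (1 + y ^+ 2))%:E)%E.
  rewrite bigcup_itv_nat; apply: (@ge0_nondecreasing_set_cvg_integral _ (measurableTypeR R) R _
    (fun y => (H (atan y) / (1 + y ^+ 2))%:E) mu).
  - apply/nondecreasing_seqP => n; apply/subsetPset => x; rewrite /= !in_itv /= => /andP[lo hi].
    by rewrite (le_trans _ lo) ?(le_trans hi) // ?lerN2 ler_nat.
  - by move=> n; exact: measurable_itv.
  - by move=> n; exact: measurable_funTS.
  - by move=> n y _; rewrite lee_fin divr_ge0 // ltW // one_plus_sqr_gt0.
have atanE n : (\int[mu]_(x in `[atan (- n%:R), atan n%:R]%classic) (H x)%:E =
    \int[mu]_(y in `[(- n%:R)%R, n%:R%R]%classic) (H (atan y) / (1 + y ^+ 2))%:E)%E.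
  by apply: integral_atan_itv => //; rewrite -subr_ge0 opprK addr_ge0.
move: cvg_I; rewrite (funext atanE) => cvg_I.
exact: cvg_unique cvg_I cvg_T.
Qed.

Lemma funepos_EFin (f : R -> R) x : ((EFin \o f)^\+ x = ((`|f x| + f x) / 2)%:E)%E.
Proof.
rewrite funeposE /= -EFin_max; congr EFin; case: (leP 0 (f x)) => fx.
  by rewrite ger0_norm //; field.
by rewrite ltr0_norm // addNr mul0r.
Qed.

Lemma funeneg_EFin (f : R -> R) x : ((EFin \o f)^\- x = ((`|f x| - f x) / 2)%:E)%E.
Proof.
rewrite funenegE /= -EFin_max; congr EFin; case: (leP 0 (- f x)) => fx.
  by rewrite ler0_norm -?oppr_ge0 //; field.
by rewrite gtr0_norm ?subrr ?mul0r // -oppr_lt0.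
Qed.

Lemma integral_tan H : (forall x, - (pi / 2) < x < pi / 2 -> {for x, continuous H}) ->
  (\int[mu]_(x in I) (H x)%:E = \int[mu]_y (H (atan y) / (1 + y ^+ 2))%:E)%E.
Proof.
move=> cH; rewrite integralE [RHS]integralE.
have part (e : R) : (forall x, 0 <= (`|H x| + e * H x) / 2) ->
    (\int[mu]_(x in I) ((`|H x| + e * H x) / 2)%:E = \int[mu]_y
      ((`|H (atan y) / (1 + y ^+ 2)| + e * (H (atan y) / (1 + y ^+ 2))) / 2)%:E)%E.
  move=> H0; rewrite (ge0_integral_tan H0) => [|x xp].
    apply: eq_integral => y _; have y0 := one_plus_sqr_gt0 y.
    rewrite normrM (gtr0_norm (x := (1 + y ^+ 2)^-1)) ?invr_gt0 //.
    by congr EFin; field; rewrite gt_eqF.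
  apply: cvgM; last exact: cvg_cst.
  by apply: cvgD; [apply: cvg_norm|apply: cvgM; first exact: cvg_cst]; exact: cH.
congr (_ - _)%E.
- under eq_integral do rewrite funepos_EFin -[X in _ + X]mul1r.
  rewrite part => [|x]; last by rewrite mul1r divr_ge0 // -lerBlDr sub0r -normrN ler_norm.
  by apply: eq_integral => y _; rewrite funepos_EFin mul1r.
- under eq_integral do rewrite funeneg_EFin -[X in _ + X]mulN1r.
  rewrite part => [|x]; last by rewrite mulN1r divr_ge0 // subr_ge0 ler_norm.
  by apply: eq_integral => y _; rewrite funeneg_EFin mulN1r.
Qed.

End tangent_substitution.

Section angle_integrand.
Variables (R : realType) (d : nat) (alpha : R).
Hypothesis alpha0 : 0 < alpha.
Hypothesis an1 : 1 < alpha * d.+1%:R.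
Local Notation mu := (@lebesgue_measure R).
Local Notation I := (`](- (pi / 2)), (pi / 2)[%classic : set R).
Local Notation an := (alpha * d.+1%:R).
Local Notation cn := (ct (an / 2)).
Implicit Types (k : nat) (x y : R).

Let an2 : 1 / 2 < an / 2. Proof. by rewrite ltr_pM2r ?invr_gt0. Qed.

Let cn_gt0 : 0 < cn. Proof. exact: ctd_gt0. Qed.

Definition angle_integrand k x : R[i] :=
  (cn * cos x `^ (an - 2))%:C%C * Complex 2^-1 (secant_integral alpha x) ^+ (d.+1 - k).

Lemma continuous_complexX (f g : R -> R) x m : {for x, continuous f} -> {for x, continuous g} ->
  {for x, continuous (fun y => complex.Re (Complex (f y) (g y) ^+ m))} /\
  {for x, continuous (fun y => complex.Im (Complex (f y) (g y) ^+ m))}.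
Proof.
move=> cf cg; elim: m => [|m [cRe cIm]]; first by split; exact: cvg_cst.
have ReE : (fun y => complex.Re (Complex (f y) (g y) ^+ m.+1)) = (fun y =>
    f y * complex.Re (Complex (f y) (g y) ^+ m) - g y * complex.Im (Complex (f y) (g y) ^+ m)).
  by apply/funext => y; rewrite exprS; case: (_ ^+ m).
have ImE : (fun y => complex.Im (Complex (f y) (g y) ^+ m.+1)) = (fun y =>
    f y * complex.Im (Complex (f y) (g y) ^+ m) + g y * complex.Re (Complex (f y) (g y) ^+ m)).
  by apply/funext => y; rewrite exprS; case: (_ ^+ m).
by rewrite ReE ImE; split; [apply: cvgB|apply: cvgD]; apply: cvgM.
Qed.

Lemma continuous_angle_integrand k x : - (pi / 2) < x < pi / 2 ->
  {for x, continuous (fun y => complex.Re (angle_integrand k y))} /\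
  {for x, continuous (fun y => complex.Im (angle_integrand k y))}.
Proof.
move=> xp; have c2 : {for x, continuous (fun=> 2^-1 : R)} by exact: cvg_cst.
have cS := is_derive1_continuous (is_derive_secant_integral alpha xp).
have [cRe cIm] := continuous_complexX (d.+1 - k) c2 cS.
have cc : {for x, continuous (fun y : R => cn * cos y `^ (an - 2))}.
  by apply: cvgM; [exact: cvg_cst|exact: continuous_cos_powR].
rewrite (funext (fun y => Re_real_mul _ _)) (funext (fun y => Im_real_mul _ _)).
by split; apply: cvgM.
Qed.

Lemma Rintegral_tan (f : R -> R) : (forall x, - (pi / 2) < x < pi / 2 -> {for x, continuous f}) ->
  \int[mu]_(x in `[(- (pi / 2)), (pi / 2)]) f x = \int[mu]_y (f (atan y) / (1 + y ^+ 2)).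
Proof.
move=> cf; have mf : measurable_fun I (EFin \o f).
  by apply/measurable_EFinP; exact: measurable_fun_itv_continuous.
rewrite /Rintegral -(integral_tan cf) -integral_itv_bndo_bndc.
  by rewrite -integral_itv_obnd_cbnd.
exact/emeasurable_fun_itv_obnd_cbndP.
Qed.

Lemma Rintegral_Im_angle_integrand k :
  \int[mu]_(x in `[(- (pi / 2)), (pi / 2)]) complex.Im (angle_integrand k x) = 0.
Proof.
have cIm x xp := (@continuous_angle_integrand k x xp).2.
rewrite Rintegral_tan //; apply: Rintegral_odd.
  by apply: continuous_measurable_fun; exact: (continuous_comp_atan cIm).
move=> y; rewrite sqrrN atanN !Im_real_mul cosN secant_integralN ?atan_itv //.
rewrite [Complex _ (- _)](_ : _ = (Complex 2^-1 (secant_integral alpha (atan y)))^*%C) //.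
rewrite -rmorphXn -mulNr -mulrN.
by case: (_ ^+ (d.+1 - k)).
Qed.

Lemma cos_atan_powR y p : cos (atan y) `^ p = (1 + y ^+ 2) `^ (- (p / 2)).
Proof. by rewrite -cauchy_weight_double -[in RHS](atanK y) cauchy_weight_tan ?atan_itv. Qed.

Lemma Rintegral_Re_angle_integrand_full :
  \int[mu]_(x in `[(- (pi / 2)), (pi / 2)]) complex.Re (angle_integrand d.+1 x) = 1.
Proof.
rewrite Rintegral_tan; last by move=> x xp; exact: (continuous_angle_integrand _ xp).1.
transitivity (\int[mu]_y (cn * (1 + y ^+ 2) `^ (- (an / 2)))).
  apply: eq_Rintegral => y _; have y0 := one_plus_sqr_gt0 y.
  rewrite /angle_integrand subnn expr0 mulr1 /= cos_atan_powR -mulrA; congr (_ * _).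
  by rewrite -[(1 + y ^+ 2)^-1]powR_inv1 ?(ltW y0) // -powRD_gt0 //; congr powR; field.
rewrite ge0_RintegralZl; [|by measurability|by nonneg].
by rewrite /Rintegral integral_powR_cauchy //= divff // gt_eqF.
Qed.

Local Notation G := (Num.sqrt pi * Gamma (alpha / 2)).

Let G_gt0 : 0 < G.
Proof. by rewrite mulr_gt0 ?sqrtr_gt0 ?pi_gt0 // Gamma_gt0 // divr_gt0. Qed.

Lemma cone_transform_tan k x : (0 < k <= d.+1)%N -> - (pi / 2) < x < pi / 2 ->
  cone_transform d alpha k (2 * tan x) =
  ((G * cos x `^ alpha) ^+ d)%:C%C * Complex 2^-1 (secant_integral alpha x) ^+ (d.+1 - k).
Proof.
move=> kd xp; have cosE : 2 * kernel_transform cos (half_mixture alpha) (2 * tan x) = G * cos x `^ alpha.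
  by rewrite (cosine_transform_half_mixture alpha0) (cauchy_weight_tan _ xp); field.
have kE : (k.-1 + (d.+1 - k) = d)%N by case: k kd => // k kd; rewrite /= subSS subnKC.
rewrite (cone_transformE alpha0 _ kd) cosE (fourier_transform_half_mixture_tan alpha0 xp).
by rewrite rmorphXn exprMn_comm ?mulrA -?exprD ?kE //; exact: mulrC.
Qed.

Lemma Re_angle_integrand_atan k y : (0 < k <= d.+1)%N ->
  complex.Re (angle_integrand k (atan y)) / (1 + y ^+ 2) = cn / G ^+ d *
  (cauchy_weight alpha (2 * y) * complex.Re (cone_transform d alpha k (2 * y))).
Proof.
move=> kd; have y0 := one_plus_sqr_gt0 y.
rewrite -{3 4}(atanK y) cone_transform_tan ?atan_itv // cauchy_weight_tan ?atan_itv //.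
rewrite !Re_real_mul [(G * _) ^+ d]exprMn; set z := complex.Re _; set c := cos (atan y).
have c0 : 0 < c by exact/cos_gt0_pihalf/atan_itv.
have -> : c `^ (an - 2) = (1 + y ^+ 2) * (c `^ alpha * c `^ alpha ^+ d).
  rewrite -{1}(atanK y) oneDtan2 ?atan_itv // -exprS powR_exprn -powRD_gt0 //.
  by congr powR; ring.
by field; rewrite expf_neq0 ?gt_eqF.
Qed.

Lemma cone_integral_angle_integrand : exists2 C : R, 0 < C & forall k, (0 < k <= d.+1)%N ->
  cone_integral d alpha k =
  (C * \int[mu]_(x in `[(- (pi / 2)), (pi / 2)]) complex.Re (angle_integrand k x))%:E.
Proof.
have sp0 : 0 < Num.sqrt (pi : R) by rewrite sqrtr_gt0 pi_gt0.
have Gd0 : 0 < G ^+ d by rewrite exprn_gt0.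
exists (Gamma (alpha / 2) / Num.sqrt pi * G ^+ d / cn).
  by rewrite divr_gt0 // mulr_gt0 // divr_gt0 // Gamma_gt0 // divr_gt0.
move=> k kd; have intQ := integrable_cone_transform alpha0 kd an1.
have two0 : (2 : R) != 0 by rewrite pnatr_eq0.
rewrite cone_integral_fourier // Rintegral_tan => [|x xp]; last first.
  exact: (continuous_angle_integrand _ xp).1.
under [in RHS]eq_Rintegral do rewrite Re_angle_integrand_atan //.
rewrite (RintegralZl _ measurableT (integrable_scale two0 intQ)) (Rintegral_scale two0 intQ) normr_nat.
by congr EFin; field; rewrite !gt_eqF.
Qed.

Lemma fine_expected_angle k : (0 < k <= d)%N ->
  fine (expected_angle d.+1 k ((alpha + d%:R) / 2)) =
  \int[mu]_(x in `[(- (pi / 2)), (pi / 2)]) complex.Re (angle_integrand k x).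
Proof.
move=> kd; have [C C0 coneE] := cone_integral_angle_integrand.
have := expected_angle_ratio alpha0 kd.
rewrite !coneE ?Rintegral_Re_angle_integrand_full ?mulr1 ?ltnSn //; last first.
  by case/andP: kd => -> /leqW.
move: (Rintegral _ _ _) (expected_angle _ _ _) => J [e| |] /=.
- by rewrite -EFinM => -[]; rewrite mulrC => /(mulfI (lt0r_neq0 C0)).
- by rewrite gt0_mulye.
- by rewrite gt0_mulNye.
Qed.

End angle_integrand.

Local Open Scope complex_scope.

Theorem theorem1p6 (R : realType) (alpha : R) (n k : nat) :
  0 < alpha -> (1 <= k <= n)%N -> 1 < alpha * n%:R ->
  (Jt n k ((alpha + n%:R - 1) / 2))%:C =
  ('C(n, k)%:R)%:C *
  cintegral (- (pi / 2)) (pi / 2)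
    (fun x : R =>
       (ct (alpha * n%:R / 2) * cos x `^ (alpha * n%:R - 2))%:C *
       (((1 / 2 : R))%:C
        + (@Complex R 0 1) * (oint 0 x (fun y => ct ((alpha + 1) / 2) * cos y `^ (- alpha)))%:C)
       ^+ (n - k)).
Proof.
move=> alpha0; case: n => [|d] /andP[k0 kn] an1; first by move: kn; rewrite leqNgt k0.
rewrite [X in cintegral _ _ X](_ : _ = angle_integrand d alpha k); last first.
  apply/funext => x; congr (_ * _ ^+ _); apply/eqP.
  by rewrite eq_complex /=; apply/andP; split; apply/eqP; rewrite -?/(secant_integral alpha x); ring.
rewrite /cintegral Rintegral_Im_angle_integrand mulr0 addr0 -rmorphM /=; congr (_ %:C).
rewrite /Jt; have [->|kd] := eqVneq k d.+1.
  by rewrite binn mul1r Rintegral_Re_angle_integrand_full.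
rewrite -fine_expected_angle ?k0 //; last by rewrite -ltnS ltn_neqAle kd kn.
by rewrite -natr1 addrA addrK.
Qed.
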